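(* Let $d\ge3$ and $1\le k\le\lfloor (d-1)/2\rfloor$. Let $\mu=\mu_1+\mu_2$ be a finite measure on $\mathbb{R}^d$, where $\mu_1$ is the ($k$-dimensional) area measure on a nonempty open subset of a smooth $k$-dimensional submanifold of $\mathbb{R}^d$, and $\mu_2$ is the ($(d-1)$-dimensional) area measure on a nonempty open subset $\Omega$ of a smooth hypersurface in $\mathbb{R}^d$ such that $\Omega$ contains a point at which the Gaussian curvature is non-zero. Then $L^2(\mu)$ does not admit a Fourier frame.
   Context: ''Smooth'' means $C^\infty$; the area measure is the surface (Hausdorff) measure induced by the embedding in $\mathbb{R}^d$, and the measures are assumed finite. For $\lambda\in\mathbb{R}^d$, $e_\lambda(x)=e^{2\pi i\langle\lambda,x\rangle}$. A countable $\Lambda\subset\mathbb{R}^d$ gives a Fourier frame $E(\Lambda)=\{e_\lambda\}_{\lambda\in\Lambda}$ for $L^2(\mu)$ if there are $0<A,B<\infty$ with $A\|f\|^2_{L^2(\mu)}\le\sum_{\lambda\in\Lambda}|\langle f,e_\lambda\rangle_{L^2(\mu)}|^2\le B\|f\|^2_{L^2(\mu)}$ for all $f\in L^2(\mu)$; ''$L^2(\mu)$ admits a Fourier frame'' means such a $\Lambda$ exists. *)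

(* Defs.v *)
From HB Require Import structures.
From mathcomp Require Import all_boot all_order all_algebra.
From mathcomp Require Import all_classical all_reals all_analysis.
Set Implicit Arguments. Unset Strict Implicit. Unset Printing Implicit Defensive.
Import Order.TTheory GRing.Theory Num.Theory.
Import numFieldNormedType.Exports.
Local Open Scope classical_set_scope.
Local Open Scope ring_scope.

Section Defs.
Variables (R : realType) (d : nat).
Notation V := 'rV[R]_d.

Definition ebase (i : 'I_d) : V := delta_mx 0 i.

Definition dotR (x y : V) : R := \sum_(i < d) x 0 i * y 0 i.
Definition edist (x y : V) : R := Num.sqrt (dotR (x - y) (x - y)).

Fixpoint iterD (l : seq 'I_d) (f : V -> R) : V -> R :=
  match l with
  | [::] => f
  | i :: l' => fun x => ('D_(ebase i) (iterD l' f) x : R^o)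
  end.

Definition smooth_on (U : set V) (f : V -> R) : Prop :=
  forall (l : seq 'I_d) (x : V), U x ->
    (forall i, derivable (iterD l f : V -> R^o) x (ebase i)) /\
    {for x, continuous (iterD l f : V -> R^o)}.

Definition jacobian (m : nat) (F : 'I_m -> V -> R) (x : V) : 'M[R]_(m, d) :=
  \matrix_(a < m, j < d) ('D_(ebase j) (F a : V -> R^o) x : R).

Definition local_defining (M : set V) (m : nat) (p : V) (U : set V)
  (F : 'I_m -> V -> R) : Prop :=
  [/\ open U, U p,
      (forall x, U x -> (M x <-> forall a, F a x = 0)),
      (forall a, smooth_on U (F a)) &
      (forall x, U x -> \rank (jacobian F x) = m)].

Definition smooth_submanifold (k : nat) (M : set V) : Prop :=
  (k <= d)%N /\
  forall p, M p -> exists (U : set V) (F : 'I_(d - k) -> V -> R),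
    local_defining M p U F.

Definition rel_open_nonempty (M O : set V) : Prop :=
  O !=set0 /\ exists W : set V, open W /\ O = M `&` W.

(* Gaussian curvature of a hypersurface with local defining function F at p:
   N = grad F / |grad F| is the Gauss map on U, DN(p) its Jacobian,
   n = N(p).  The matrix DN(p) P + n n^T (P = I - n n^T the projection on the
   tangent space T_p = n^perp) acts as the shape operator (Weingarten map) on
   T_p and as the identity on the normal line, so its determinant is the
   determinant of the shape operator, i.e. the Gaussian curvature (up to the
   sign convention for the normal). *)
Definition gradF (F : V -> R) (x : V) : V :=
  \row_(j < d) ('D_(ebase j) (F : V -> R^o) x : R).
Definition gauss_map (F : V -> R) (x : V) : V :=
  (Num.sqrt (dotR (gradF F x) (gradF F x)))^-1 *: gradF F x.
Definition gaussian_curvature (F : V -> R) (p : V) : R :=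
  let n : V := gauss_map F p in
  let DN : 'M[R]_d := jacobian (fun a : 'I_d => fun x => gauss_map F x 0 a) p in
  let P : 'M[R]_d := 1%:M - n^T *m n in
  \det (DN *m P + n^T *m n).

Definition nonzero_gauss_curv_in (M O : set V) : Prop :=
  exists p, O p /\ exists (U : set V) (F : 'I_1 -> V -> R),
    local_defining M p U F /\ gaussian_curvature (F ord0) p != 0.

Fixpoint ball_vol (s : nat) : R :=
  match s with
  | 0 => 1
  | 1 => 2
  | s'.+2 => (2 * pi / s%:R) * ball_vol s'
  end.

Definition ediam (A : set V) : \bar R :=
  ereal_sup ([set 0%E] `|` [set (edist x y)%:E | x in A & y in A]).

Definition hausdorff_delta (s : nat) (delta : R) (A : set V) : \bar R :=
  ereal_inf [set (\sum_(0 <= n <oo)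
                    ((ball_vol s / 2 ^+ s) * (fine (ediam (C n))) ^+ s)%:E)%E
            | C in [set C : nat -> set V |
                     A `<=` \bigcup_n C n /\
                     forall n, (ediam (C n) <= delta%:E)%E]].

Definition hausdorff (s : nat) (A : set V) : \bar R :=
  ereal_sup [set hausdorff_delta s delta A | delta in [set e : R | 0 < e]].

End Defs.

Definition Rd (R : realType) (d : nat) := g_sigma_algebraType (@open 'rV[R]_d).

Section L2.
Variables (R : realType) (d : nat).
Local Notation T := (Rd R d).
Variable (mu : {measure set T -> \bar R}).

(* a complex-valued function f = u + i v *)
Definition L2fun (u v : T -> R) : Prop :=
  [/\ measurable_fun setT u, measurable_fun setT v &
      (\int[mu]_x ((u x ^+ 2 + v x ^+ 2)%:E) < +oo)%E].

Definition L2norm2 (u v : T -> R) : \bar R :=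
  (\int[mu]_x ((u x ^+ 2 + v x ^+ 2)%:E))%E.

Definition phase (lam : 'rV[R]_d) (x : T) : R := 2 * pi * dotR lam x.

(* |<f, e_lambda>_{L^2(mu)}|^2 with  <f, e_lambda> = int f(x) e^{-2 pi i <lambda,x>} dmu *)
Definition fcoef2 (u v : T -> R) (lam : 'rV[R]_d) : R :=
  (Rintegral mu setT (fun x => u x * cos (phase lam x) + v x * sin (phase lam x))) ^+ 2
  + (Rintegral mu setT (fun x => v x * cos (phase lam x) - u x * sin (phase lam x))) ^+ 2.

Definition fourier_frame (Lam : set 'rV[R]_d) : Prop :=
  countable Lam /\
  exists A B : R, [/\ 0 < A, 0 < B &
    forall u v : T -> R, L2fun u v ->
      (A%:E * L2norm2 u v <= \esum_(lam in Lam) (fcoef2 u v lam)%:E)%E /\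
      (\esum_(lam in Lam) (fcoef2 u v lam)%:E <= B%:E * L2norm2 u v)%E].

Definition admits_fourier_frame : Prop := exists Lam, fourier_frame Lam.

End L2.

(* Main.v *)
(* Near a point of [U1] balls of radius [s] have mass at least [c s^k], so testing
   the upper frame bound on modulated indicators of small balls shows that a
   ball of radius [r] contains [O(r^k)] frequencies; as [k < d], there are
   arbitrarily large balls [B(xi, 8^J)] free of frequencies.  On the other hand,
   near a point of [Omega] with non-zero curvature, parametrise the hypersurface
   by [gam] and let [m] be the law of [gam (a (w + v))], with [w] uniform and [v]
   beta distributed on the unit cube.  Then [m <= C mu], and integrating by parts
   [N] times in [v], after Cauchy-Schwarz in [v],
     [|m^(lam)|^2 <= C (dl^(d-1) + (|lam| dl)^-N)]  for all [0 < dl <= 1].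
   With [g = dm/dmu] and [N = 4 k], the coefficients of [g e_xi] are
   [O(16^(-j k))] for [|lam - xi| >= 8^j], since [d - 1 >= 2 k]; there are
   [O(8^(j k))] frequencies with [|lam - xi| < 8^(j+1)], so the sum of the
   squared coefficients is [O(2^-J)], against the lower bound [A |g|_2^2 > 0]. *)

Require Import Defs.
From HB Require Import structures.
From mathcomp Require Import all_boot all_order all_algebra.
From mathcomp Require Import all_classical all_reals all_analysis.
From mathcomp Require Import measurable_realfun ring lra zify.
Set Implicit Arguments. Unset Strict Implicit. Unset Printing Implicit Defensive.
Import Order.TTheory GRing.Theory Num.Theory.
Import numFieldNormedType.Exports.
Local Open Scope classical_set_scope.
Local Open Scope ring_scope.

(** * Vectors, product laws and bounded measurable functions *)

Section rV_norm.
Variable R : realType.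

(** The sum [w + v] replaces a smooth cut-off. The beta density is a multiple of [(s (1 - s)) ^ N],
    so no boundary term survives the integrations by parts in [v]; the uniform [w] supplies the
    second copy over which the square is expanded. The gain comes from the difference of two phases:
    for a nearly normal [lam], non-zero curvature forces its derivative in some direction of [v] to
    be at least of order [|lam| |w - w'|], while the pairs with [|w - w'| <= dl] have probability
    [O(dl^(d-1))]. Hausdorff measure is only ever bounded from below: a bi-Lipschitz chart turns
    every cover of an image into a cover of a set of parameters by cubes. All constants have to be
    uniform in [lam], [w] and [w']; this is why regularity is stated for families over an arbitrary
    parameter type, with directions normalised so that the size of [lam] enters only as a frequency.
    The norm of row vectors is the maximum norm: balls are cubes, and coordinates can be changed one
    at a time without leaving them. *)

Lemma rV_norm_ge n (x : 'rV[R]_n) i : `|x 0 i| <= `|x|.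
Proof.
rewrite [leRHS]/Num.norm /= mx_normrE; apply/bigmax_geP; right => /=.
by exists (0, i).
Qed.

Lemma rV_norm_le n (x : 'rV[R]_n) c :
  0 <= c -> (forall i, `|x 0 i| <= c) -> `|x| <= c.
Proof.
move=> c0 xc; rewrite [leLHS]/Num.norm /= mx_normrE; apply/bigmax_leP; split=> //.
by move=> [i j] _ /=; rewrite ord1.
Qed.

Lemma rV_norm_lt n (x : 'rV[R]_n) c :
  0 < c -> (forall i, `|x 0 i| < c) -> `|x| < c.
Proof.
move=> c0 xc; rewrite [ltLHS]/Num.norm /= mx_normrE; apply/bigmax_ltP; split=> //.
by move=> [i j] _ /=; rewrite ord1.
Qed.

Lemma normr_mulmx_le n m (x : 'rV[R]_n) (A : 'M[R]_(n, m)) :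
  `|x *m A| <= `|x| * \sum_i \sum_j `|A i j|.
Proof.
have S0 i : 0 <= \sum_j `|A i j| by apply: sumr_ge0.
apply: rV_norm_le => [|j]; first by rewrite mulr_ge0 ?sumr_ge0.
rewrite mxE (le_trans (ler_norm_sum _ _ _))// mulr_sumr ler_sum// => i _.
rewrite normrM ler_pM// ?rV_norm_ge//.
by rewrite (bigD1 j)//= lerDl sumr_ge0.
Qed.

Lemma dotR_norm_le n (x y : 'rV[R]_n) : `|dotR x y| <= n%:R * `|x| * `|y|.
Proof.
rewrite /dotR (le_trans (ler_norm_sum _ _ _))//.
apply: (@le_trans _ _ (\sum_(i < n) `|x| * `|y|)).
  by apply: ler_sum => i _; rewrite normrM ler_pM ?rV_norm_ge.
by rewrite sumr_const card_ord -mulrA mulr_natl.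
Qed.

Lemma dotRBr n (x y z : 'rV[R]_n) : dotR x (y - z) = dotR x y - dotR x z.
Proof. by rewrite /dotR -sumrB; apply: eq_bigr => i _; rewrite !mxE mulrBr. Qed.

Lemma dotRBl n (x y z : 'rV[R]_n) : dotR (y - z) x = dotR y x - dotR z x.
Proof. by rewrite /dotR -sumrB; apply: eq_bigr => i _; rewrite !mxE mulrBl. Qed.

Lemma dotRZl n a (x y : 'rV[R]_n) : dotR (a *: x) y = a * dotR x y.
Proof. by rewrite /dotR mulr_sumr; apply: eq_bigr => i _; rewrite !mxE mulrA. Qed.

(** Diameters in the Hausdorff measure are Euclidean, whereas charts are controlled in the maximum
    norm; this comparison is the bridge. *)
Lemma edist_norm_ge n (x y : 'rV[R]_n) : `|x - y| <= Defs.edist x y.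
Proof.
apply: rV_norm_le => [|i]; first exact: sqrtr_ge0.
rewrite -sqrtr_sqr /Defs.edist ler_wsqrtr// /dotR (bigD1 i)//= expr2 lerDl sumr_ge0// => j _.
by rewrite -expr2 sqr_ge0.
Qed.

End rV_norm.

(** * Borel measurability of maps between row vectors *)

Section measurability.
Variable R : realType.

Lemma measurable_rV_continuous n m (f : 'rV[R]_n -> 'rV[R]_m) :
  continuous f -> @measurable_fun _ _ (Rd R n) (Rd R m) setT f.
Proof.
move=> cf; apply: (@measurability _ _ (Rd R n) (Rd R m) setT f (@open 'rV[R]_m)) => //.
move=> _ [B oB <-]; rewrite setTI; apply: sub_sigma_algebra.
exact: open_comp.
Qed.

Lemma measurable_rV_continuousR n (f : 'rV[R]_n -> R) :
  continuous f -> measurable_fun setT (f : Rd R n -> R).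
Proof.
move=> cf; apply: (measurability _ (RGenOpens.measurableE R)).
move=> _ [_ [a [b ->] <-]]; rewrite setTI; apply: sub_sigma_algebra.
by apply: (@open_comp _ _ f); [move=> x _; exact: cf|exact: interval_open].
Qed.

Lemma measurable_rV_coord n (i : 'I_n) :
  measurable_fun setT (fun x : Rd R n => (x : 'rV[R]_n) 0 i).
Proof. by apply: measurable_rV_continuousR => x; exact: coord_continuous. Qed.

Lemma rV_open_box n (O : set 'rV[R]_n) x : open O -> O x ->
  exists q : 'rV[rat]_n, exists e : rat, 
    (forall y : 'rV[R]_n, (forall i, `|y 0 i - ratr (q 0 i)| < ratr e) -> O y) /\
    (forall i, `|x 0 i - ratr (q 0 i)| < ratr e).
Proof.
rewrite openE => oO /oO; rewrite /interior => /nbhs_normP[r /= r0 rO].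
have [e /andP[e0 er]] : exists e : rat, 0 < (ratr e : R) < r / 2.
  have [e] := @rat_in_itvoo R 0 (r / 2) ltac:(by rewrite divr_gt0).
  by rewrite in_itv => ?; exists e.
have H i : exists q : rat, `|x 0 i - ratr q| < ratr e.
  have [q] := @rat_in_itvoo R (x 0 i) (x 0 i + ratr e) ltac:(by rewrite ltrDl).
  rewrite in_itv /= => /andP[q1 q2]; exists q; rewrite ltr_norml; apply/andP; split.
    by rewrite ltrBrDl ltrBlDr.
  by rewrite (lt_trans _ e0)// subr_lt0.
pose q := \row_i (projT1 (cid (H i))).
have Hq i : `|x 0 i - ratr (q 0 i)| < ratr e by rewrite mxE; case: cid.
exists q, e; split=> // y Hy; apply: rO => /=.
apply: rV_norm_lt => // i; rewrite !mxE.
rewrite (_ : x 0 i - y 0 i = (x 0 i - ratr (q 0 i)) - (y 0 i - ratr (q 0 i))); last by ring.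
by rewrite (le_lt_trans (ler_normB _ _))//; have := Hq i; have := Hy i; lra.
Qed.

(** The sigma-algebra of [Rd] is generated by the open sets. Each of these is a countable union of
    rational boxes, and the preimage of a box is a finite intersection of coordinate events. *)
Lemma measurable_rV d (T : measurableType d) n (f : T -> 'rV[R]_n) :
  (forall i, measurable_fun setT (fun t => f t 0 i)) ->
  @measurable_fun _ _ T (Rd R n) setT f.
Proof.
move=> mf; apply: (@measurability _ _ T (Rd R n) setT f (@open 'rV[R]_n)) => //.
move=> _ [W oW <-]; rewrite setTI.
pose box (qe : 'rV[rat]_n * rat) : set 'rV[R]_n :=
  [set y | forall i, `|y 0 i - ratr (qe.1 0 i)| < ratr qe.2].
(* A box not contained in [W] contributes the empty set, so that the union runs over a countable
   type. *)
pose F (qe : 'rV[rat]_n * rat) : set T :=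
  if `[< box qe `<=` W >] then f @^-1` box qe else set0.
have -> : f @^-1` W = \bigcup_qe F qe.
  apply/seteqP; split=> t /=.
    move=> /(rV_open_box oW)[q [e [sO xe]]]; exists (q, e) => //.
    by rewrite /F; case: asboolP.
  by move=> [qe _]; rewrite /F; case: asboolP => // + ?; apply.
apply: countable_bigcupT_measurable => // qe; rewrite /F; case: ifP => // _.
have -> : f @^-1` box qe =
    \bigcap_(i in [set: 'I_n]) ((fun t => f t 0 i) @^-1` (ball (ratr (qe.1 0 i) : R) (ratr qe.2))).
  apply/seteqP; split=> t /= H i; first by move=> _; rewrite /ball/= distrC; exact: H.
  by have := H i I; rewrite /ball/= distrC.
apply: fin_bigcap_measurable => // i _; rewrite -[X in measurable X]setTI.
by apply: mf => //; apply: open_measurable; exact: ball_open.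
Qed.

End measurability.

(** Completeness is what the fixed point argument of [near_id_inverse] rests on. *)
HB.instance Definition _ (R : realType) m n := Complete.on 'M[R]_(m, n).

(** * Powers of a law on the line *)

Section powprob.
Variable R : realType.

Definition rV_cons n (z : measurableTypeR R * Rd R n) : Rd R n.+1 :=
  \row_i oapp (fun j => (z.2 : 'rV[R]_n) 0 j) z.1 (unlift ord0 i).

Lemma rV_cons0 n z : (rV_cons z : 'rV[R]_n.+1) 0 ord0 = z.1.
Proof. by rewrite mxE unlift_none. Qed.

Lemma rV_consS n z i : (rV_cons z : 'rV[R]_n.+1) 0 (lift ord0 i) = (z.2 : 'rV[R]_n) 0 i.
Proof. by rewrite mxE liftK. Qed.

Lemma measurable_rV_cons n : measurable_fun setT (@rV_cons n).
Proof.
apply: measurable_rV => i; case: (unliftP ord0 i) => [j|] ->.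
  rewrite (_ : (fun _ => _) = (fun x : Rd R n => (x : 'rV[R]_n) 0 j) \o snd).
    by apply: measurableT_comp; [exact: measurable_rV_coord|exact: measurable_snd].
  by apply/funext => z; rewrite rV_consS.
rewrite (_ : (fun _ => _) = fst); first exact: measurable_fst.
by apply/funext => z; rewrite rV_cons0.
Qed.

HB.instance Definition _ n := isMeasurableFun.Build _ _ _ _ (@rV_cons n)
  (@measurable_rV_cons n).

(** The [n]-fold product law, carried to the Borel sigma-algebra of row vectors by [rV_cons]. Fubini
    for binary products then peels off one coordinate at a time. *)
Fixpoint powprob (pi : probability (measurableTypeR R) R) n : probability (Rd R n) R :=
  match n with
  | 0 => dirac (0 : Rd R 0)
  | n'.+1 => distribution (pi \x powprob pi n')%E (@rV_cons n')
  end.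

Lemma measurable_rV_box n (D : 'I_n -> set R) : (forall i, measurable (D i)) ->
  measurable [set x : Rd R n | forall i, D i ((x : 'rV[R]_n) 0%R i)].
Proof.
move=> mD; rewrite (_ : [set _ | _] = \bigcap_(i in [set: 'I_n])
    ((fun x : Rd R n => (x : 'rV[R]_n) 0 i) @^-1` D i)).
  apply: fin_bigcap_measurable => // i _; rewrite -[X in measurable X]setTI.
  exact: (measurable_rV_coord (n := n) i measurableT (mD i)).
by apply/seteqP; split=> x /= H i; [move=> _; exact: H|exact: (H i I)].
Qed.

Lemma powprob_box (pi : probability (measurableTypeR R) R) n (D : 'I_n -> set R) :
  (forall i, measurable (D i)) ->
  (powprob pi n [set x : Rd R n | forall i, D i ((x : 'rV[R]_n) 0%R i)] =
   \big[*%E/1]_(i < n) pi (D i))%E.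
Proof.
elim: n D => [|n IH] D mD.
  by rewrite big_ord0 /= diracE mem_set//= => -[].
rewrite big_ord_recl /= /distribution /pushforward.
rewrite (_ : _ @^-1` _ = D ord0 `*` [set x : Rd R n | forall i, D (lift ord0 i) ((x : 'rV[R]_n) 0%R i)]).
  rewrite product_measure1E//.
  - by congr (_ * _)%E; exact: (IH (fun i => D (lift ord0 i))).
  - exact: mD.
  - exact: (measurable_rV_box (fun i => mD (lift ord0 i))).
apply/seteqP; split => -[s x] /= H.
  by split => [|i]; [have := H ord0; rewrite rV_cons0|have := H (lift ord0 i); rewrite rV_consS].
by move=> i; case: (unliftP ord0 i) => [j|] ->; [rewrite rV_consS; exact: H.2|rewrite rV_cons0; exact: H.1].
Qed.

Lemma powprob_box_le (pi : probability (measurableTypeR R) R) n (c : R) (D : 'I_n -> set R) :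
  (forall i, measurable (D i)) -> (forall i, (pi (D i) <= c%:E)%E) ->
  (powprob pi n [set x : Rd R n | forall i, D i ((x : 'rV[R]_n) 0%R i)] <= (c ^+ n)%:E)%E.
Proof.
move=> mD Dc; rewrite powprob_box//.
elim: n D mD Dc => [|n IH] D mD Dc; first by rewrite big_ord0.
by rewrite big_ord_recl exprS EFinM lee_pmul ?prode_ge0 ?IH.
Qed.

Lemma powprob_box_eq (pi : probability (measurableTypeR R) R) n (c : R) (D : 'I_n -> set R) :
  (forall i, measurable (D i)) -> (forall i, pi (D i) = c%:E) ->
  (powprob pi n [set x : Rd R n | forall i, D i ((x : 'rV[R]_n) 0%R i)] = (c ^+ n)%:E)%E.
Proof.
move=> mD Dc; rewrite powprob_box//; under eq_bigr do rewrite Dc.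
by rewrite prodEFin prodr_const card_ord.
Qed.

End powprob.

(** * Integration of bounded measurable functions *)

Section bounded_measurable.
Context (R : realType).

(** Such functions are integrable for every finite measure and stable under the operations used
    below, so this one predicate justifies all linearity and Fubini steps. *)
Definition bmeas d (T : measurableType d) (f : T -> R) :=
  measurable_fun setT f /\ exists C, forall x, `|f x| <= C.

Lemma bmeas_integrable d (T : measurableType d)
    (mu : {finite_measure set T -> \bar R}) (f : T -> R) :
  bmeas f -> mu.-integrable setT (EFin \o f).
Proof.
move=> [mf [C fC]]; apply: (@le_integrable _ _ _ mu setT _ _ (cst C%:E)) => //.
- exact/measurable_EFinP.
- by move=> x _ /=; rewrite lee_fin (le_trans (fC x))// ler_norm.
- exact: finite_measure_integrable_cst.
Qed.

Lemma bmeas_comp d1 d2 (T1 : measurableType d1) (T2 : measurableType d2)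
    (g : T1 -> T2) (f : T2 -> R) :
  measurable_fun setT g -> bmeas f -> bmeas (f \o g).
Proof.
move=> mg [mf [C fC]]; split; first exact: measurableT_comp.
by exists C => x; exact: fC.
Qed.

Lemma bmeasM d (T : measurableType d) (f g : T -> R) :
  bmeas f -> bmeas g -> bmeas (fun x => f x * g x).
Proof.
move=> [mf [C fC]] [mg [D gD]]; split; first exact: measurable_funM.
by exists (C * D) => x; rewrite normrM ler_pM.
Qed.

Lemma bmeasD d (T : measurableType d) (f g : T -> R) :
  bmeas f -> bmeas g -> bmeas (fun x => f x + g x).
Proof.
move=> [mf [C fC]] [mg [D gD]]; split; first exact: measurable_funD.
by exists (C + D) => x; rewrite (le_trans (ler_normD _ _))// lerD.
Qed.

Lemma bmeas_cos d (T : measurableType d) (f : T -> R) :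
  measurable_fun setT f -> bmeas (fun x => cos (f x)).
Proof.
move=> mf; split; last first.
  by exists 1 => x; rewrite ler_norml cos_geN1 cos_le1.
by apply: (measurableT_comp (f := cos)) => //; apply: continuous_measurable_fun;
  exact: continuous_cos.
Qed.

Lemma bmeas_sin d (T : measurableType d) (f : T -> R) :
  measurable_fun setT f -> bmeas (fun x => sin (f x)).
Proof.
move=> mf; split; last first.
  by exists 1 => x; rewrite ler_norml sin_geN1 sin_le1.
by apply: (measurableT_comp (f := sin)) => //; apply: continuous_measurable_fun;
  exact: continuous_sin.
Qed.

Lemma bmeas_indic d (T : measurableType d) (D : set T) :
  measurable D -> bmeas (\1_D : T -> R).
Proof.
move=> mD; split; first exact: measurable_indic.
by exists 1 => x; rewrite indicE; case: (_ \in _); rewrite ?normr1 ?normr0.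
Qed.

Lemma bmeas_cst d (T : measurableType d) (c : R) : bmeas (fun _ : T => c).
Proof. by split; [exact: measurable_cst|exists `|c|]. Qed.

Lemma bmeasZ d (T : measurableType d) (c : R) (f : T -> R) :
  bmeas f -> bmeas (fun x => c * f x).
Proof. by apply: bmeasM; exact: bmeas_cst. Qed.

Lemma bmeasN d (T : measurableType d) (f : T -> R) :
  bmeas f -> bmeas (fun x => - f x).
Proof.
by move=> /(bmeasZ (-1)); under eq_fun do rewrite mulN1r.
Qed.

Lemma Rintegral_cst1 d (T : measurableType d) (P : probability T R) (c : R) :
  Rintegral P setT (fun=> c) = c.
Proof.
transitivity (c * fine (P setT)); first exact: Rintegral_cst.
by rewrite probability_setT mulr1.
Qed.

Lemma Rintegral_le_ae d (T : measurableType d) (P : probability T R) (f : T -> R)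
    (D : set T) C :
  measurable D -> P D = 1%E -> bmeas f -> (forall x, D x -> f x <= C) ->
  Rintegral P setT f <= C.
Proof.
move=> mD PD bf fC; have [mf [M fM]] := bf.
(* Off [D] the majorant [h] is at least [M]; its integral is [C] because the complement of [D] is
   null. *)
pose h x := C + (M + `|C|) * \1_(~` D) x.
have b1 : bmeas (\1_(~` D) : T -> R) by apply: bmeas_indic; exact: measurableC.
have bh : bmeas h by apply: bmeasD; [exact: bmeas_cst|exact: bmeasZ].
apply: (@le_trans _ _ (Rintegral P setT h)).
  apply: le_Rintegral => //; [exact: bmeas_integrable|exact: bmeas_integrable|].
  move=> x _; rewrite /h indicE; case: (boolP (x \in ~` D)) => [_|].
    by rewrite mulr1; have := ler_norm (f x); have := fM x; have := ler_norm (- C); rewrite normrN; lra.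
  by rewrite in_setC negbK mulr0 addr0 inE => /fC.
rewrite RintegralD//; [|by apply: bmeas_integrable; exact: bmeas_cst|by apply: bmeas_integrable; exact: bmeasZ].
rewrite Rintegral_cst1 RintegralZl//; last exact: bmeas_integrable.
rewrite [X in _ + _ * X](_ : _ = 0) ?mulr0 ?addr0//.
by rewrite /Rintegral integral_indic//=; [rewrite setIT probability_setC// PD subee|exact: measurableC].
Qed.

Lemma Rintegral_norm_le_ae d (T : measurableType d) (P : probability T R) (f : T -> R)
    (D : set T) C :
  measurable D -> P D = 1%E -> bmeas f -> (forall x, D x -> `|f x| <= C) ->
  `|Rintegral P setT f| <= C.
Proof.
move=> mD PD bf fC; rewrite ler_norml; apply/andP; split.
  rewrite lerNl -mulN1r -RintegralZl//; last exact: bmeas_integrable.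
  apply: (Rintegral_le_ae mD PD); first exact: bmeasZ.
  by move=> x /fC; rewrite mulN1r => /ler_normlP[].
by apply: (Rintegral_le_ae mD PD) => // x /fC /ler_normlP[].
Qed.

Lemma bmeas_Rintegral1 d1 d2 (T1 : measurableType d1) (T2 : measurableType d2)
    (P2 : probability T2 R) (f : T1 * T2 -> R) :
  bmeas f -> bmeas (fun x => Rintegral P2 setT (fun y => f (x, y))).
Proof.
move=> bf; have [mf [C fC]] := bf; split; last first.
  exists C => x; apply: (Rintegral_norm_le_ae measurableT (probability_setT _)) => //.
  split; last by exists C.
  exact: measurable_fun_pair2.
(* Tonelli gives measurability for nonnegative integrands, hence the shift by [C]. *)
pose g z := f z + C.
have g0 z : 0 <= g z by rewrite -lerBlDr sub0r; have := fC z; rewrite ler_norml => /andP[].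
have bfx x : bmeas (fun y => f (x, y)).
  by apply: (@bmeas_comp _ _ _ _ (pair x)) => //; exact: pair1_measurable.
rewrite (_ : (fun _ => _) = (fun x => Rintegral P2 setT (fun y => g (x, y)) - C)).
  apply: measurable_funB => //; apply: measurableT_comp => //.
  apply: (@measurable_fun_fubini_tonelli_F _ _ _ _ _ P2 (EFin \o g)) => //.
  by apply/measurable_EFinP; apply: measurable_funD.
apply/funext => x; rewrite RintegralD// ?Rintegral_cst1 ?addrK//.
  exact: bmeas_integrable.
by apply: bmeas_integrable; exact: bmeas_cst.
Qed.

Lemma Rintegral_prod1 d1 d2 (T1 : measurableType d1) (T2 : measurableType d2)
    (P1 : probability T1 R) (P2 : probability T2 R) (f : T1 * T2 -> R) :
  bmeas f ->
  Rintegral (P1 \x P2)%E setT f =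
  Rintegral P1 setT (fun x => Rintegral P2 setT (fun y => f (x, y))).
Proof.
move=> bf; have if_ : (P1 \x P2)%E.-integrable setT (EFin \o f) by exact: (@bmeas_integrable _ _ ((P1 \x P2)%E : probability _ R)).
rewrite /Rintegral -(integral12_prod_meas1 if_); congr fine.
apply: eq_integral => x _; rewrite /fubini_F fineK//.
apply: integrable_fin_num => //.
apply: (@bmeas_integrable _ _ _ (fun y => f (x, y))).
by apply: (@bmeas_comp _ _ _ _ (pair x)) => //; exact: pair1_measurable.
Qed.

Lemma Rintegral_prod2 d1 d2 (T1 : measurableType d1) (T2 : measurableType d2)
    (P1 : probability T1 R) (P2 : probability T2 R) (f : T1 * T2 -> R) :
  bmeas f ->
  Rintegral (P1 \x P2)%E setT f =
  Rintegral P2 setT (fun y => Rintegral P1 setT (fun x => f (x, y))).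
Proof.
move=> bf; have if_ : (P1 \x P2)%E.-integrable setT (EFin \o f) by exact: (@bmeas_integrable _ _ ((P1 \x P2)%E : probability _ R)).
rewrite /Rintegral -(integral21_prod_meas1 if_); congr fine.
apply: eq_integral => x _; rewrite /fubini_G fineK//.
apply: integrable_fin_num => //.
apply: (@bmeas_integrable _ _ _ (fun y => f (y, x))).
by apply: (@bmeas_comp _ _ _ _ (fun y => (y, x))) => //; exact: pair2_measurable.
Qed.

Lemma Rintegral_distribution d1 d2 (T1 : measurableType d1) (T2 : measurableType d2)
    (P : probability T1 R) (X : {mfun T1 >-> T2}) (f : T2 -> R) :
  bmeas f ->
  Rintegral (distribution P X) setT f = Rintegral P setT (f \o X).
Proof.
move=> bf; have [mf _] := bf; rewrite /Rintegral integral_distribution//.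
  exact/measurable_EFinP.
by apply: bmeas_integrable; apply: bmeas_comp bf; exact: measurable_funPT.
Qed.

End bounded_measurable.

Section powprob_average.
Variables (R : realType) (pi : probability (measurableTypeR R) R) (D : set R).
Hypotheses (mD : measurable (D : set (measurableTypeR R))) (piD : pi D = 1%E).

Definition rV_upd n (x : 'rV[R]_n) (j : 'I_n) (s : R) : 'rV[R]_n :=
  \row_i if i == j then s else x 0 i.

Lemma rV_upd_cons0 n (s t : R) (y : 'rV[R]_n) :
  rV_upd (rV_cons (s, y)) ord0 t = rV_cons (t, y).
Proof.
apply/rowP => i; rewrite mxE; case: (unliftP ord0 i) => [j|] ->.
  by rewrite !rV_consS.
by rewrite eqxx !rV_cons0.
Qed.

Lemma rV_upd_consS n (s t : R) (y : 'rV[R]_n) j :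
  rV_upd (rV_cons (s, y)) (lift ord0 j) t = rV_cons (s, rV_upd y j t).
Proof.
apply/rowP => i; rewrite mxE; case: (unliftP ord0 i) => [k|] ->.
  by rewrite !rV_consS mxE (inj_eq (@lift_inj _ _)).
by rewrite (negbTE (neq_lift _ _)) !rV_cons0.
Qed.

Lemma powprob_cube n : powprob pi n [set x | forall i, D ((x : 'rV[R]_n) 0 i)] = 1%E.
Proof.
by have := @powprob_box_eq _ pi n 1 (fun=> D); rewrite expr1n; apply.
Qed.

(* Integrate first in the [j]-th variable. *)
Lemma powprob_average n (f : Rd R n -> R) (j : 'I_n) C : bmeas f ->
  (forall x : 'rV[R]_n, (forall i, D (x 0 i)) ->
    `|Rintegral pi setT (fun s => f (rV_upd x j s))| <= C) ->
  `|Rintegral (powprob pi n) setT f| <= C.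
Proof.
elim: n f j => [f []//|n IH] f j bf fC.
have mDn m : measurable [set x : Rd R m | forall i, D ((x : 'rV[R]_m) 0 i)].
  exact: (@measurable_rV_box _ m (fun=> D)).
have D0 : exists s, D s.
  apply: contrapT => /forallNP D0; move: piD; rewrite (_ : D = set0).
    by rewrite measure0 => /eqP; rewrite eqe eq_sym oner_eq0.
  by apply/seteqP; split => // x /D0.
rewrite /= Rintegral_distribution//.
have bc : bmeas (f \o @rV_cons R n) by apply: bmeas_comp bf; exact: measurable_rV_cons.
case: (unliftP ord0 j) => [k|] jE; subst j.
  rewrite Rintegral_prod1//.
  apply: (Rintegral_norm_le_ae mD piD) => [|s Ds]; first exact: (bmeas_Rintegral1 _ bc).
  apply: (IH (fun y => (f \o @rV_cons R n) (s, y)) k).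
    by apply: (@bmeas_comp _ _ _ _ _ (pair s)) => //; exact: pair1_measurable.
  move=> y Dy; under eq_Rintegral do rewrite /= -rV_upd_consS.
  apply: fC => i; case: (unliftP ord0 i) => [l|] ->.
    by rewrite rV_consS; exact: Dy.
  by rewrite rV_cons0.
rewrite Rintegral_prod2//.
apply: (Rintegral_norm_le_ae (mDn n) (powprob_cube n)) => [|y Dy].
  apply: (@bmeas_Rintegral1 _ _ _ _ _ pi (fun z => f (rV_cons (z.2, z.1)))).
  apply: (@bmeas_comp _ _ _ _ _ (fun z => (z.2, z.1)) _ _ bc).
  by apply: measurable_fun_pair; [exact: measurable_snd|exact: measurable_fst].
(* [s0] is a placeholder in the coordinate that [rV_upd] overwrites; it has to lie in [D] because
   [fC] speaks of points of the cube. *)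
have [s0 Ds0] := D0.
under eq_Rintegral do rewrite /= -(rV_upd_cons0 s0).
apply: fC => i; case: (unliftP ord0 i) => [l|] ->.
  by rewrite rV_consS; exact: Dy.
by rewrite rV_cons0.
Qed.

End powprob_average.

(** * One-dimensional oscillatory integrals *)

Section regular_families.
Variable R : realType.

(* Regularity of order [N] on [0, 1], uniformly in the parameter [p]. *)
Fixpoint Sreg (T : Type) (N : nat) (g : T -> R -> R) : Prop :=
  (exists C : R, forall p (s : R), 0 <= s <= 1 -> `|g p s| <= C) /\
  match N with
  | 0 => forall p (s : R), 0 <= s <= 1 -> {for s, continuous (g p)}
  | N'.+1 => exists g' : T -> R -> R, (forall p (s : R), 0 <= s <= 1 -> is_derive s 1 (g p) (g' p s)) /\
             Sreg N' g'
  end.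

Lemma Sreg_bounded (T : Type) N (g : T -> R -> R) :
  Sreg N g -> exists2 C, 0 < C & forall p (s : R), 0 <= s <= 1 -> `|g p s| <= C.
Proof.
case: N => [|N] [[C gC] _]; exists (`|C| + 1) => [|p s s01]; rewrite ?ltr_wpDl//;
 by rewrite (le_trans (gC p s s01))// (le_trans (ler_norm _))// lerDl.
Qed.

Lemma is_derive1_continuous (f : R -> R) (s df : R) :
  is_derive s 1 f df -> {for s, continuous f}.
Proof. by case=> /derivable1_diffP/differentiable_continuous. Qed.

Lemma Sreg_continuous (T : Type) N (g : T -> R -> R) :
  Sreg N g -> forall p (s : R), 0 <= s <= 1 -> {for s, continuous (g p)}.
Proof.
case: N => [[]//|N [_ [g' [dg _]]] p s s01].
exact: is_derive1_continuous (dg p s s01).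
Qed.

Lemma SregW (T : Type) N (g : T -> R -> R) : Sreg N.+1 g -> Sreg N g.
Proof.
elim: N g => [|N IH] g; last first.
  by move=> [bg [g' [dg Sg]]]; split=> //; exists g'; split=> //; exact: IH.
by move=> Sg; split; [case: Sg|exact: Sreg_continuous Sg].
Qed.

Lemma Sreg_param (T : Type) N (c : T -> R) C :
  (forall p, `|c p| <= C) -> Sreg N (fun p _ => c p).
Proof.
elim: N c C => [|N IH] c C cC; split; try by exists C.
  by move=> p s _; exact: cst_continuous.
exists (fun _ _ => 0); split; first by move=> p s _; exact: is_derive_cst.
by apply: (IH (fun=> 0) 0) => p; rewrite normr0.
Qed.

Lemma Sreg_cst (T : Type) N (c : R) : Sreg N (fun (_ : T) _ => c).
Proof. exact: (@Sreg_param T N (fun=> c) `|c|). Qed.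

Lemma Sreg_id (T : Type) N : Sreg N (fun (_ : T) s => s).
Proof.
have b : exists C, forall (p : T) s, 0 <= s <= 1 -> `|s| <= C :> R.
  by exists 1 => p s /andP[s0 s1]; rewrite ger0_norm.
case: N => [|N]; split=> //; first by move=> p s _; exact: cvg_id.
exists (fun _ _ => 1); split; first by move=> p s _; exact: is_derive_id.
exact: Sreg_cst.
Qed.

Lemma SregD (T : Type) N (f g : T -> R -> R) :
  Sreg N f -> Sreg N g -> Sreg N (fun p s => f p s + g p s).
Proof.
elim: N f g => [|N IH] f g [[C fC] Sf] [[D gD] Sg].
  split; first by exists (C + D) => p s s01; rewrite (le_trans (ler_normD _ _))// lerD ?fC ?gD.
  by move=> p s s01; apply: continuousD; [exact: Sf|exact: Sg].
move: Sf Sg => [f' [df Sf]] [g' [dg Sg]].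
split; first by exists (C + D) => p s s01; rewrite (le_trans (ler_normD _ _))// lerD ?fC ?gD.
exists (fun p s => f' p s + g' p s); split; last exact: IH.
by move=> p s s01; have := df p s s01; have := dg p s s01 => ? ?; exact: is_deriveD.
Qed.

Lemma SregM (T : Type) N (f g : T -> R -> R) :
  Sreg N f -> Sreg N g -> Sreg N (fun p s => f p s * g p s).
Proof.
elim: N f g => [|N IH] f g Sf0 Sg0.
  move: Sf0 Sg0 => [[C fC] Sf] [[D gD] Sg].
  split; first by exists (C * D) => p s s01; rewrite normrM ler_pM ?fC ?gD.
  by move=> p s s01; apply: continuousM; [exact: Sf|exact: Sg].
move: (Sf0) (Sg0) => [[C fC] [f' [df Sf]]] [[D gD] [g' [dg Sg]]].
split; first by exists (C * D) => p s s01; rewrite normrM ler_pM ?fC ?gD.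
exists (fun p s => f p s * g' p s + g p s * f' p s); split; last first.
  by apply: SregD; apply: IH => //; exact: SregW.
by move=> p s s01; have := df p s s01; have := dg p s s01 => ? ?; exact: is_deriveM.
Qed.

Lemma SregV (T : Type) N (q : T -> R -> R) (c : R) : 0 < c ->
  (forall p (s : R), 0 <= s <= 1 -> c <= `|q p s|) ->
  Sreg N q -> Sreg N (fun p s => (q p s)^-1).
Proof.
move=> c0 qc.
have q0 p (s : R) : 0 <= s <= 1 -> q p s != 0.
  by move=> s01; rewrite -normr_gt0 (lt_le_trans c0)// qc.
have b : exists C : R, forall p (s : R), 0 <= s <= 1 -> `|(q p s)^-1| <= C.
  exists c^-1 => p s s01; rewrite normfV lef_pV2 ?qc// posrE.
  by rewrite normr_gt0 q0.
elim: N => [|N IH] Sq; split=> //.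
  by move=> p s s01; apply: continuousV; [exact: q0|exact: Sreg_continuous Sq _ _ s01].
have [_ [q' [dq Sq']]] := Sq.
exists (fun p s => - 1 * ((q p s)^-1 * (q p s)^-1) * q' p s); split.
  move=> p s s01; apply: (is_derive_eq (is_deriveV (q0 p s s01) (dq p s s01))).
  by rewrite /GRing.scale /= mulN1r expr2 invfM.
by apply: SregM => //; apply: SregM; [exact: Sreg_cst|apply: SregM; apply: IH; exact: SregW].
Qed.

End regular_families.

(** * Integration by parts against a weight vanishing at the endpoints *)

Section oscillatory.
Variable R : realType.
Notation mu := (@lebesgue_measure R).

Lemma continuous_within (f : R -> R) :
  (forall s : R, 0 <= s <= 1 -> {for s, continuous f}) -> {within `[0, 1], continuous f}.
Proof.
move=> cf; apply/continuous_in_subspaceT => s; rewrite inE /= in_itv /=.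
exact: cf.
Qed.

Lemma integral_derive01 (F f : R -> R) :
  (forall s : R, 0 <= s <= 1 -> is_derive s 1 F (f s)) ->
  (forall s : R, 0 <= s <= 1 -> {for s, continuous f}) ->
  Rintegral mu `[0, 1] f = F 1 - F 0.
Proof.
move=> dF cf.
have cF (s : R) : 0 <= s <= 1 -> {for s, continuous F}.
  by move=> s01; exact: is_derive1_continuous (dF s s01).
rewrite /Rintegral (continuous_FTC2 (F := F) ltr01)//.
- exact: continuous_within.
- split.
  + move=> s; rewrite in_itv /= => /andP[s0 s1].
    by have [] := dF s _; rewrite ?ltW.
  + by apply: cvg_at_right_filter; apply: cF; rewrite lexx ler01.
  + by apply: cvg_at_left_filter; apply: cF; rewrite lexx ler01.
- move=> s; rewrite in_itv /= => /andP[s0 s1]; rewrite derive1E.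
  by have [] := dF s _; rewrite ?ltW.
Qed.

Lemma continuous_integrable01 (f : R -> R) :
  (forall s : R, 0 <= s <= 1 -> {for s, continuous f}) ->
  mu.-integrable `[0, 1] (EFin \o f).
Proof.
move=> cf; apply: continuous_compact_integrable; first exact: segment_compact.
exact: continuous_within.
Qed.

Lemma Rintegral01_norm_le (f : R -> R) C :
  (forall s : R, 0 <= s <= 1 -> {for s, continuous f}) ->
  (forall s : R, 0 <= s <= 1 -> `|f s| <= C) ->
  `|Rintegral mu `[0, 1] f| <= C.
Proof.
move=> cf fC; have if_ := continuous_integrable01 cf.
apply: (le_trans (le_normr_Rintegral _ if_)) => //.
have -> : C = Rintegral mu `[0, 1] (fun=> C).
  rewrite Rintegral_cst//= lebesgue_measure_itv/= lte_fin ltr01 //=.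
  by rewrite oppr0 addr0 mulr1.
apply: le_Rintegral => //.
- exact: integrable_norm.
- by apply: continuous_integrable01 => s _; exact: cst_continuous.
Qed.

(* Each integration by parts trades one of the [N] zeros of the weight at the
   endpoints for a factor [1 / t]. *)
Lemma oscillatory_decay (T : Type) N (c q Q : T -> R -> R) (c0 : R) :
  0 < c0 -> Sreg N c -> Sreg N q ->
  (forall p (s : R), 0 <= s <= 1 -> c0 <= `|q p s|) ->
  (forall p (s : R), 0 <= s <= 1 -> is_derive s 1 (Q p) (q p s)) ->
  exists C, forall p (t : R), 0 < t ->
    `|Rintegral mu `[0, 1] (fun s => (s * (1 - s)) ^+ N * c p s * cos (t * Q p s))| <= C / t ^+ N /\
    `|Rintegral mu `[0, 1] (fun s => (s * (1 - s)) ^+ N * c p s * sin (t * Q p s))| <= C / t ^+ N.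
Proof.
move=> c00 + + qc dQ.
have cQ p (s : R) : 0 <= s <= 1 -> {for s, continuous (Q p)}.
  by move=> s01; exact: is_derive1_continuous (dQ p s s01).
have ccos p t (s : R) : 0 <= s <= 1 -> {for s, continuous (fun s => cos (t * Q p s))}.
  move=> s01; apply: (continuous_comp (f := fun s => t * Q p s)) (@continuous_cos R _).
  by apply: continuousM; [exact: cst_continuous|exact: cQ].
have csin p t (s : R) : 0 <= s <= 1 -> {for s, continuous (fun s => sin (t * Q p s))}.
  move=> s01; apply: (continuous_comp (f := fun s => t * Q p s)) (@continuous_sin R _).
  by apply: continuousM; [exact: cst_continuous|exact: cQ].
have cw N' (a : T -> R -> R) : Sreg N' a -> forall n p (s : R), 0 <= s <= 1 ->
    {for s, continuous (fun s : R => (s * (1 - s)) ^+ n * a p s)}.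
  move=> Sa n p s s01; apply: continuousM; last exact: Sreg_continuous Sa _ _ s01.
  apply: (continuous_comp (f := fun s : R => s * (1 - s)) (g := fun y => y ^+ n)); last exact: exprn_continuous.
  by apply: continuousM; [exact: cvg_id|apply: continuousB; [exact: cst_continuous|exact: cvg_id]].
elim: N c => [|N IH] c Sc Sq.
  have [C C0 cC] := Sreg_bounded Sc.
  exists C => p t t0; rewrite expr0 divr1; split; apply: Rintegral01_norm_le => s s01.
  - by apply: continuousM; [exact: cw Sc _ _ _ s01|exact: ccos].
  - rewrite expr0 mul1r normrM (le_trans _ (cC p s s01))// ler_piMr//.
    by rewrite ler_norml cos_geN1 cos_le1.
  - by apply: continuousM; [exact: cw Sc _ _ _ s01|exact: csin].
  - rewrite expr0 mul1r normrM (le_trans _ (cC p s s01))// ler_piMr//.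
    by rewrite ler_norml sin_geN1 sin_le1.
have Se : Sreg N.+1 (fun p s => c p s * (q p s)^-1) by apply: SregM => //; exact: (SregV c00).
have [_ [e' [de Se']]] := Se.
set e := (fun p s => c p s * (q p s)^-1) in Se de.
(* With [e = c / q], the derivative of [(s (1 - s)) ^+ N.+1 * e] is [(s (1 - s)) ^+ N * c']. The
   negations are written as products so that [SregD] and [SregM] apply. *)
pose c' p s := N.+1%:R * (1 + -1 * (s + s)) * e p s + s * (1 + -1 * s) * e' p s.
have Sc' : Sreg N c'.
  apply: SregD; apply: SregM => //; last 1 first.
  - by apply: SregM; [exact: Sreg_id|apply: SregD; [exact: Sreg_cst|apply: SregM; [exact: Sreg_cst|exact: Sreg_id]]].
  - apply: SregM; [exact: Sreg_cst|apply: SregD; [exact: Sreg_cst|]].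
    by apply: SregM; [exact: Sreg_cst|apply: SregD; exact: Sreg_id].
  - exact: SregW.
have [C HC] := IH c' Sc' (SregW Sq).
have dw (s : R) : is_derive s 1 (fun s : R => s * (1 - s)) (1 + -1 * (s + s)).
  have h := is_deriveM (is_derive_id s (1 : R)) (is_deriveB (is_derive_cst (1 : R) s 1) (is_derive_id s (1 : R))).
  apply: (is_derive_eq h); rewrite /GRing.scale /= ?fctE /=; ring.
have db p (s : R) : 0 <= s <= 1 -> is_derive s 1 (fun s => (s * (1 - s)) ^+ N.+1 * e p s)
    ((s * (1 - s)) ^+ N * c' p s).
  move=> s01; have dX := is_deriveX N.+1 (dw s); rewrite exprfctE in dX.
  have h := is_deriveM dX (de p s s01); apply: (is_derive_eq h).
  by rewrite /GRing.scale /= /c' /e exprS; ring.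
have eq_c p (s : R) : 0 <= s <= 1 -> e p s * q p s = c p s.
  by move=> s01; rewrite /e mulfVK// -normr_gt0 (lt_le_trans c00)// qc.
(* One integration by parts for an abstract pair [f' = g]; it serves for [(sin, cos)] and for
   [(- cos, sin)]. *)
have parts p t (f g : R -> R) :
    (forall s : R, is_derive s 1 f (g s)) -> continuous g ->
    t * Rintegral mu `[0, 1] (fun s => (s * (1 - s)) ^+ N.+1 * c p s * g (t * Q p s)) =
    - Rintegral mu `[0, 1] (fun s => (s * (1 - s)) ^+ N * c' p s * f (t * Q p s)).
  move=> df cg.
  have cfQ (h : R -> R) : continuous h -> forall s : R, 0 <= s <= 1 ->
      {for s, continuous (fun s => h (t * Q p s))}.
    move=> ch s s01; apply: (continuous_comp (f := fun s => t * Q p s)) (ch _).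
    by apply: continuousM; [exact: cst_continuous|exact: cQ].
  have cf : continuous f by move=> s; exact: is_derive1_continuous (df s).
  have dfQ (s : R) : 0 <= s <= 1 ->
      is_derive s 1 (fun s => f (t * Q p s)) (g (t * Q p s) * (t * q p s)).
    move=> s01; apply: (is_derive1_comp (g := fun s => t * Q p s)).
    exact: is_deriveZ (dQ p s s01).
  have c1 (s : R) : 0 <= s <= 1 ->
     {for s, continuous (fun s : R => (s * (1 - s)) ^+ N.+1 * c p s * g (t * Q p s))}.
    by move=> s01; apply: continuousM; [exact: cw Sc _ _ _ s01|exact: cfQ].
  have c2 (s : R) : 0 <= s <= 1 ->
     {for s, continuous (fun s : R => (s * (1 - s)) ^+ N * c' p s * f (t * Q p s))}.
    by move=> s01; apply: continuousM; [exact: cw Sc' _ _ _ s01|exact: cfQ].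
  have c3 (s : R) : 0 <= s <= 1 ->
     {for s, continuous (fun s : R => t * ((s * (1 - s)) ^+ N.+1 * c p s * g (t * Q p s)))}.
    by move=> s01; apply: continuousM; [exact: cst_continuous|exact: c1].
  (* The weight makes [F] vanish at both endpoints, so the two halves of its derivative have
     opposite integrals. *)
  pose F (s : R) := (s * (1 - s)) ^+ N.+1 * e p s * f (t * Q p s).
  have dF (s : R) : 0 <= s <= 1 -> is_derive s 1 F
      (t * ((s * (1 - s)) ^+ N.+1 * c p s * g (t * Q p s)) +
       (s * (1 - s)) ^+ N * c' p s * f (t * Q p s)).
    move=> s01; have h := is_deriveM (db p s s01) (dfQ s s01).
    apply: (is_derive_eq h).
    by rewrite /GRing.scale /= -(eq_c p s s01); ring.
  have := integral_derive01 dF (fun s s01 => continuousD (c3 s s01) (c2 s s01)).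
  rewrite RintegralD//; try exact: continuous_integrable01.
  rewrite RintegralZl//; last exact: continuous_integrable01.
  by rewrite /F subrr mulr0 mul0r !expr0n /= !mul0r subrr => /eqP; rewrite addr_eq0 => /eqP.
exists C => p t t0.
have bound x y : t * x = - y -> `|y| <= C / t ^+ N -> `|x| <= C / t ^+ N.+1.
  move=> xy; rewrite !ler_pdivlMr ?exprn_gt0//.
  by rewrite -normrN -xy normrM (gtr0_norm t0) exprS mulrA [t * _]mulrC.
split.
  by apply: bound (HC p t t0).2; apply: parts => // s; exact: continuous_cos.
have := (HC p t t0).1; rewrite -normrN; apply: bound.
have dNcos (s : R) : is_derive s 1 (fun s => - cos s) (sin s).
  by have h := is_deriveN (is_derive_cos s); apply: (is_derive_eq h); rewrite opprK.
rewrite (parts p t _ sin dNcos (@continuous_sin R)).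
congr (- _); rewrite -mulN1r -RintegralZl//.
  by apply: eq_Rintegral => s _; ring.
apply: continuous_integrable01 => s s01.
by apply: continuousM; [exact: cw Sc' _ _ _ s01|exact: ccos].
Qed.

End oscillatory.

(** * Differentiability and charts of submanifolds *)

Section derivatives.
Variable R : realType.

Lemma is_derive_epsdelta (V : normedModType R) (f : V -> R) (x v : V) (df : R) :
  (forall e, 0 < e -> exists2 dl, 0 < dl & forall h : R, `|h| < dl ->
     `|f (h *: v + x) - f x - h * df| <= e * `|h|) ->
  is_derive x v f df.
Proof.
move=> H.
have cv : h^-1 *: (f (h *: v + x) - f x) @[h --> (0 : R)^'] --> df.
  apply/cvgrPdist_le => e e0; have [dl dl0 Hdl] := H e e0.
  near=> h.
  have h0 : h != 0 by near: h; exact: nbhs_dnbhs_neq.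
  have hdl : `|h| < dl.
    near: h; apply: (@nbhs_dnbhs _ (0 : R)); exists dl => //= h /=.
    by rewrite sub0r normrN.
  rewrite -(ler_pM2r (_ : 0 < `|h|)) ?normr_gt0// (le_trans _ (Hdl h hdl))//.
  rewrite -normrM distrC /GRing.scale /= mulrBl mulrAC mulVf// mul1r.
  by rewrite [df * h]mulrC.
apply: DeriveDef; first by apply/cvg_ex; exists df.
exact: cvg_lim.
Unshelve. all: by end_near. Qed.

Lemma is_derive_line (V : normedModType R) (f : V -> R) (z v : V) (s df : R) :
  is_derive (z + s *: v) v f df -> is_derive s 1 (fun s => f (z + s *: v)) df.
Proof.
have E : (fun h : R => h^-1 *: (f (z + (h *: 1 + s) *: v) - f (z + s *: v))) =
         (fun h : R => h^-1 *: (f (h *: v + (z + s *: v)) - f (z + s *: v))).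
  apply/funext => h; congr (_ *: (f _ - _)).
  by have -> : h *: (1 : R) = h; [exact: mulr1|rewrite scalerDl addrCA].
move=> [d1 d2]; split; last by rewrite /derive -[in RHS]d2 /derive /= E.
by rewrite /derivable E.
Qed.

(** Together with [is_derive_line], this transfers one-variable rules, such as those for the inverse
    and the square root, to directional derivatives. *)
Lemma is_derive_line0 (V : normedModType R) (f : V -> R) (z v : V) (df : R) :
  is_derive (0 : R) 1 (fun s => f (z + s *: v)) df -> is_derive z v f df.
Proof.
have E : (fun h : R => h^-1 *: (f (z + (h *: (1 : R) + (0 : R)) *: v) - f (z + (0 : R) *: v))) =
         (fun h : R => h^-1 *: (f (h *: v + z) - f z)).
  apply/funext => h; rewrite scale0r !addr0; congr (_ *: (f _ - _)).
  by have -> : h *: (1 : R) = h; [exact: mulr1|rewrite addrC].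
move=> [d1 d2]; split; last by rewrite /derive -[in RHS]d2 /derive /= E.
by move: d1; rewrite /derivable E.
Qed.

Lemma convex_norm_lt (a b s r : R) :
  `|a| < r -> `|b| < r -> 0 <= s <= 1 -> `|b + (a - b) * s| < r.
Proof.
move=> ar br /andP[s0 s1].
rewrite (_ : b + _ = s * a + (1 - s) * b); last by ring.
rewrite (le_lt_trans (ler_normD _ _))// !normrM (ger0_norm s0).
rewrite (@ger0_norm _ (1 - s)) ?subr_ge0//.
have [ab|ab] := leP `|a| `|b|; first by rewrite (le_lt_trans _ br)//; nra.
by rewrite (le_lt_trans _ ar)//; nra.
Qed.

(** Only partial derivatives are given, so the increment is telescoped along a path that changes one
    coordinate at a time, with the mean value theorem on each edge. The edges stay in the ball
    because the norm is the maximum norm. *)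
Lemma C1_mean n (f : 'rV[R]_n -> R) (g : 'I_n -> 'rV[R]_n -> R) (p : 'rV[R]_n)
    (r : R) (a : 'I_n -> R) (e : R) :
  (forall x i, `|x - p| < r -> is_derive x (ebase R i) f (g i x)) ->
  (forall x i, `|x - p| < r -> `|g i x - a i| <= e) ->
  forall x y, `|x - p| < r -> `|y - p| < r ->
  `|f x - f y - \sum_i a i * (x 0 i - y 0 i)| <= e * \sum_i `|x 0 i - y 0 i|.
Proof.
move=> df ga x y xr yr.
have r0 : 0 < r by exact: le_lt_trans xr.
(* The corners of the path: the first [k] coordinates come from [x], the others from [y]. *)
pose hyb k : 'rV[R]_n := \row_i if (i < k)%N then x 0 i else y 0 i.
have hyb0 : hyb 0%N = y by apply/rowP => i; rewrite mxE.
have hybn : hyb n = x by apply/rowP => i; rewrite mxE ltn_ord.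
have hybS (i : 'I_n) : hyb i.+1 = hyb i + (x 0 i - y 0 i) *: ebase R i.
  apply/rowP => j; rewrite !mxE eqxx /= ltnS leq_eqVlt.
  have [->|ji] := eqVneq j i; first by rewrite eqxx ltnn /= mulr1 addrC subrK.
  by rewrite -val_eqE in ji; rewrite (negbTE ji) /= mulr0 addr0.
have hybr (i : 'I_n) s : 0 <= s <= 1 -> `|hyb i + ((x 0 i - y 0 i) * s) *: ebase R i - p| < r.
  move=> /andP[s0 s1]; apply: rV_norm_lt => // j; rewrite !mxE eqxx /=.
  have xj := le_lt_trans (rV_norm_ge (x - p) j) xr.
  have yj := le_lt_trans (rV_norm_ge (y - p) j) yr.
  rewrite !mxE in xj yj; have [ji|ji] := eqVneq j i; last first.
    by rewrite mulr0 addr0; case: ifP.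
  rewrite {}ji in xj yj *; rewrite ltnn mulr1 (_ : _ - p 0 i = (y 0 i - p 0 i) + ((x 0 i - p 0 i) - (y 0 i - p 0 i)) * s); last by ring.
  by apply: convex_norm_lt => //; rewrite s0.
have step (i : 'I_n) : `|f (hyb i.+1) - f (hyb i) - a i * (x 0 i - y 0 i)| <= e * `|x 0 i - y 0 i|.
  set dl := x 0 i - y 0 i.
  pose phi (s : R) := f (hyb i + (dl * s) *: ebase R i).
  have dphi (s : R) : 0 <= s <= 1 -> is_derive s 1 phi (g i (hyb i + (dl * s) *: ebase R i) * dl).
    move=> s01.
    have h1 := is_derive_line (df _ i (hybr i s s01)).
    have h2 : is_derive s 1 (fun s : R => dl * s) dl.
      have h := is_deriveZ dl (is_derive_id s (1:R)); apply: (is_derive_eq h).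
      by rewrite /GRing.scale /= mulr1.
    exact: is_derive1_comp h1 h2.
  have [||c] := @MVT_segment R phi (fun s => g i (hyb i + (dl * s) *: ebase R i) * dl) 0 1 ler01.
  - by move=> c; rewrite in_itv /= => /andP[c0 c1]; apply: dphi; rewrite !ltW.
  - by apply: continuous_within => c c01; exact: is_derive1_continuous (dphi c c01).
  rewrite in_itv /= => c01; rewrite /phi mulr1 mulr0 scale0r addr0 -hybS subr0 mulr1.
  by move=> ->; rewrite -mulrBl normrM ler_wpM2r// ga// hybr.
have -> : f x - f y = \sum_(i < n) (f (hyb i.+1) - f (hyb i)).
  by rewrite -(big_mkord xpredT (fun i => f (hyb i.+1) - f (hyb i))) telescope_sumr// hybn hyb0.
rewrite -sumrB mulr_sumr (le_trans (ler_norm_sum _ _ _))//.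
by apply: ler_sum => i _; exact: step.
Qed.

(** C^N regularity with derivatives as witnesses constrained on [U] only. Closure under sums,
    products and inverses then follows by induction, without computing iterated derivatives. *)
Fixpoint Cn n (N : nat) (U : set 'rV[R]_n) (f : 'rV[R]_n -> R) : Prop :=
  (forall x, U x -> {for x, continuous f}) /\
  match N with
  | 0 => True
  | N'.+1 => exists g : 'I_n -> 'rV[R]_n -> R,
      (forall x i, U x -> is_derive x (ebase R i) f (g i x)) /\
      forall i, Cn N' U (g i)
  end.

Section Cn_theory.
Variables (n : nat) (U : set 'rV[R]_n).

Lemma smooth_Cn N (f : 'rV[R]_n -> R) : smooth_on U f -> Cn N U f.
Proof.
move=> sf; suff H : forall l, Cn N U (Defs.iterD l f) by exact: (H [::]).
elim: N => [|N IH] l; split => //; try by move=> x /(sf l)[].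
exists (fun i => Defs.iterD (i :: l) f); split; last by move=> i; exact: IH.
by move=> x i /(sf l)[dl _]; split; [exact: dl|].
Qed.

Lemma Cn_continuous N f : Cn N U f -> forall x, U x -> {for x, continuous f}.
Proof. by case: N => [|N] []. Qed.

Lemma CnW N f : Cn N.+1 U f -> Cn N U f.
Proof.
elim: N f => [|N IH] f [cf [g [dg Sg]]]; split=> //.
by exists g; split=> // i; exact: IH.
Qed.

Lemma Cn_cst N c : Cn N U (fun=> c).
Proof.
elim: N c => [|N IH] c; split=> //; try by move=> x _; exact: cst_continuous.
by exists (fun _ _ => 0); split => // x i _; exact: is_derive_cst.
Qed.

Lemma CnD N f g : Cn N U f -> Cn N U g -> Cn N U (fun x => f x + g x).
Proof.
elim: N f g => [|N IH] f g [cf Sf] [cg Sg].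
  by split=> // x Ux; apply: continuousD; [exact: cf|exact: cg].
split; first by move=> x Ux; apply: continuousD; [exact: cf|exact: cg].
move: Sf Sg => [f' [df Sf]] [g' [dg Sg]].
exists (fun i x => f' i x + g' i x); split=> [x i Ux|i]; last by apply: IH; [exact: Sf|exact: Sg].
exact: is_deriveD (df x i Ux) (dg x i Ux).
Qed.

Lemma CnM N f g : Cn N U f -> Cn N U g -> Cn N U (fun x => f x * g x).
Proof.
elim: N f g => [|N IH] f g Cf Cg.
  split=> // x Ux; apply: continuousM; first exact: Cn_continuous Cf _ Ux.
  exact: Cn_continuous Cg _ Ux.
move: (Cf) (Cg) => [cf [f' [df Sf]]] [cg [g' [dg Sg]]].
split; first by move=> x Ux; apply: continuousM; [exact: cf|exact: cg].
exists (fun i x => f x * g' i x + g x * f' i x); split=> [x i Ux|i].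
  exact: is_deriveM (df x i Ux) (dg x i Ux).
by apply: CnD; apply: IH; [exact: CnW|exact: Sg|exact: CnW|exact: Sf].
Qed.

Lemma is_derive_inv (V : normedModType R) (f : V -> R) (x v : V) (df : R) :
  f x != 0 -> is_derive x v f df ->
  is_derive x v (fun y => (f y)^-1) (-1 * ((f x)^-1 * (f x)^-1) * df).
Proof.
move=> fx0; rewrite -{1}[x]addr0 -{1}(scale0r v).
move=> /is_derive_line h; apply: is_derive_line0.
have := @is_deriveV R (fun s => f (x + s *: v)) 0 df 1.
rewrite scale0r addr0 => /(_ fx0 h) k; apply: (is_derive_eq k).
by rewrite /GRing.scale /= mulN1r expr2 invfM.
Qed.

Lemma CnV N f : (forall x, U x -> f x != 0) ->
  Cn N U f -> Cn N U (fun x => (f x)^-1).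
Proof.
move=> f0; elim: N => [|N IH] Cf.
  split=> // x Ux; apply: continuousV; first exact: f0.
  exact: Cn_continuous Cf _ Ux.
have [cf [f' [df Sf]]] := Cf.
split; first by move=> x Ux; apply: continuousV; [exact: f0|exact: cf].
exists (fun i x => -1 * ((f x)^-1 * (f x)^-1) * f' i x); split=> [x i Ux|i].
  by apply: is_derive_inv; [exact: f0|exact: df].
have Cv := IH (CnW Cf).
by apply: CnM; [apply: CnM; [exact: Cn_cst|exact: CnM]|exact: Sf].
Qed.

Lemma Cn_sum (I : Type) (s : seq I) (P : pred I) N (f : I -> 'rV[R]_n -> R) :
  (forall i, Cn N U (f i)) -> Cn N U (fun x => \sum_(i <- s | P i) f i x).
Proof.
move=> Cf; elim: s => [|i s IH].
  by under eq_fun do rewrite big_nil; exact: Cn_cst.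
under eq_fun do rewrite big_cons; case: (P i) => //.
exact: CnD.
Qed.

Lemma Cn_prod (I : Type) (s : seq I) (P : pred I) N (f : I -> 'rV[R]_n -> R) :
  (forall i, Cn N U (f i)) -> Cn N U (fun x => \prod_(i <- s | P i) f i x).
Proof.
move=> Cf; elim: s => [|i s IH].
  by under eq_fun do rewrite big_nil; exact: Cn_cst.
under eq_fun do rewrite big_cons; case: (P i) => //.
exact: CnM.
Qed.

Lemma Cn_det N k (D : 'rV[R]_n -> 'M[R]_k) :
  (forall i j, Cn N U (fun x => D x i j)) -> Cn N U (fun x => \det (D x)).
Proof.
move=> CD; rewrite /determinant; apply: Cn_sum => s.
by apply: CnM; [exact: Cn_cst|apply: Cn_prod].
Qed.

Lemma is_derive_coord (x : 'rV[R]_n) i j :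
  is_derive x (ebase R i) (fun x : 'rV[R]_n => x 0 j) (j == i)%:R.
Proof.
apply: is_derive_epsdelta => e e0; exists 1 => // h _.
by rewrite !mxE eqxx /= addrK subrr normr0 mulr_ge0// ltW.
Qed.

Lemma Cn_coord N j : Cn N U (fun x => x 0 j).
Proof.
case: N => [|N]; split=> //; try by move=> x _; exact: coord_continuous.
exists (fun i _ => (j == i)%:R); split=> [x i _|i]; last exact: Cn_cst.
exact: is_derive_coord.
Qed.

End Cn_theory.

Lemma CnS n N (U U' : set 'rV[R]_n) f : U' `<=` U -> Cn N U f -> Cn N U' f.
Proof.
move=> UU; elim: N f => [|N IH] f [cf Cf]; split=> //; try by move=> x /UU; exact: cf.
have [g [dg Cg]] := Cf; exists g; split=> [x i /UU|i]; first exact: dg.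
by apply: IH; exact: Cg.
Qed.

End derivatives.

(** * Local inverses by contraction *)

Section inverse.
Variable R : realType.

Lemma continuous_finite_ball n (I : finType) (f : I -> 'rV[R]_n -> R) p e :
  0 < e -> (forall i, {for p, continuous (f i)}) ->
  exists2 r, 0 < r & forall x, `|x - p| < r -> forall i, `|f i x - f i p| <= e.
Proof.
move=> e0 cf.
have H : \forall x \near p, forall i, `|f i x - f i p| <= e.
  suff H (s : seq I) : \forall x \near p, forall i, i \in s -> `|f i x - f i p| <= e.
    by apply: filterS (H (enum I)) => x Hx i; apply: Hx; rewrite mem_enum.
  elim: s => [|i s IH]; first by near=> x.
  have /cvgrPdist_le/(_ e e0) Hi := cf i.
  near=> x => j; rewrite inE => /predU1P[->|].
    by rewrite distrC; near: x.
  by move: j; near: x.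
have /nbhs_normP[r r0 Hr] := H.
by exists r => // x xr; apply: Hr; rewrite /= distrC.
Unshelve. all: by end_near. Qed.

(** Solutions of [Psi x = w] are the fixed points of [x - Psi x + w], which contracts by [1/2]; the
    bound [r / 2] on [w - Psi p] is what lets this map preserve the closed ball. *)
Lemma near_id_inverse n (Psi : 'rV[R]_n -> 'rV[R]_n) p r : 0 < r ->
  (forall x y, `|x - p| <= r -> `|y - p| <= r ->
     `|Psi x - Psi y - (x - y)| <= 2^-1 * `|x - y|) ->
  forall w, `|w - Psi p| <= r / 2 -> exists2 x, `|x - p| <= r & Psi x = w.
Proof.
move=> r0 HPsi w wr.
pose T x := x - Psi x + w.
pose A := [set x | `|x - p| <= r].
have pA : A p by rewrite /A /= subrr normr0 ltW.
have TA : {homo T : x / A x >-> A x}.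
  move=> x Ax; rewrite /A /=.
  have -> : T x - p = - (Psi x - Psi p - (x - p)) + (w - Psi p).
    by rewrite /T; apply/rowP => i; rewrite !mxE; ring.
  rewrite (le_trans (ler_normD _ _))// normrN.
  have := HPsi x p Ax pA; move: wr Ax; rewrite /A /=; lra.
have cT : is_contraction (mkfun_fun TA).
  exists (2^-1)%:nng; split; first by rewrite /= invf_lt1// ltr1n.
  move=> [x y] [/= Ax Ay].
  have -> : T x - T y = - (Psi x - Psi y - (x - y)).
    by rewrite /T; apply/rowP => i; rewrite !mxE; ring.
  by rewrite normrN; exact: HPsi.
have clA : closed A.
  rewrite (_ : A = (fun x => `|x - p|) @^-1` [set t | t <= r]) //.
  apply: closed_comp => [x _|]; last exact: closed_le.
  apply: (continuous_comp (f := fun x => x - p)); last exact: norm_continuous.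
  by apply: continuousB; [exact: cvg_id|exact: cst_continuous].
have [] := @banach_fixed_point R 'rV[R]_n A (mkfun_fun TA) cT clA; first by exists p.
move=> x Ax /= xT; exists x => //; apply/rowP => i.
by move/rowP/(_ i): xT; rewrite /T !mxE; lra.
Qed.

Lemma near_identity n (Psi : 'rV[R]_n -> 'rV[R]_n) (D : 'rV[R]_n -> 'M[R]_n) p r0 :
  0 < r0 ->
  (forall x a b, `|x - p| < r0 -> is_derive x (ebase R b) (fun x => Psi x 0 a) (D x b a)) ->
  (forall a b, {for p, continuous (fun x => D x b a)}) -> D p = 1%:M ->
  exists2 r, 0 < r <= r0 & forall x y, `|x - p| < r -> `|y - p| < r ->
     `|Psi x - Psi y - (x - y)| <= 2^-1 * `|x - y|.
Proof.
move=> r00 dPsi cD Dp.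
(* Summing over [n] coordinates costs a factor [n], and [n * e <= 1/2]. *)
pose e : R := (2 * n.+1%:R)^-1.
have e0 : 0 < e by rewrite invr_gt0 mulr_gt0// ltr0n.
have [r r_gt0 Hr] := @continuous_finite_ball n ('I_n * 'I_n)%type (fun ab x => D x ab.2 ab.1)
  p e e0 (fun ab => cD ab.1 ab.2).
exists (Num.min r r0); first by rewrite lt_min r_gt0 r00 ge_min lexx orbT.
move=> x y; rewrite !lt_min => /andP[xr xr0] /andP[yr yr0].
apply: rV_norm_le => [|a]; first by rewrite mulr_ge0// invr_ge0.
have d1 z (b : 'I_n) : `|z - p| < Num.min r r0 ->
    is_derive z (ebase R b) (fun x => Psi x 0 a) (D z b a).
  by rewrite lt_min => /andP[_ zr0]; exact: dPsi.
have d2 z (b : 'I_n) : `|z - p| < Num.min r r0 -> `|D z b a - (b == a)%:R| <= e.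
  rewrite lt_min => /andP[zr _].
  by have := Hr z zr (a, b); rewrite /= Dp mxE.
have xm : `|x - p| < Num.min r r0 by rewrite lt_min xr.
have ym : `|y - p| < Num.min r r0 by rewrite lt_min yr.
have := @C1_mean R n (fun x => Psi x 0 a) (fun b x => D x b a) p _ (fun b => (b == a)%:R) e d1 d2 x y xm ym.
have -> : \sum_i (i == a)%:R * (x 0 i - y 0 i) = x 0 a - y 0 a.
  rewrite (bigD1 a)//= eqxx mul1r big1 ?addr0// => i /negbTE ->.
  by rewrite mul0r.
rewrite !mxE => H; apply: le_trans H _.
rewrite (le_trans (_ : _ <= e * \sum_(i < n) `|x - y|))//.
  rewrite ler_pM2l// ler_sum// => i _.
  by have := rV_norm_ge (x - y) i; rewrite !mxE.
rewrite sumr_const card_ord -[_ *+ n]mulr_natl mulrA ler_wpM2r//.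
rewrite /e invfM -mulrA ler_piMr// ?invr_ge0//.
by rewrite ler_pdivrMl ?ltr0n// mulr1 ler_nat.
Qed.

End inverse.

Section local_parametrisation.
Variable R : realType.

Lemma sum_coord_norm_le n (x : 'rV[R]_n) : \sum_i `|x 0 i| <= n%:R * `|x|.
Proof.
rewrite (le_trans (_ : _ <= \sum_(i < n) `|x|))//.
  by apply: ler_sum => i _; exact: rV_norm_ge.
by rewrite sumr_const card_ord mulr_natl.
Qed.

(* Derivative of [A \o gamma] for a local inverse [gamma] of the affine
   family [Psi = p + y B], by the implicit function theorem. *)
Lemma is_derive_implicit d k (Psi : 'rV[R]_d -> 'rV[R]_d)
    (D : 'rV[R]_d -> 'M[R]_d) (B : 'M[R]_(k, d)) (gam : 'rV[R]_k -> 'rV[R]_d)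
    (p : 'rV[R]_d) (r rho L : R) (A : 'rV[R]_d -> R)
    (g : 'I_d -> 'rV[R]_d -> R) (y0 : 'rV[R]_k) (j : 'I_k) (X : 'rV[R]_d) :
  (forall x a b, `|x - p| < r ->
     is_derive x (ebase R b) (fun x => Psi x 0 a) (D x b a)) ->
  (forall x a b, `|x - p| < r -> {for x, continuous (fun x => D x b a)}) ->
  (forall x a, `|x - p| < r -> is_derive x (ebase R a) A (g a x)) ->
  (forall x a, `|x - p| < r -> {for x, continuous (g a)}) ->
  (forall y, `|y| < rho -> `|gam y - p| < r /\ Psi (gam y) = p + y *m B) ->
  (forall y z, `|y| < rho -> `|z| < rho -> `|gam y - gam z| <= L * `|y - z|) ->
  `|y0| < rho -> D (gam y0) \in unitmx -> X *m D (gam y0) = row j B ->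
  is_derive y0 (ebase R j) (A \o gam) (\sum_a g a (gam y0) * X 0 a).
Proof.
move=> dPsi cD dA cg gamP gamL y0r uD XD.
set x0 := gam y0; have [x0r Psix0] := gamP y0 y0r.
pose G := invmx (D x0); pose SG := \sum_i \sum_j `|G i j|.
have SG0 : 0 <= SG by apply: sumr_ge0 => i _; apply: sumr_ge0.
pose Sg := \sum_a `|g a x0|; have Sg0 : 0 <= Sg by apply: sumr_ge0.
pose L' := `|L|; have L'0 : 0 <= L' by exact: normr_ge0.
pose dL := d%:R * L'; have dL0 : 0 <= dL by rewrite mulr_ge0.
apply: is_derive_epsdelta => e e0.
(* The errors [AL] and [rvG] below add up to [e' (dL + Sg dL SG) |h|]; the 1 keeps [c] positive. *)
pose c := 1 + dL + Sg * (dL * SG).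
have c0 : 0 < c by rewrite /c -addrA ltr_wpDr// addr_ge0// mulr_ge0// mulr_ge0.
pose e' := e / c; have e'0 : 0 < e' by rewrite divr_gt0.
have [r1 r10 Hr1] := @continuous_finite_ball R d ('I_d * 'I_d)%type
  (fun ab x => D x ab.1 ab.2) x0 e' e'0 (fun ab => cD x0 ab.2 ab.1 x0r).
have [r2 r20 Hr2] := @continuous_finite_ball R d 'I_d g x0 e' e'0 (fun a => cg x0 a x0r).
pose r' := Num.min (Num.min r1 r2) (r - `|x0 - p|).
have r'0 : 0 < r' by rewrite !lt_min r10 r20 subr_gt0.
have r'P z : `|z - x0| < r' -> [/\ `|z - x0| < r1, `|z - x0| < r2 & `|z - p| < r].
  rewrite !lt_min => /andP[/andP[-> ->] zr]; split => //.
  by rewrite -(subrK x0 z) -addrA (le_lt_trans (ler_normD _ _))// -ltrBrDr.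
pose dl := Num.min (rho - `|y0|) (r' / (L' + 1)).
exists dl; first by rewrite lt_min subr_gt0 y0r divr_gt0// ltr_wpDl.
move=> h; rewrite lt_min => /andP[h1 h2].
set y := h *: ebase R j + y0.
have nej : `|h *: ebase R j : 'rV[R]_k| <= `|h|.
  by apply: rV_norm_le => // i; rewrite !mxE eqxx /=; case: eqP => _; rewrite ?mulr1 ?mulr0 ?normr0.
have yr : `|y| < rho.
  by rewrite (le_lt_trans (ler_normD _ _))// -ltrBrDr (le_lt_trans nej).
have [xr Psix] := gamP y yr; set x := gam y in xr Psix *.
have xx0 : `|x - x0| <= L' * `|h|.
  rewrite (le_trans (gamL y y0 yr y0r))// (le_trans (_ : _ <= L' * `|y - y0|))//.
    by rewrite ler_wpM2r// ler_norm.
  by rewrite ler_wpM2l// /y addrK.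
have xr' : `|x - x0| < r'.
  rewrite (le_lt_trans xx0)// (le_lt_trans (_ : _ <= (L' + 1) * `|h|))//.
    by rewrite ler_wpM2r// lerDl.
  by rewrite mulrC -ltr_pdivlMr// ltr_wpDl.
have x0r' : `|x0 - x0| < r' by rewrite subrr normr0.
have sxx0 : \sum_i `|x 0 i - x0 0 i| <= dL * `|h|.
  rewrite (_ : \sum_i _ = \sum_i `|(x - x0) 0 i|); last by apply: eq_bigr => i _; rewrite !mxE.
  by rewrite (le_trans (sum_coord_norm_le _))// /dL -mulrA ler_wpM2l.
(* [rv] is the error of linearising [Psi] at [x0]. Multiplied by the inverse of [D x0] it becomes
   [(x - x0) - h X], so [gam] moves by [h X] up to [rv *m G]. *)
pose rv := (x - x0) *m D x0 - h *: row j B.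
have rvE : (x - x0) - h *: X = rv *m G.
  by rewrite /rv mulmxBl mulmxK// -scalemxAl -XD mulmxK.
have rvL : `|rv| <= e' * (dL * `|h|).
  apply: rV_norm_le => [|a]; first by rewrite mulr_ge0 ?(ltW e'0)// mulr_ge0.
  have d1 z (b : 'I_d) : `|z - x0| < r' -> is_derive z (ebase R b) (fun x => Psi x 0 a) (D z b a).
    by move=> /r'P[_ _]; exact: dPsi.
  have d2 z (b : 'I_d) : `|z - x0| < r' -> `|D z b a - D x0 b a| <= e'.
    by move=> /r'P[zr _ _]; have := Hr1 z zr (b, a).
  have H := C1_mean d1 d2 xr' x0r'.
  have -> : rv 0 a = - (Psi x 0 a - Psi x0 0 a - \sum_i D x0 i a * (x 0 i - x0 0 i)).
    have -> : Psi x 0 a - Psi x0 0 a = h * row j B 0 a.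
      rewrite Psix Psix0 /y mulmxDl -scalemxAl /ebase -rowE.
      move: (y0 *m B) (row j B) => S b; rewrite !mxE.
      by rewrite opprD addrACA subrr add0r addrK.
    have -> : \sum_i D x0 i a * (x 0 i - x0 0 i) = ((x - x0) *m D x0) 0 a.
      by rewrite [RHS]mxE; apply: eq_bigr => i _; rewrite mulrC; congr (_ * _); rewrite !mxE.
    by rewrite /rv; move: (_ *m _) (row j B) => S b; rewrite !mxE opprB.
  by rewrite normrN; apply: le_trans H _; rewrite ler_wpM2l// ltW.
have AL : `|A x - A x0 - \sum_i g i x0 * (x 0 i - x0 0 i)| <= e' * (dL * `|h|).
  have d1 z (b : 'I_d) : `|z - x0| < r' -> is_derive z (ebase R b) A (g b z).
    by move=> /r'P[_ _]; exact: dA.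
  have d2 z (b : 'I_d) : `|z - x0| < r' -> `|g b z - g b x0| <= e'.
    by move=> /r'P[_ zr _]; exact: Hr2.
  apply: le_trans (C1_mean d1 d2 xr' x0r') _.
  by rewrite ler_wpM2l// ltW.
rewrite /= -/x -/x0.
rewrite (_ : _ - _ - _ = (A x - A x0 - \sum_i g i x0 * (x 0 i - x0 0 i)) +
    \sum_i g i x0 * (rv *m G) 0 i); last first.
  rewrite -rvE [in X in _ = _ + X](eq_bigr (fun i => g i x0 * (x 0 i - x0 0 i) - h * (g i x0 * X 0 i))).
    by rewrite sumrB -mulr_sumr; ring.
  by move=> i _; rewrite !mxE; ring.
have rvG : `|rv *m G| <= e' * (dL * `|h|) * SG.
  by rewrite (le_trans (normr_mulmx_le _ _))// ler_wpM2r.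
rewrite (le_trans (ler_normD _ _))// (le_trans (lerD AL (_ : _ <= Sg * (e' * (dL * `|h|) * SG))))//.
  rewrite (le_trans (ler_norm_sum _ _ _))// mulr_suml ler_sum// => i _.
  by rewrite normrM ler_wpM2l// (le_trans (rV_norm_ge _ _)).
rewrite (_ : _ + _ = e' * (dL + Sg * (dL * SG)) * `|h|); last by ring.
rewrite ler_wpM2r// /e' -mulrA ler_piMr// ?(ltW e0)// ler_pdivrMl// mulr1 /c.
by rewrite -addrA lerDr.
Qed.

End local_parametrisation.

(** * Bi-Lipschitz charts of a submanifold *)

Section charts.
Variable R : realType.

Lemma kernel_basis m k d (J : 'M[R]_(m, d)) : \rank J = m -> d = (m + k)%N ->
  exists B : 'M[R]_(k, d), row_free B /\ B *m J^T = 0.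
Proof.
move=> rJ dmk; have rk : \rank (kermx J^T) = k by rewrite mxrank_ker mxrank_tr rJ dmk addKn.
have H : exists B : 'M[R]_(\rank (kermx J^T), d), row_free B /\ B *m J^T = 0.
  exists (row_base (kermx J^T)); split; first exact: row_base_free.
  have : (row_base (kermx J^T) <= kermx J^T)%MS by rewrite eq_row_base.
  by move/sub_kermxP.
by rewrite rk in H.
Qed.

Lemma smooth_derive d (U : set 'rV[R]_d) (f : 'rV[R]_d -> R) b :
  smooth_on U f -> smooth_on U ('D_(ebase R b) (f : 'rV[R]_d -> R^o)).
Proof.
move=> sf l x Ux; have H : Defs.iterD l ('D_(ebase R b) (f : 'rV[R]_d -> R^o)) = Defs.iterD (l ++ [:: b]) f.
  by elim: l => //= i l ->.
by rewrite H; exact: sf.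
Qed.

(* [gam] parametrises [S] near [p] bi-Lipschitzly; the fields [X j], defined on
   a whole ball of the ambient space, restrict to the partial derivatives of
   [gam] along [S]. *)
Record chart d k (p : 'rV[R]_d) (S : set 'rV[R]_d) (B : 'M[R]_(k, d))
    (X : 'I_k -> 'I_d -> 'rV[R]_d -> R) (gam : 'rV[R]_k -> 'rV[R]_d)
    (r rho L : R) : Prop := {
  chart_r : 0 < r;
  chart_rho : 0 < rho;
  chart_L : 0 < L;
  chart_base : gam 0 = p;
  chart_in : forall y, `|y| < rho -> `|gam y - p| < r /\ S (gam y);
  chart_lip : forall y z, `|y| < rho -> `|z| < rho ->
    `|gam y - gam z| <= L * `|y - z|;
  chart_colip : forall y z, `|y| < rho -> `|z| < rho ->
    `|y - z| <= L * `|gam y - gam z|;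
  chart_field : forall N j a, Cn N [set x | `|x - p| < r] (X j a);
  chart_fieldp : forall j a, X j a p = B j a;
  chart_derive : forall A (g : 'I_d -> 'rV[R]_d -> R) y j, `|y| < rho ->
    (forall x a, `|x - p| < r -> is_derive x (ebase R a) A (g a x)) ->
    (forall x a, `|x - p| < r -> {for x, continuous (g a)}) ->
    is_derive y (ebase R j) (A \o gam) (\sum_a g a (gam y) * X j a (gam y))
}.

(* [Psi] is tangent to the identity at [p] and straightens [M]: it maps
   [{F = 0}] into the affine space [p + ker J^T]. *)
Lemma exists_chart d m k (M U W : set 'rV[R]_d) p (F : 'I_m -> 'rV[R]_d -> R) :
  local_defining M p U F -> M p -> d = (m + k)%N -> open W -> W p ->
  exists B X gam r rho L, [/\ @chart d k p (M `&` W) B X gam r rho L,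
    B *m (Defs.jacobian F p)^T = 0, row_free B & [set x | `|x - p| < r] `<=` U].
Proof.
move=> [oU Up MF sF rF] Mp dmk oW Wp.
pose J := Defs.jacobian F p.
have rJ : \rank J = m by exact: rF.
have [B [fB BJ]] := kernel_basis rJ dmk.
have /row_freeP[K JK] : row_free J by rewrite /row_free rJ.
have /row_freeP[B' BB'] := fB.
have [r0 r00 r0U] : exists2 r0, 0 < r0 & [set x | `|x - p| < r0] `<=` U `&` W.
  have : nbhs p (U `&` W) by apply: open_nbhs_nbhs; split; [exact: openI|].
  move=> /nbhs_normP[r0 r00 H]; exists r0 => // x /= xr; apply: H.
  by rewrite /ball_ /= distrC.
pose Fx x := \row_c F c x.
(* As [J K = 1], one gets [(Psi x - p) J^T = F x]; the added correction has zero derivative at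
   [p]. *)
pose Psi x := x + (Fx x - (x - p) *m J^T) *m K^T.
pose D x : 'M[R]_d := \matrix_(b, a) ((b == a)%:R +
  \sum_c ('D_(ebase R b) (F c : _ -> R^o) x - J c b) * K a c).
have Dp : D p = 1%:M.
  apply/matrixP => b a; rewrite !mxE big1 ?addr0// => c _.
  by rewrite /J !mxE subrr mul0r.
have Fp : Fx p = 0.
  by apply/rowP => c; rewrite !mxE; exact: (MF p Up).1.
have Psip : Psi p = p by rewrite /Psi Fp subrr mul0mx subrr mul0mx addr0.
have CD N b a : Cn N U (fun x => D x b a).
  under eq_fun do rewrite mxE.
  apply: CnD; first exact: Cn_cst.
  apply: Cn_sum => c; apply: CnM; last exact: Cn_cst.
  apply: CnD; last exact: Cn_cst.
  by apply: smooth_Cn; exact: smooth_derive.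
have dPsi x a b : `|x - p| < r0 -> is_derive x (ebase R b) (fun x => Psi x 0 a) (D x b a).
  move=> xr; have Lin (c : 'I_m) : is_derive x (ebase R b) (fun x => ((x - p) *m J^T) 0 c) (J c b).
    apply: is_derive_epsdelta => e e0; exists 1 => // h _.
    have -> : h *: ebase R b + x - p = h *: ebase R b + (x - p) by rewrite addrA.
    rewrite mulmxDl -scalemxAl /ebase -rowE.
    move: ((x - p) *m J^T) => T; rewrite !mxE addrK subrr normr0.
    by rewrite mulr_ge0// ltW.
  have dF (c : 'I_m) : is_derive x (ebase R b) (F c) ('D_(ebase R b) (F c : _ -> R^o) x).
    by have [dl _] := sF c [::] x (r0U x xr).1; split.
  have dh c : is_derive x (ebase R b) (fun x => (F c x - ((x - p) *m J^T) 0 c) * K a c)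
     (('D_(ebase R b) (F c : _ -> R^o) x - J c b) * K a c).
    have h := is_deriveM (is_deriveB (dF c) (Lin c)) (is_derive_cst (K a c) x (ebase R b)).
    by apply: (is_derive_eq h); rewrite scaler0 add0r /GRing.scale /= mulrC.
  have h := is_deriveD (is_derive_coord x b a) (is_derive_sum dh).
  rewrite (_ : (fun x => _) = (fun x : 'rV[R]_d => x 0 a) + (\sum_c (fun x => (F c x - ((x - p) *m J^T) 0 c) * K a c))).
    by apply: (is_derive_eq h); rewrite mxE eq_sym.
  apply/funext => z; rewrite /Psi fctE fct_sumE !mxE; congr (_ + _).
  by apply: eq_bigr => c _; rewrite [K^T c a]mxE; congr (_ * _); rewrite [RHS]addrC mxE addrC; congr (_ + _); rewrite !mxE.
have [r1 /andP[r10 r1r0] HPsi] := near_identity r00 dPsi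
  (fun a b => Cn_continuous (CD 0%N b a) Up) Dp.
(* Keeping the determinant within [1/2] of its value 1 at [p] makes [D] invertible on the ball. *)
have [r2' r2'0 Hr2'] := @continuous_finite_ball R d 'I_1 (fun _ x => \det (D x)) p (2^-1)
  ltac:(by rewrite invr_gt0) (fun _ => Cn_continuous (Cn_det (CD 0%N)) Up).
pose r := Num.min r1 r2'.
have r_gt0 : 0 < r by rewrite lt_min r10.
have rr0 x : `|x - p| < r -> `|x - p| < r0.
  by rewrite lt_min => /andP[xr _]; exact: lt_le_trans r1r0.
have rr1 x : `|x - p| < r -> `|x - p| < r1 by rewrite lt_min => /andP[].
have detD x : `|x - p| < r -> \det (D x) != 0.
  rewrite lt_min => /andP[_ /Hr2'/(_ ord0)]; rewrite Dp det1.
  by apply: contraTneq => ->; rewrite sub0r normrN normr1 -ltNge invf_lt1// ltr1n.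
have rU : [set x | `|x - p| < r] `<=` U by move=> x /rr0/r0U[].
(* [X j] is row [j] of [B] times the inverse of [D x]. Writing the inverse with the adjugate reduces
   its regularity to that of determinants. *)
pose X (j : 'I_k) a x := \sum_b B j b * ((\det (D x))^-1 * \adj (D x) b a).
have XE j x : `|x - p| < r -> (\row_a X j a x) *m D x = row j B.
  move=> xr; have uD : D x \in unitmx by rewrite unitmxE unitfE detD.
  rewrite (_ : \row_a _ = row j B *m invmx (D x)) ?mulmxKV//.
  apply/rowP => a; rewrite !mxE; apply: eq_bigr => b _.
  by rewrite /invmx uD !mxE.
pose S := \sum_i \sum_j `|B i j|; have S0 : 0 <= S by apply: sumr_ge0 => i _; apply: sumr_ge0.
pose S' := \sum_i \sum_j `|B' i j|; have S'0 : 0 <= S' by apply: sumr_ge0 => i _; apply: sumr_ge0.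
(* Then [|y B| <= r / 4], the bound that [near_id_inverse] asks for on the ball of radius [r / 2];
   the solution stays strictly inside the ball of radius [r]. *)
pose rho := (r / 4) / (S + 1).
have rho0 : 0 < rho by rewrite !divr_gt0// ltr_wpDl.
have yB (y : 'rV[R]_k) : `|y| < rho -> `|y *m B| <= r / 4.
  move=> yr; rewrite (le_trans (normr_mulmx_le _ _))//.
  rewrite (le_trans (_ : _ <= `|y| * (S + 1)))//; first by rewrite ler_wpM2l// lerDl.
  by rewrite -ler_pdivlMr ?ltr_wpDl// ltW.
have exg y : exists x, `|y| < rho -> `|x - p| <= r / 2 /\ Psi x = p + y *m B.
  have [yr|yr] := ltP `|y| rho; last by exists 0.
  have [|||x xr Px] := @near_id_inverse R d Psi p (r / 2) _ _ (p + y *m B).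
  - by rewrite divr_gt0.
  - move=> u v ur vr; apply: HPsi; apply: rr1.
      by rewrite (le_lt_trans ur)// gtr_pMr// invf_lt1// ltr1n.
    by rewrite (le_lt_trans vr)// gtr_pMr// invf_lt1// ltr1n.
  - by rewrite Psip [p + _]addrC addrK (le_trans (yB y yr))//; move: r_gt0; lra.
  by exists x.
have [gam gamP] := choice exg.
have gamr y : `|y| < rho -> `|gam y - p| < r.
  by move=> /gamP[yr _]; rewrite (le_lt_trans yr)// gtr_pMr// invf_lt1// ltr1n.
have FPsi x : Fx x = (Psi x - p) *m J^T.
  have KJ : K^T *m J^T = 1%:M by rewrite -trmx_mul JK trmx1.
  by rewrite /Psi addrAC mulmxDl -mulmxA KJ mulmx1 addrCA subrr addr0.
have S2 : 0 < 2 * (S + S' + 1) by rewrite mulr_gt0// ltr_wpDl// addr_ge0.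
have near_gam y z : `|y| < rho -> `|z| < rho ->
    `|(y - z) *m B - (gam y - gam z)| <= 2^-1 * `|gam y - gam z|.
  move=> yr zr; have := HPsi _ _ (rr1 _ (gamr y yr)) (rr1 _ (gamr z zr)).
  rewrite (gamP y yr).2 (gamP z zr).2 mulmxBl.
  by rewrite [p + y *m B]addrC addrKA.
have gamL y z : `|y| < rho -> `|z| < rho -> `|gam y - gam z| <= 2 * (S + S' + 1) * `|y - z|.
  move=> yr zr; have H := near_gam y z yr zr.
  have H1 : `|gam y - gam z| <= `|(y - z) *m B| + 2^-1 * `|gam y - gam z|.
    rewrite -[X in `|X| <= _](subKr ((y - z) *m B)).
    by rewrite (le_trans (ler_normB _ _))// lerD.
  have H2 : `|(y - z) *m B| <= `|y - z| * S by exact: normr_mulmx_le.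
  have H3 : 0 <= `|y - z| * S' by rewrite mulr_ge0.
  have H4 := normr_ge0 (y - z).
  by move: H1 H2 H3 H4; lra.
(* [near_gam] yields the Lipschitz constants [2 S] for [gam] and [3/2 S'] for its inverse; a single
   constant covers both. *)
exists B, X, gam, r, rho, (2 * (S + S' + 1)); split => //; split => //.
- have rho00 : `|0 : 'rV[R]_k| < rho by rewrite normr0.
  have [g0 Pg0] := gamP 0 rho00.
  have := HPsi (gam 0) p (rr1 _ (gamr 0 rho00)); rewrite subrr normr0 => /(_ r10).
  rewrite Pg0 Psip mul0mx addr0 subrr sub0r normrN => H.
  have : `|gam 0 - p| <= 0 by move: (normr_ge0 (gam 0 - p)) H; lra.
  by rewrite normr_le0 subr_eq0 => /eqP.
- move=> y yr; split; first exact: gamr.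
  have [gU gW] := r0U _ (rr0 _ (gamr y yr)); split => //.
  apply/(MF _ gU) => c; have := FPsi (gam y).
  rewrite (gamP y yr).2 [p + _]addrC addrK -mulmxA BJ mulmx0 => /rowP/(_ c).
  by rewrite !mxE.
- move=> y z yr zr; have H := near_gam y z yr zr.
  have H1 : `|(y - z) *m B| <= `|gam y - gam z| + 2^-1 * `|gam y - gam z|.
    rewrite -[X in `|X| <= _](subrK (gam y - gam z)).
    by rewrite (le_trans (ler_normD _ _))// addrC lerD.
  have H2 : `|y - z| <= `|(y - z) *m B| * S'.
    by rewrite -{1}[y - z]mulmx1 -BB' mulmxA; exact: normr_mulmx_le.
  have H3 : 0 <= `|gam y - gam z| * S by rewrite mulr_ge0.
  have H4 := normr_ge0 (gam y - gam z).
  have H5 : `|(y - z) *m B| * S' <= (`|gam y - gam z| + 2^-1 * `|gam y - gam z|) * S'.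
    by rewrite ler_wpM2r.
  by move: H1 H2 H3 H4 H5; nra.
- move=> N j a; apply: Cn_sum => b; apply: CnM; first exact: Cn_cst.
  apply: CnM; first by apply: CnV => //; apply: Cn_det => i i'; exact: CnS (CD N i i').
  rewrite (_ : (fun x => _) = (fun x => (-1) ^+ (a + b) * \det (row' a (col' b (D x))))); last first.
    by apply/funext => x; rewrite mxE.
  apply: CnM; first exact: Cn_cst.
  apply: Cn_det => i i'.
  rewrite (_ : (fun x => _) = (fun x => D x (lift a i) (lift b i'))); last first.
    by apply/funext => x; rewrite 2!mxE.
  exact: CnS (CD N _ _).
- move=> j a; have pr : `|p - p| < r by rewrite subrr normr0.
  have /rowP/(_ a) := XE j p pr.
  by rewrite Dp mulmx1 !mxE.
- move=> A g y j yr dA cg.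
  have yr' := gamr y yr.
  have uD : D (gam y) \in unitmx by rewrite unitmxE unitfE detD.
  have h := @is_derive_implicit R d k Psi D B gam p r rho (2 * (S + S' + 1)) A g y j (\row_a X j a (gam y))
    (fun x a b xr => dPsi x a b (rr0 x xr))
    (fun x a b xr => Cn_continuous (CD 0%N b a) (rU x xr)) dA cg
    (fun y yr => conj (gamr y yr) (gamP y yr).2) gamL yr uD (XE j _ yr').
  by apply: (is_derive_eq h); apply: eq_bigr => a _; rewrite mxE.
Qed.

End charts.

(** * Chart laws and Hausdorff measures *)

Section uniform_law.
Variable R : realType.

Definition unif01 : probability (measurableTypeR R) R := uniform_prob (@ltr01 R).

Lemma unif01_le (U : set R) : measurable U -> (unif01 U <= lebesgue_measure U)%E.
Proof.
move=> mU; rewrite /unif01 /= /uniform_prob.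
rewrite -[leRHS]mul1e -integral_cst//.
apply: ge0_le_integral => //.
- by move=> x _; rewrite lee_fin uniform_pdf_ge0.
- by apply/measurable_EFinP; apply: measurable_funTS; exact: measurable_uniform_pdf.
- move=> x _; rewrite lee_fin /uniform_pdf; case: ifP => // _.
  by rewrite subr0 invr1.
Qed.

Lemma unif01_itv_le (a b : R) : a <= b -> (unif01 `[a, b]%classic <= (b - a)%:E)%E.
Proof.
move=> ab; rewrite (le_trans (unif01_le _))//= lebesgue_measure_itv /= lte_fin.
by case: ifPn => // _; rewrite lee_fin subr_ge0.
Qed.

Lemma unif01_itv (c : R) : 0 <= c <= 1 -> unif01 `[0, c]%classic = c%:E.
Proof.
move=> /andP[c0 c1]; rewrite /unif01 /= /uniform_prob.
rewrite (eq_integral (cst 1%E)); last first.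
  move=> x; rewrite inE /= in_itv /= => /andP[x0 xc].
  by rewrite /uniform_pdf x0 (le_trans xc c1) /= subr0 invr1.
rewrite integral_cst//= mul1e lebesgue_measure_itv /= lte_fin.
by case: ltgtP c0 => // [_|<-] _; rewrite ?oppr0 ?adde0 ?sube0.
Qed.

Lemma unif01_01 : unif01 `[0, 1]%classic = 1%E.
Proof. by rewrite unif01_itv// ler01 lexx. Qed.

End uniform_law.
Arguments unif01 {R}.

Section hausdorff_lower_bound.
Variable R : realType.

Lemma probability_ae_setI d (T : measurableType d) (P : probability T R) (A D : set T) :
  measurable A -> measurable D -> P D = 1%E -> P A = P (A `&` D).
Proof.
move=> mA mD PD; rewrite [LHS](measureDI P mA mD) [X in (X + _)%E](_ : _ = 0%E) ?add0e//.
apply/eqP; rewrite eq_le measure_ge0 andbT.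
rewrite (le_trans (_ : _ <= P (~` D))%E)//.
  apply: le_measure; rewrite ?inE; first exact: measurableD.
    exact: measurableC.
  by move=> x [].
by rewrite probability_setC// PD subee.
Qed.

Lemma ball_vol_gt0 s : 0 < ball_vol R s.
Proof.
suff: 0 < ball_vol R s /\ 0 < ball_vol R s.+1 by case.
elim: s => [|s [IH1 IH2]] /=; first by rewrite ltr01 ltr0n.
by split=> //; rewrite mulr_gt0// divr_gt0 ?ltr0n// mulr_gt0// pi_gt0.
Qed.

Lemma ediam_dist d (A : set 'rV[R]_d) x y c : (ediam A <= c%:E)%E -> A x -> A y ->
  `|x - y| <= fine (ediam A).
Proof.
move=> Ac Ax Ay.
have A0 : (0 <= ediam A)%E by apply: ereal_sup_ubound; left.
have fA : ediam A \is a fin_num by rewrite ge0_fin_numE// (le_lt_trans Ac) ?ltry.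
rewrite (le_trans (edist_norm_ge x y))// -lee_fin fineK//.
by apply: ereal_sup_ubound; right; exists x => //; exists y.
Qed.

(* A set of diameter [D] pulls back under the bi-Lipschitz map into a cube of
   side [O(D)], so every cover of [A] bounds the probability. *)
Lemma law_le_hausdorff d k (G : 'rV[R]_k -> 'rV[R]_d) (a L : R) (O : set 'rV[R]_d) :
  0 < a -> 0 < L -> continuous G ->
  (forall y z, `|y| <= 2 * a -> `|z| <= 2 * a -> `|y - z| <= L * `|G y - G z|) ->
  (forall y, `|y| <= 2 * a -> O (G y)) ->
  exists2 C, 0 < C & forall (v : 'rV[R]_k) (A : set (Rd R d)),
    (forall i, `[0, 1]%classic (v 0 i)) -> measurable A ->
    (powprob unif01 k [set w | A (G (a *: ((w : 'rV[R]_k) + v)))] <= C%:E * hausdorff k (A `&` O))%E.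
Proof.
move=> a0 L0 cG GL GO.
pose bv := ball_vol R k / 2 ^+ k.
have bv0 : 0 < bv by rewrite divr_gt0 ?ball_vol_gt0// exprn_gt0.
(* A piece of diameter [D] pulls back into a cube of side [2 L D / a], the factor 2 coming from
   centring it at one of its points. *)
pose K := (2 * (L / a)) ^+ k.
have K0 : 0 < K by rewrite exprn_gt0// mulr_gt0// divr_gt0.
exists (K / bv); first by rewrite divr_gt0.
move=> v A v01 mA.
set P := powprob unif01 k.
pose D := [set w : Rd R k | forall i, `[0, 1]%classic ((w : 'rV[R]_k) 0 i)].
have mD : measurable D by exact: (@measurable_rV_box _ k (fun=> `[0, 1]%classic)).
have PD : P D = 1%E by apply: powprob_cube; [exact: measurable_itv|exact: unif01_01].
pose f (w : 'rV[R]_k) := G (a *: (w + v)).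
have mf : @measurable_fun _ _ (Rd R k) (Rd R d) setT f.
  apply: measurable_rV_continuous => w; apply: (continuous_comp (f := fun w => a *: (w + v))); last exact: cG.
  apply: continuousZ; first exact: cst_continuous.
  by apply: continuousD; [exact: cvg_id|exact: cst_continuous].
set E := [set w | _].
have mE : measurable (E : set (Rd R k)) by have := mf measurableT _ mA; rewrite setTI.
rewrite (probability_ae_setI mE mD PD).
(* [w + v] lies in [[0, 2]^k], which is the origin of the radius [2 * a]. *)
have fw w : D w -> `|a *: (w + v)| <= 2 * a.
  move=> Dw; apply: rV_norm_le => [|i]; first by rewrite mulr_ge0// ltW.
  rewrite !mxE normrM (gtr0_norm a0) mulrC ler_pM2r//.
  have := Dw i; have := v01 i; rewrite /= !in_itv /= => /andP[? ?] /andP[? ?].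
  by rewrite ger0_norm; lra.
have [p Pp] : exists p : R, P (E `&` D) = p%:E.
  exists (fine (P (E `&` D))); rewrite fineK//; apply: fin_num_measure.
  exact: measurableI.
suff H : ((p / (K / bv))%:E <= hausdorff k (A `&` O))%E.
  rewrite Pp; apply: (@le_trans _ _ ((K / bv)%:E * (p / (K / bv))%:E)%E).
    by rewrite -EFinM lee_fin mulrC divfK// gt_eqF// divr_gt0.
  by apply: lee_wpmul2l => //; rewrite lee_fin ltW// divr_gt0.
(* Any [delta] bounds the supremum from below. In the estimate of covers the bound on diameters
   serves to make them finite. *)
apply: le_trans (_ : hausdorff_delta k 1 (A `&` O) <= _)%E; last first.
  by apply: ereal_sup_ubound; exists 1 => //=.
apply: le_ereal_inf_tmp => _ [C [AC Cd] <-].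
pose l n := L / a * fine (ediam (C n)).
have l0 n : 0 <= l n.
  rewrite mulr_ge0 ?fine_ge0//; first by rewrite divr_ge0 ?ltW.
  by apply: ereal_sup_ubound; left.
(* Each piece is centred at one of its preimages in the cube; for a piece that misses the image the
   centre is 0 and the claim is vacuous. *)
have ex_w n : exists wn : 'rV[R]_k, forall w : 'rV[R]_k, E w -> D w -> C n (f w) -> forall i, `|w 0 i - wn 0 i| <= l n.
  have [[wn [En Dn Cn]]|H] := pselect (exists wn, [/\ E wn, D wn & C n (f wn)]).
    exists wn => w Ew Dw Cw i.
    have h1 := GL _ _ (fw w Dw) (fw wn Dn).
    have h2 := ediam_dist (Cd n) Cw Cn.
    have h3 : `|a *: (w + v) - a *: (wn + v)| = a * `|w - wn|.
      by rewrite -scalerBr normrZ (gtr0_norm a0) opprD addrACA subrr addr0.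
    rewrite h3 in h1.
    rewrite (le_trans (_ : _ <= `|w - wn|))//; first by have := rV_norm_ge (w - wn) i; rewrite !mxE.
    by rewrite /l mulrAC ler_pdivlMr// mulrC (le_trans h1)// ler_wpM2l// ltW.
  by exists (0 : 'rV[R]_k) => w Ew Dw Cw; exfalso; apply: H; exists w.
have [W HW] := choice ex_w.
pose box n := [set w : Rd R k | forall i, `[W n 0 i - l n, W n 0 i + l n]%classic ((w : 'rV[R]_k) 0 i)].
have mbox n : measurable (box n).
  by apply: (@measurable_rV_box _ k (fun i => `[W n 0 i - l n, W n 0 i + l n]%classic)).
have Ebox : E `&` D `<=` \bigcup_n box n.
  move=> w [Ew Dw]; have [n _ Cn] := AC (f w) (conj Ew (GO _ (fw w Dw))).
  exists n => // i; have := HW n w Ew Dw Cn i.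
  by rewrite ler_distl /= in_itv.
have Pbox n : (P (box n) <= ((2 * l n) ^+ k)%:E)%E.
  apply: (@powprob_box_le _ _ k (2 * l n) (fun i => `[W n 0 i - l n, W n 0 i + l n]%classic)) => // i.
  apply: le_trans (unif01_itv_le _) _; first by have := l0 n; lra.
  by rewrite lee_fin; have := l0 n; lra.
have : (P (E `&` D) <= \sum_(0 <= n <oo) (K / bv)%:E * (bv * fine (ediam (C n)) ^+ k)%:E)%E.
  apply: le_trans (measure_sigma_subadditive P mbox _ Ebox) _; first exact: measurableI.
  apply: lee_nneseries => n _ //.
  apply: le_trans (Pbox n) _; rewrite -EFinM lee_fin /K /l [X in X ^+ k]mulrA exprMn.
  by rewrite [leRHS]mulrA divfK ?gt_eqF.
rewrite Pp nneseriesZl//; last first.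
  move=> n _; rewrite lee_fin mulr_ge0 ?(ltW bv0)// exprn_ge0// fine_ge0//.
  by apply: ereal_sup_ubound; left.
have KV : 0 < K / bv by rewrite divr_gt0.
move=> H; rewrite [p / _]mulrC EFinM. by rewrite (lee_pdivrMl _ _ KV).
Qed.

End hausdorff_lower_bound.

(** * Laws carried by charts *)

Section charts_measure.
Variable R : realType.

Definition clamp k (b : R) (y : 'rV[R]_k) : 'rV[R]_k :=
  \row_i Num.max (- b) (Num.min b (y 0 i)).

Lemma clamp_id k b (y : 'rV[R]_k) : `|y| <= b -> clamp b y = y.
Proof.
move=> yb; apply/rowP => i; rewrite mxE.
have := le_trans (rV_norm_ge y i) yb; rewrite ler_norml => /andP[h1 h2].
by rewrite min_r// max_r.
Qed.

Lemma clamp_norm_le k b (y : 'rV[R]_k) : 0 <= b -> `|clamp b y| <= b.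
Proof.
move=> b0; apply: rV_norm_le => // i; rewrite mxE ler_norml.
by rewrite le_max lexx /= ge_max ge_min lexx /= andbT; lra.
Qed.

Lemma clamp_lip k b (y z : 'rV[R]_k) : 0 <= b -> `|clamp b y - clamp b z| <= `|y - z|.
Proof.
move=> b0; apply: rV_norm_le => // i; rewrite !mxE.
apply: le_trans (_ : `|y 0 i - z 0 i| <= _); last by have := rV_norm_ge (y - z) i; rewrite !mxE.
move: (y 0 i) (z 0 i) => s t.
suff H (u v : R) : u <= v -> `|Num.max (- b) (Num.min b u) - Num.max (- b) (Num.min b v)| <= `|u - v|.
  have [/H//|/ltW/H] := leP s t.
  by rewrite distrC [in X in _ <= X -> _]distrC.
move=> uv; have uv' : `|u - v| = v - u by rewrite distrC ger0_norm// subr_ge0.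
rewrite uv' ler_norml.
rewrite /Order.max /Order.min.
by case: (ltP b u) => ?; case: (ltP b v) => ?; case: ltP => ?; case: ltP => ?; apply/andP; split; lra.
Qed.

(** Measurability of the laws calls for a map continuous on the whole space, while [gam] is
    controlled only for [|y| < rho]; precomposing with [clamp] provides one. *)
Lemma chart_extension d k p S B X gam r rho L : @chart R d k p S B X gam r rho L ->
  forall b, 0 < b < rho -> exists2 G : 'rV[R]_k -> 'rV[R]_d, continuous G &
    forall y, `|y| <= b -> G y = gam y.
Proof.
move=> ch b /andP[b0 br]; exists (gam \o clamp b); last by move=> y /clamp_id /= ->.
have cr z : `|clamp b z : 'rV[R]_k| < rho by rewrite (le_lt_trans (clamp_norm_le _ (ltW b0))).
move=> y; apply/(@cvgrPdist_le _ _ _ (nbhs y)) => e e0.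
have eL : 0 < e / L by rewrite divr_gt0// (chart_L ch).
have nb : nbhs (y : 'rV[R]_k) [set z : 'rV[R]_k | `|y - z| < e / L].
  by have := @nbhsx_ballx R 'rV[R]_k y (e / L) eL; rewrite mx_norm_ball.
apply: filterS nb => z /= yz.
rewrite (le_trans (chart_lip ch (cr y) (cr z)))// (le_trans (_ : _ <= L * `|y - z|))//.
  by rewrite ler_pM2l ?(chart_L ch)// clamp_lip// ltW.
by rewrite mulrC -ler_pdivlMr ?(chart_L ch)// ltW.
Qed.

Lemma measurable_norm_ball d (p : 'rV[R]_d) s :
  measurable ([set x : 'rV[R]_d | `|x - p| < s] : set (Rd R d)).
Proof.
apply: sub_sigma_algebra.
apply: (@open_comp _ _ (fun x => `|x - p|) [set t | t < s]) => [x _|]; last exact: open_lt.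
apply: (continuous_comp (f := fun x => x - p)); last exact: norm_continuous.
by apply: continuousB; [exact: cvg_id|exact: cst_continuous].
Qed.

Lemma chart_law_le_hausdorff d k p S B X gam r rho L a (O : set 'rV[R]_d) :
  @chart R d k p S B X gam r rho L -> S `<=` O -> 0 < a -> 2 * a < rho ->
  exists G : 'rV[R]_k -> 'rV[R]_d, [/\ continuous G,
    forall y, `|y| <= 2 * a -> G y = gam y &
  exists2 C, 0 < C & forall (v : 'rV[R]_k) (A : set (Rd R d)),
    (forall i, `[0, 1]%classic (v 0 i)) -> measurable A ->
    (powprob unif01 k [set w | A (G (a *: ((w : 'rV[R]_k) + v)))] <= C%:E * hausdorff k (A `&` O))%E].
Proof.
move=> ch SO a0 ar.
have b0r : 0 < 2 * a < rho by rewrite ar mulr_gt0.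
have [G cG GE] := chart_extension ch b0r.
exists G; split => //.
apply: (law_le_hausdorff a0 (chart_L ch) cG).
  by move=> y z yb zb; rewrite !GE//; apply: (chart_colip ch); exact: le_lt_trans ar.
move=> y yb; rewrite GE//; apply: SO; apply: (chart_in ch _).2; exact: le_lt_trans ar.
Qed.

(** For [v = 0], the cube [[0, e s]^k] has mass [(e s)^k], and the Lipschitz bound places its image
    in the ball of radius [s]. *)
Lemma chart_mass_ge d k p S B X gam r rho L (O : set 'rV[R]_d) :
  @chart R d k p S B X gam r rho L -> S `<=` O ->
  exists c s0 : R, [/\ 0 < c, 0 < s0 & forall s, 0 < s <= s0 ->
    ((c * s ^+ k)%:E <= hausdorff k ([set x : 'rV[R]_d | (`|x - p| < s)%R] `&` O))%E].
Proof.
move=> ch SO.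
pose a := rho / 4; have a0 : 0 < a by rewrite divr_gt0// (chart_rho ch).
have ar : 2 * a < rho by have := chart_rho ch; rewrite /a; lra.
have [G [cG GE [C C0 H]]] := chart_law_le_hausdorff ch SO a0 ar.
have L0 := chart_L ch.
(* Then [L (a (e s)) = s / 2 < s], and [s <= e^-1] keeps the small cube inside the unit cube. *)
pose e := (2 * L * a)^-1.
have e0 : 0 < e by rewrite invr_gt0; apply: mulr_gt0 => //; exact: mulr_gt0.
have ec : 0 < e ^+ k / C by rewrite divr_gt0// exprn_gt0.
exists (e ^+ k / C), e^-1; split => //; first by have := e0; rewrite -invr_gt0.
move=> s /andP[s0 ss].
pose A : set (Rd R d) := [set x : 'rV[R]_d | `|x - p| < s].
have mA : measurable A by exact: measurable_norm_ball.
have c01 : 0 <= e * s <= 1.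
  apply/andP; split; first by apply: mulr_ge0; exact: ltW.
  apply: (@le_trans _ _ (e * e^-1)); first by rewrite ler_pM2l.
  by rewrite mulfV// gt_eqF.
have v0 : forall i, `[0, 1]%classic ((0 : 'rV[R]_k) 0 i).
  by move=> i; rewrite /= in_itv /= mxE lexx ler01.
have {}H := H 0 A v0 mA.
pose box := [set w : Rd R k | forall i, `[0, e * s]%classic ((w : 'rV[R]_k) 0 i)].
have mbox : measurable box by exact: (@measurable_rV_box _ k (fun=> `[0, e * s]%classic)).
have Pbox : powprob unif01 k box = ((e * s) ^+ k)%:E.
  by apply: (@powprob_box_eq _ _ k (e * s) (fun=> `[0, e * s]%classic)) => // i; exact: unif01_itv.
have : (powprob unif01 k box <= C%:E * hausdorff k (A `&` O))%E.
  apply: le_trans _ H; apply: le_measure; rewrite ?inE//.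
    have mf : @measurable_fun _ _ (Rd R k) (Rd R d) setT (fun w : 'rV[R]_k => G (a *: (w + 0))).
      apply: measurable_rV_continuous => w.
      apply: (continuous_comp (f := fun w => a *: (w + 0))); last exact: cG.
      apply: continuousZ; first exact: cst_continuous.
      by apply: continuousD; [exact: cvg_id|exact: cst_continuous].
    by have := mf measurableT _ mA; rewrite setTI.
  move=> w wb /=; rewrite addr0.
  have nw : `|a *: (w : 'rV[R]_k)| <= a * (e * s).
    rewrite normrZ (gtr0_norm a0) ler_pM2l//; apply: rV_norm_le => [|i]; first by case/andP: c01.
    by have := wb i; rewrite /= in_itv /= => /andP[w0 w1]; rewrite ger0_norm.
  have nw2 : `|a *: (w : 'rV[R]_k)| <= 2 * a.
    rewrite (le_trans nw)// mulrC ler_pM2r//; by case/andP: c01 => _ h; rewrite (le_trans h)// ler1n.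
  rewrite /A /= GE// -(chart_base ch).
  have r0 := chart_rho ch.
  rewrite (le_lt_trans (chart_lip ch _ _))//; first exact: le_lt_trans ar.
    by rewrite normr0.
  rewrite subr0 (le_lt_trans (_ : _ <= L * (a * (e * s))))//; first by rewrite ler_pM2l.
  have -> : L * (a * (e * s)) = s / 2 by rewrite /e; field; rewrite !gt_eqF.
  by lra.
rewrite Pbox exprMn => {}H.
rewrite mulrAC EFinM muleC lee_pdivrMl//.
Qed.

End charts_measure.

(** * Decay of the averaged exponential *)

Section paths.
Variable R : realType.

Lemma Sreg_reparam (T T' : Type) N (phi : T' -> T) (g : T -> R -> R) :
  Sreg N g -> Sreg N (fun p => g (phi p)).
Proof.
elim: N g => [|N IH] g [[C gC] Sg]; split; try by exists C => p; exact: gC.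
  by move=> p; exact: Sg.
have [g' [dg Sg']] := Sg; exists (fun p => g' (phi p)); split; last exact: IH.
by move=> p; exact: dg.
Qed.

Lemma Sreg_sum (T : Type) (I : Type) (l : seq I) N (f : I -> T -> R -> R) :
  (forall i, Sreg N (f i)) -> Sreg N (fun p s => \sum_(i <- l) f i p s).
Proof.
move=> Sf; elim: l => [|i l IH].
  by under eq_fun do under eq_fun do rewrite big_nil; exact: Sreg_cst.
by under eq_fun do under eq_fun do rewrite big_cons; exact: SregD.
Qed.

Variables (d k : nat) (p : 'rV[R]_d) (S : set 'rV[R]_d) (B : 'M[R]_(k, d))
  (X : 'I_k -> 'I_d -> 'rV[R]_d -> R) (gam : 'rV[R]_k -> 'rV[R]_d) (r rho L : R).
Hypothesis ch : chart p S B X gam r rho L.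
Notation Ur := [set x : 'rV[R]_d | `|x - p| < r].

Lemma chart_continuous y : `|y| < rho -> {for y, continuous gam}.
Proof.
move=> yr; apply/(@cvgrPdist_le _ _ _ (nbhs y)) => e e0.
have L0 := chart_L ch.
pose dl := Num.min (e / L) (rho - `|y|).
have dl0 : 0 < dl by rewrite lt_min divr_gt0// subr_gt0.
have nb : nbhs (y : 'rV[R]_k) [set z : 'rV[R]_k | `|y - z| < dl].
  by have := @nbhsx_ballx R 'rV[R]_k y dl dl0; rewrite mx_norm_ball.
apply: filterS nb => z /=; rewrite lt_min => /andP[yz1 yz2].
have zr : `|z| < rho.
  rewrite -(subKr y z) (le_lt_trans (ler_normB _ _))// -ltrBrDl//.
rewrite (le_trans (chart_lip ch yr zr))//.
by rewrite mulrC -ler_pdivlMr// ltW.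
Qed.

Lemma chart_comp_continuous (A : 'rV[R]_d -> R) y :
  (forall x, Ur x -> {for x, continuous A}) -> `|y| < rho ->
  {for y, continuous (A \o gam)}.
Proof.
move=> cA yr; apply: continuous_comp; first exact: chart_continuous.
by apply: cA; exact: (chart_in ch yr).1.
Qed.

Lemma compact_norm_ball n b : compact [set y : 'rV[R]_n | `|y| <= b].
Proof.
apply: bounded_closed_compact.
  by exists b; split; [exact: num_real|move=> M bM y /= yb; rewrite (le_trans yb)// ltW].
rewrite (_ : [set _ | _] = (fun y : 'rV[R]_n => `|y|) @^-1` [set t | t <= b]) //.
by apply: closed_comp => [x _|]; [exact: norm_continuous|exact: closed_le].
Qed.

Lemma chart_comp_bounded (A : 'rV[R]_d -> R) b :
  (forall x, Ur x -> {for x, continuous A}) -> b < rho ->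
  exists2 C, 0 < C & forall y, `|y| <= b -> `|A (gam y)| <= C.
Proof.
move=> cA br; pose K := [set y : 'rV[R]_k | `|y| <= b].
have cK : {within K, continuous (A \o gam)}.
  apply/continuous_in_subspaceT => y; rewrite inE /K /= => yb.
  by apply: chart_comp_continuous => //; exact: le_lt_trans br.
have := compact_bounded (continuous_compact cK (@compact_norm_ball k b)).
move=> [M [_ HM]]; exists (`|M| + 1); first by rewrite ltr_wpDl.
move=> y yb; apply: (HM (`|M| + 1)); last by exists y.
by rewrite (le_lt_trans (ler_norm M))// ltrDl.
Qed.

Variable a : R.
Hypotheses (a0 : 0 < a) (ar : 2 * a < rho).

(** Subtypes of this predicate are the parameter types of the families below; it keeps the whole
    segment in the ball where [gam] is controlled. *)
Definition path_dom (j : 'I_k) (y : 'rV[R]_k) : Prop :=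
  forall s : R, 0 <= s <= 1 -> `|y + (a * s) *: ebase R j| <= 2 * a.

Lemma path_derive j y (A : 'rV[R]_d -> R) (g : 'I_d -> 'rV[R]_d -> R) (s : R) :
  (forall x b, Ur x -> is_derive x (ebase R b) A (g b x)) ->
  (forall x b, Ur x -> {for x, continuous (g b)}) ->
  path_dom j y -> 0 <= s <= 1 ->
  is_derive s 1 (fun s => A (gam (y + (a * s) *: ebase R j)))
    (a * \sum_b g b (gam (y + (a * s) *: ebase R j)) * X j b (gam (y + (a * s) *: ebase R j))).
Proof.
move=> dA cg yD s01.
have h := is_derive_line (chart_derive ch j (le_lt_trans (yD s s01) ar) dA cg).
have h2 : is_derive s 1 (fun s : R => a * s) a.
  have h' := is_deriveZ a (is_derive_id s (1:R)); apply: (is_derive_eq h').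
  by rewrite /GRing.scale /= mulr1.
have h3 := is_derive1_comp h h2.
by apply: (is_derive_eq h3); rewrite mulrC.
Qed.

Lemma path_continuous j y (A : 'rV[R]_d -> R) (s : R) :
  (forall x, Ur x -> {for x, continuous A}) -> path_dom j y -> 0 <= s <= 1 ->
  {for s, continuous (fun s => A (gam (y + (a * s) *: ebase R j)))}.
Proof.
move=> cA yD s01.
apply: (continuous_comp (f := fun s : R => y + (a * s) *: ebase R j) (g := A \o gam)).
  apply: continuousD; first exact: cst_continuous.
  apply: (@continuousZ _ _ _ (fun s : R => a * s) (fun=> ebase R j)); last exact: cst_continuous.
  by apply: continuousM; [exact: cst_continuous|exact: cvg_id].
by apply: chart_comp_continuous => //; exact: le_lt_trans (yD s s01) ar.
Qed.

(** The derivative of [A \o gam] along the path is again some [A' \o gam], with [A'] built from the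
    partial derivatives of [A] and the field [X j]. The induction closes because the fields are
    defined and regular on a ball of the ambient space. *)
Lemma Sreg_path j N (A : 'rV[R]_d -> R) : Cn N Ur A ->
  Sreg N (fun (y : {y | path_dom j y}) s => A (gam (sval y + (a * s) *: ebase R j))).
Proof.
elim: N A => [|N IH] A CA.
  have [C C0 AC] := chart_comp_bounded (Cn_continuous CA) ar.
  split; first by exists C => -[y yD] s s01; apply: AC; exact: yD.
  by move=> [y yD] s s01; apply: path_continuous => //; exact: Cn_continuous CA.
have [C C0 AC] := chart_comp_bounded (Cn_continuous CA) ar.
split; first by exists C => -[y yD] s s01; apply: AC; exact: yD.
have [_ [g [dg Cg]]] := CA.
pose A' x := a * \sum_b g b x * X j b x.
exists (fun y s => A' (gam (sval y + (a * s) *: ebase R j))); split.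
  by move=> [y yD] s s01; apply: path_derive => // x b; exact: Cn_continuous (Cg b) x.
apply: (IH A'); apply: CnM; first exact: Cn_cst.
by apply: Cn_sum => b; apply: CnM; [exact: Cg|exact: (chart_field ch)].
Qed.

Lemma chart_comp_lipschitz (A : 'rV[R]_d -> R) : Cn 1 Ur A ->
  exists C, forall y z, `|y| <= 2 * a -> `|z| <= 2 * a ->
    `|A (gam y) - A (gam z)| <= C * `|y - z|.
Proof.
move=> [_ [g [dg Cg]]].
have cg x b : Ur x -> {for x, continuous (g b)} by exact: (Cg b).1 x.
(* [C1_mean] works on open balls, so an intermediate radius is inserted around the closed ball of
   radius [2 * a]. *)
pose b := (2 * a + rho) / 2.
have b2 : 2 * a < b by rewrite /b; move: ar; lra.
have br : b < rho by rewrite /b; move: ar; lra.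
pose D i x := \sum_b g b x * X i b x.
have CD i : Cn 0 Ur (D i).
  by apply: Cn_sum => c; apply: CnM; [exact: (Cg c)|exact: (chart_field ch)].
have /choice[C HC] : forall i, exists C, 0 < C /\ forall y, `|y| <= b -> `|D i (gam y)| <= C.
  by move=> i; have [C C0 H] := chart_comp_bounded (Cn_continuous (CD i)) br; exists C.
pose M := \sum_i C i.
have CM i : C i <= M.
  by rewrite /M (bigD1 i)//= lerDl sumr_ge0// => j _; rewrite ltW// (HC j).1.
exists (M * k%:R) => y z yb zb.
have d1 u i : `|u - 0| < b -> is_derive u (ebase R i) (A \o gam) (D i (gam u)).
  rewrite subr0 => ub; apply: (chart_derive ch) => //; exact: lt_trans br.
have d2 u i : `|u - 0| < b -> `|D i (gam u) - 0| <= M.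
  by rewrite !subr0 => ub; rewrite (le_trans ((HC i).2 u (ltW ub))).
have := C1_mean d1 d2 (x := y) (y := z).
rewrite !subr0 => /(_ (le_lt_trans yb b2) (le_lt_trans zb b2)).
rewrite big1 ?subr0 => [H|i _]; last by rewrite mul0r.
have M0 : 0 <= M by apply: sumr_ge0 => i _; rewrite ltW// (HC i).1.
rewrite (le_trans H)// -mulrA ler_wpM2l//.
rewrite (_ : \sum_i _ = \sum_i `|(y - z) 0 i|); first exact: sum_coord_norm_le.
by apply: eq_bigr => i _; rewrite !mxE.
Qed.

Definition diff_dom (j : 'I_k) (yu : 'rV[R]_k * 'rV[R]_k) : Prop :=
  [/\ path_dom j yu.1, path_dom j yu.2 & yu.1 != yu.2].

(** The bounds must not degenerate as the two base points merge: they come from Lipschitz estimates,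
    at the price of one more order of regularity. Differentiation in [s] once more replaces [A] by
    [A']. *)
Lemma Sreg_diff j N (A : 'rV[R]_d -> R) : Cn N.+1 Ur A ->
  Sreg N (fun (yu : {yu | diff_dom j yu}) s => `|(sval yu).1 - (sval yu).2|^-1 *
    (A (gam ((sval yu).1 + (a * s) *: ebase R j)) -
     A (gam ((sval yu).2 + (a * s) *: ebase R j)))).
Proof.
have bd A' : Cn 1 Ur A' -> exists C : R, forall (yu : {yu | diff_dom j yu}) s, 0 <= s <= 1 ->
    `| `|(sval yu).1 - (sval yu).2|^-1 * (A' (gam ((sval yu).1 + (a * s) *: ebase R j)) -
     A' (gam ((sval yu).2 + (a * s) *: ebase R j)))| <= C.
  move=> /chart_comp_lipschitz[C HC]; exists C => -[[y z] /= [yD zD yz]] s s01.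
  have yz0 : 0 < `|y - z| by rewrite normr_gt0 subr_eq0.
  rewrite normrM normfV normr_id ler_pdivrMl// [leRHS]mulrC.
  apply: (le_trans (HC _ _ (yD s s01) (zD s s01))); rewrite /=.
  by rewrite opprD addrACA subrr addr0.
have CW N' A' : Cn N'.+1 Ur A' -> Cn 1 Ur A' by elim: N' => // N' IH /CnW.
elim: N A => [|N IH] A CA; (split; first exact/bd/CW/CA).
  move=> [[y z] /= [yD zD yz]] s s01; apply: continuousM; first exact: cst_continuous.
  by apply: continuousB; apply: path_continuous => //; exact: Cn_continuous CA.
have [_ [g [dg Cg]]] := CA.
pose A' x := a * \sum_b g b x * X j b x.
exists (fun yu s => `|(sval yu).1 - (sval yu).2|^-1 * (A' (gam ((sval yu).1 + (a * s) *: ebase R j)) -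
     A' (gam ((sval yu).2 + (a * s) *: ebase R j)))); split.
  move=> [[y z] /= [yD zD yz]] s s01.
  have cg x b : Ur x -> {for x, continuous (g b)} by exact: (Cg b).1 x.
  have h1 := path_derive dg cg yD s01.
  have h2 := path_derive dg cg zD s01.
  exact: is_deriveZ (is_deriveB h1 h2).
apply: (IH A'); apply: CnM; first exact: Cn_cst.
by apply: Cn_sum => b; apply: CnM; [exact: Cg|exact: (chart_field ch)].
Qed.

End paths.

(** * Averages against the beta law *)

Section averages.
Variable R : realType.
Notation mu := (@lebesgue_measure R).

(** Up to normalisation its density is [(s (1 - s)) ^+ N], the weight of [oscillatory_decay]. *)
Definition betaN (N : nat) : probability (measurableTypeR R) R := beta_prob N.+1 N.+1.

Lemma Rintegral_beta N (h : measurableTypeR R -> R) : bmeas h ->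
  Rintegral (betaN N) setT h =
  (beta_fun N.+1 N.+1)^-1 * Rintegral mu `[0, 1] (fun s : R => (s * (1 - s)) ^+ N * h s).
Proof.
move=> bh; have [mh [C hC]] := bh.
have iw : mu.-integrable `[0, 1] (EFin \o (fun s : R => (s * (1 - s)) ^+ N * h s)).
  apply: measurable_bounded_integrable => //.
  - by rewrite /= lebesgue_measure_itv /= lte_fin ltr01 -EFinB ltry.
  - apply: measurable_funTS; apply: measurable_funM => //.
    apply: measurable_funX; apply: measurable_funM => //.
    exact: measurable_funB.
  - exists (`|C| + 0); split; first exact: num_real.
    move=> M CM s /=; rewrite in_itv /= => /andP[s0 s1].
    rewrite normrM (le_trans (_ : _ <= 1 * `|C|))//; last by rewrite mul1r ltW// -[`|C|]addr0.
    apply: ler_pM => //; last by rewrite (le_trans (hC s))// ler_norm.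
    rewrite normrX exprn_ile1// ger0_norm ?mulr_ge0 ?subr_ge0//.
    by rewrite mulr_ile1 ?subr_ge0// lerBlDr lerDl.
rewrite -RintegralZl// [RHS]Rintegral_mkcond /Rintegral /betaN.
rewrite (integral_beta_prob (f := EFin \o h)) //.
- congr fine; apply: eq_integral => s _ /=.
  rewrite -EFinM; congr EFin; rewrite /beta_pdf !patchE.
  case: ifPn => _; last by rewrite mul0r mulr0.
  by rewrite /XMonemX /= /unstable.onem exprMn; ring.
- exact/measurable_EFinP.
- have := bmeas_integrable (betaN N) bh.
  by move=> /integrableP[].
Qed.

(** On every line of the cube parallel to axis [j] the phase is [t * Q p] for some parameter [p].
    [oscillatory_decay] is uniform in [p], and [powprob_average] absorbs the other coordinates. *)
Lemma average_decay N k (T : Type) (q Q : T -> R -> R) (c0 : R) :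
  0 < c0 -> Sreg N q -> (forall p (s : R), 0 <= s <= 1 -> c0 <= `|q p s|) ->
  (forall p (s : R), 0 <= s <= 1 -> is_derive s 1 (Q p) (q p s)) ->
  exists2 C, 0 < C & forall (t : R) (f : Rd R k -> R) (j : 'I_k), 0 < t ->
    measurable_fun setT f ->
    (forall v : 'rV[R]_k, (forall i, `[0, 1]%classic (v 0 i)) ->
      exists p, forall s : R, 0 <= s <= 1 -> f (rV_upd v j s) = t * Q p s) ->
    `|Rintegral (powprob (betaN N) k) setT (fun v => cos (f v))| <= C / t ^+ N /\
    `|Rintegral (powprob (betaN N) k) setT (fun v => sin (f v))| <= C / t ^+ N.
Proof.
move=> c00 Sq qc dQ.
have [C HC] := oscillatory_decay c00 (Sreg_cst T N 1) Sq qc dQ.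
pose bf : R := beta_fun N.+1 N.+1.
have bf0 : 0 < bf by exact: beta_fun_gt0.
exists (`|C| / bf + 1); first by rewrite ltr_wpDl// divr_ge0// ltW.
move=> t f j t0 mf fQ.
have tN : 0 < t ^+ N by rewrite exprn_gt0.
have mupd (v : 'rV[R]_k) : @measurable_fun _ _ (measurableTypeR R) (Rd R k) setT (rV_upd v j).
  apply: measurable_rV => i; rewrite /rV_upd.
  under eq_fun do rewrite mxE.
  by case: (i == j); [exact: measurable_id|exact: measurable_cst].
have CC : C / t ^+ N / bf <= (`|C| / bf + 1) / t ^+ N.
  rewrite mulrAC ler_pM2r ?invr_gt0// (le_trans (_ : _ <= `|C| / bf)) ?lerDl//.
  by rewrite ler_pM2r ?invr_gt0// ler_norm.
have key (h : R -> R) :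
   (forall d (T' : measurableType d) (g : T' -> R), measurable_fun setT g -> bmeas (fun x => h (g x))) ->
   (forall p (t : R), 0 < t -> `|Rintegral mu `[0, 1] (fun s => (s * (1 - s)) ^+ N * 1 * h (t * Q p s))| <= C / t ^+ N) ->
   `|Rintegral (powprob (betaN N) k) setT (fun v => h (f v))| <= (`|C| / bf + 1) / t ^+ N.
  move=> hm Hh; apply: (@powprob_average R (betaN N) `[0, 1]%classic _ _ k _ j) => //.
  - exact: beta_prob01.
  - exact: (hm _ (Rd R k) f mf).
  move=> v v01; have [p Hp] := fQ v v01.
  rewrite (@Rintegral_beta N (fun s => h (f (rV_upd v j s)))); last first.
    by apply: (hm _ (measurableTypeR R) (fun s => f (rV_upd v j s))); exact: measurableT_comp (mupd v).
  apply: le_trans CC; rewrite normrM (ger0_norm (_ : 0 <= bf^-1)) ?invr_ge0 ?(ltW bf0)//.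
  rewrite [leRHS]mulrC ler_pM2l ?invr_gt0//; apply: le_trans (Hh p t t0).
  rewrite (_ : Rintegral _ _ _ = Rintegral mu `[0, 1] (fun s => (s * (1 - s)) ^+ N * 1 * h (t * Q p s)))//.
  apply: eq_Rintegral => s; rewrite inE /= in_itv /= => s01.
  by rewrite mulr1 Hp.
split; apply: key.
- by move=> d T' g mg; exact: bmeas_cos.
- by move=> p t' t'0; exact: (HC p t' t'0).1.
- by move=> d T' g mg; exact: bmeas_sin.
- by move=> p t' t'0; exact: (HC p t' t'0).2.
Qed.

End averages.

Section chart_averages.
Variable R : realType.
Variables (d k : nat) (p : 'rV[R]_d) (S : set 'rV[R]_d) (B : 'M[R]_(k, d))
  (X : 'I_k -> 'I_d -> 'rV[R]_d -> R) (gam : 'rV[R]_k -> 'rV[R]_d) (r rho L : R).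
Hypothesis ch : chart p S B X gam r rho L.
Notation Ur := [set x : 'rV[R]_d | `|x - p| < r].
Variables (a : R) (G : 'rV[R]_k -> 'rV[R]_d).
Hypotheses (a0 : 0 < a) (ar : 2 * a < rho) (cG : continuous G)
  (GE : forall y, `|y| <= 2 * a -> G y = gam y).

Definition cube (v : 'rV[R]_k) : Prop := forall i, `[0, 1]%classic (v 0 i).

Lemma cube_norm_le (v w : 'rV[R]_k) : cube v -> cube w -> `|a *: (v + w)| <= 2 * a.
Proof.
move=> v01 w01; apply: rV_norm_le => [|i]; first by rewrite mulr_ge0// ltW.
rewrite !mxE normrM (gtr0_norm a0) mulrC ler_pM2r//.
have := v01 i; have := w01 i; rewrite /= !in_itv /= => /andP[? ?] /andP[? ?].
by rewrite ger0_norm; lra.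
Qed.

Lemma cube_upd v j (s : R) : cube v -> 0 <= s <= 1 -> cube (rV_upd v j s).
Proof. by move=> v01 s01 i; rewrite mxE; case: eqP => // _; rewrite /= in_itv. Qed.

Lemma rV_updE (w v : 'rV[R]_k) j s :
  a *: (w + rV_upd v j s) = a *: (w + rV_upd v j 0) + (a * s) *: ebase R j.
Proof.
apply/rowP => i; rewrite !mxE eqxx /=.
by case: (i == j); rewrite /= ?mulr1 ?mulr0; ring.
Qed.

Lemma cube_path_dom (w v : 'rV[R]_k) j : cube w -> cube v -> path_dom a j (a *: (w + rV_upd v j 0)).
Proof.
by move=> w01 v01 s s01; rewrite -rV_updE; apply: cube_norm_le => //; exact: cube_upd.
Qed.

Lemma is_derive_dotR (lam x : 'rV[R]_d) b :
  is_derive x (ebase R b) (dotR lam) (lam 0 b).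
Proof.
apply: is_derive_epsdelta => e e0; exists 1 => // h _.
rewrite -dotRBr addrK.
have -> : dotR lam (h *: ebase R b) = h * lam 0 b.
  rewrite /dotR (bigD1 b)//= big1 => [|i /negbTE ib].
    by rewrite !mxE !eqxx mulr1 addr0 mulrC.
  by rewrite !mxE ib andbF mulr0 mulr0.
by rewrite subrr normr0 mulr_ge0// ltW.
Qed.

Definition field j (x : 'rV[R]_d) : 'rV[R]_d := \row_b X j b x.

Lemma path_dotR_derive j y lam (s : R) : path_dom a j y -> 0 <= s <= 1 ->
  is_derive s 1 (fun s => dotR lam (gam (y + (a * s) *: ebase R j)))
    (a * dotR lam (field j (gam (y + (a * s) *: ebase R j)))).
Proof.
move=> yD s01.
have h := @path_derive R d k p S B X gam r rho L ch a ar j y (dotR lam) (fun b _ => lam 0 b) s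
  (fun x b _ => is_derive_dotR lam x b) (fun x b _ => @cst_continuous _ _ _ x) yD s01.
by apply: (is_derive_eq h); congr (_ * _); apply: eq_bigr => b _; rewrite mxE.
Qed.

Definition unitvec (lam : 'rV[R]_d) := `|lam|^-1 *: lam.

Lemma unitvecE lam : lam != 0 -> `|lam| *: unitvec lam = lam.
Proof. by move=> l0; rewrite scalerA mulfV ?scale1r// normr_eq0. Qed.

Lemma unitvec_norm lam : `|unitvec lam| <= 1.
Proof.
have [->|l0] := eqVneq lam 0; first by rewrite /unitvec scaler0 normr0 ler01.
by rewrite normrZ normfV normr_id mulVf// normr_eq0.
Qed.

Lemma measurable_phase n (lam : 'rV[R]_n) : measurable_fun setT (phase lam : Rd R n -> R).
Proof.
apply: measurable_rV_continuousR => x.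
apply: (@continuousM _ _ (fun=> 2 * pi) (dotR lam)); first exact: cst_continuous.
have := @Cn_sum R n setT 'I_n (index_enum 'I_n) xpredT 0 (fun i x => lam 0 i * x 0 i).
move=> H; apply: (Cn_continuous (H _)) => // i.
by apply: CnM; [exact: Cn_cst|exact: Cn_coord].
Qed.

End chart_averages.

Section chart_decay.
Variable R : realType.
Variables (d k : nat) (p : 'rV[R]_d) (S : set 'rV[R]_d) (B : 'M[R]_(k, d))
  (X : 'I_k -> 'I_d -> 'rV[R]_d -> R) (gam : 'rV[R]_k -> 'rV[R]_d) (r rho L : R).
Hypothesis ch : chart p S B X gam r rho L.
Variables (a : R) (G : 'rV[R]_k -> 'rV[R]_d).
Hypotheses (a0 : 0 < a) (ar : 2 * a < rho) (cG : continuous G)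
  (GE : forall y, `|y| <= 2 * a -> G y = gam y).

Lemma measurable_chart_phase (lam : 'rV[R]_d) (w : 'rV[R]_k) :
  measurable_fun setT ((fun v => phase lam (G (a *: (w + v)))) : Rd R k -> R).
Proof.
apply: (measurableT_comp (measurable_phase lam)).
apply: measurable_rV_continuous => v.
apply: (continuous_comp (f := fun v => a *: (w + v))); last exact: cG.
apply: continuousZ; first exact: cst_continuous.
by apply: continuousD; [exact: cst_continuous|exact: cvg_id].
Qed.

(** The frequency is [t = |lam|]: the phase divided by it is tested on the direction [unitvec lam],
    and its derivative in [s] is at least [2 pi a kap]. *)
Lemma decay_tangential N j (kap : R) : 0 < kap ->
  exists2 C, 0 < C & forall (lam : 'rV[R]_d) (w : 'rV[R]_k), lam != 0 -> cube w ->
    (forall y, `|y| <= 2 * a -> kap * `|lam| <= `|dotR lam (field X j (gam y))|) ->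
    `|Rintegral (powprob (betaN R N) k) setT (fun v => cos (phase lam (G (a *: (w + (v : 'rV[R]_k))))))|
      <= C / `|lam| ^+ N /\
    `|Rintegral (powprob (betaN R N) k) setT (fun v => sin (phase lam (G (a *: (w + (v : 'rV[R]_k))))))|
      <= C / `|lam| ^+ N.
Proof.
move=> kap0.
(* The lower bound on the derivative is part of the parameter type, so one use of [average_decay]
   gives a constant valid for all [lam] and [w]. *)
pose T := {ly : 'rV[R]_d * {y | path_dom a j y} | `|ly.1| <= 1 /\ forall s : R, 0 <= s <= 1 ->
  kap <= `|dotR ly.1 (field X j (gam (sval ly.2 + (a * s) *: ebase R j)))|}.
pose pt (l : T) s := gam (sval (sval l).2 + (a * s) *: ebase R j).
pose q (l : T) s := 2 * pi * (a * dotR (sval l).1 (field X j (pt l s))).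
pose Q (l : T) s := 2 * pi * dotR (sval l).1 (pt l s).
have pi20 : 0 < 2 * pi :> R by rewrite mulr_gt0// pi_gt0.
have Sq : Sreg N q.
  apply: SregM; first exact: Sreg_cst.
  apply: SregM; first exact: Sreg_cst.
  rewrite /dotR; apply: Sreg_sum => b; apply: SregM.
    apply: (@Sreg_param _ _ _ _ 1) => -[[l y] [/= l1 _]].
    exact: le_trans (rV_norm_ge l b) l1.
  rewrite (_ : (fun l s => _) = (fun l s => X j b (pt l s))); last first.
    by apply/funext => l; apply/funext => s; rewrite mxE.
  apply: (@Sreg_reparam _ _ _ N (fun l : T => (sval l).2) _
    (Sreg_path ch ar j (chart_field ch N j b))).
have qc (l : T) (s : R) : 0 <= s <= 1 -> 2 * pi * (a * kap) <= `|q l s|.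
  move=> s01; rewrite /q !normrM (gtr0_norm a0) [`|2|]ger0_norm// (gtr0_norm (pi_gt0 R)).
  by rewrite ler_pM2l// ler_pM2l//; have [_ H] := svalP l; exact: H.
have dQ (l : T) (s : R) : 0 <= s <= 1 -> is_derive s 1 (Q l) (q l s).
  move=> s01; have h := path_dotR_derive ch ar (sval l).1 (svalP (sval l).2) s01.
  exact: is_deriveZ h.
have c00 : 0 < 2 * pi * (a * kap) by rewrite mulr_gt0// mulr_gt0.
have [C C0 HC] := average_decay k c00 Sq qc dQ.
exists C => // lam w l0 w01 Hl.
have t0 : 0 < `|lam| by rewrite normr_gt0.
apply: (HC _ (fun v : Rd R k => phase lam (G (a *: (w + (v : 'rV[R]_k))))) j t0).
  exact: measurable_chart_phase.
move=> v v01.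
have yD := cube_path_dom a0 j w01 v01.
have dl x : dotR lam x = `|lam| * dotR (unitvec lam) x by rewrite -dotRZl unitvecE.
have Hp : `|unitvec lam| <= 1 /\ forall s : R, 0 <= s <= 1 -> kap <=
    `|dotR (unitvec lam) (field X j (gam (a *: (w + rV_upd v j 0) + (a * s) *: ebase R j)))|.
  split=> [|s s01]; first exact: unitvec_norm.
  have := Hl _ (yD s s01); rewrite dl normrM normr_id mulrC.
  by rewrite ler_pM2l.
exists (exist _ (unitvec lam, exist _ _ yD) Hp) => s s01.
rewrite /Q /pt /= rV_updE GE; last exact: yD.
by rewrite /phase dl; ring.
Qed.

(** The frequency is [t = |lam| a |w - u|], where [a |w - u|] is the distance of the two base
    points. After division by [t], the derivative of the phase difference is a difference quotient
    of the field [X j], regular uniformly in [w] and [u] by [Sreg_diff]. *)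
Lemma decay_normal N j (kap : R) : 0 < kap ->
  exists2 C, 0 < C & forall (lam : 'rV[R]_d) (w u : 'rV[R]_k), lam != 0 -> w != u ->
    cube w -> cube u ->
    (forall v, cube v -> kap * `|lam| * (a * `|w - u|) <=
       `|dotR lam (field X j (gam (a *: (w + v))) - field X j (gam (a *: (u + v))))|) ->
    `|Rintegral (powprob (betaN R N) k) setT (fun v => cos (phase lam (G (a *: (w + (v : 'rV[R]_k))))
        - phase lam (G (a *: (u + (v : 'rV[R]_k))))))|
      <= C / (`|lam| * (a * `|w - u|)) ^+ N.
Proof.
move=> kap0.
pose T := {ly : 'rV[R]_d * {yu | diff_dom a j yu} | `|ly.1| <= 1 /\ forall s : R, 0 <= s <= 1 ->
  kap <= `| `|(sval ly.2).1 - (sval ly.2).2|^-1 *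
    dotR ly.1 (field X j (gam ((sval ly.2).1 + (a * s) *: ebase R j)) -
               field X j (gam ((sval ly.2).2 + (a * s) *: ebase R j)))|}.
pose p1 (l : T) s := gam ((sval (sval l).2).1 + (a * s) *: ebase R j).
pose p2 (l : T) s := gam ((sval (sval l).2).2 + (a * s) *: ebase R j).
pose D (l : T) := `|(sval (sval l).2).1 - (sval (sval l).2).2|^-1.
pose q (l : T) s := 2 * pi * (D l * (a * dotR (sval l).1 (field X j (p1 l s)) -
  a * dotR (sval l).1 (field X j (p2 l s)))).
pose Q (l : T) s := 2 * pi * (D l * (dotR (sval l).1 (p1 l s) - dotR (sval l).1 (p2 l s))).
have pi20 : 0 < 2 * pi :> R by rewrite mulr_gt0// pi_gt0.
have qE l s : q l s = 2 * pi * (a * \sum_b (sval l).1 0 b *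
    (D l * (X j b (p1 l s) - X j b (p2 l s)))).
  rewrite /q -mulrBr -dotRBr [D l * _]mulrCA; congr (_ * (_ * _)).
  rewrite /dotR mulr_sumr; apply: eq_bigr => b _; rewrite !mxE; ring.
have Sq : Sreg N q.
  rewrite (_ : q = fun l s => 2 * pi * (a * \sum_b (sval l).1 0 b *
    (D l * (X j b (p1 l s) - X j b (p2 l s))))); last by apply/funext => l; apply/funext => s; exact: qE.
  apply: SregM; first exact: Sreg_cst.
  apply: SregM; first exact: Sreg_cst.
  apply: Sreg_sum => b; apply: SregM.
    apply: (@Sreg_param _ _ _ _ 1) => -[[l y] [/= l1 _]].
    exact: le_trans (rV_norm_ge l b) l1.
  exact: (@Sreg_reparam _ _ _ N (fun l : T => (sval l).2) _
    (Sreg_diff ch ar j (chart_field ch N.+1 j b))).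
have qc (l : T) (s : R) : 0 <= s <= 1 -> 2 * pi * (a * kap) <= `|q l s|.
  move=> s01; rewrite /q -mulrBr -dotRBr [D l * _]mulrCA !normrM -[`|D l| * _]normrM.
  rewrite (gtr0_norm a0) [`|2|]ger0_norm// (gtr0_norm (pi_gt0 R)).
  by rewrite ler_pM2l// ler_pM2l//; have [_ H] := svalP l; exact: H.
have dQ (l : T) (s : R) : 0 <= s <= 1 -> is_derive s 1 (Q l) (q l s).
  move=> s01; have [yD uD _] := svalP (sval l).2.
  have h1 := path_dotR_derive ch ar (sval l).1 yD s01.
  have h2 := path_dotR_derive ch ar (sval l).1 uD s01.
  exact: (is_deriveZ (2 * pi) (is_deriveZ (D l) (is_deriveB h1 h2))).
have c00 : 0 < 2 * pi * (a * kap) by rewrite mulr_gt0// mulr_gt0.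
have [C C0 HC] := average_decay k c00 Sq qc dQ.
exists C => // lam w u l0 wu w01 u01 Hl.
have wu0 : 0 < a * `|w - u| by rewrite mulr_gt0// normr_gt0 subr_eq0.
have t0 : 0 < `|lam| * (a * `|w - u|) by rewrite mulr_gt0// normr_gt0.
apply: (HC _ (fun v : Rd R k => phase lam (G (a *: (w + (v : 'rV[R]_k)))) -
   phase lam (G (a *: (u + (v : 'rV[R]_k))))) j t0 _ _).1.
  by apply: measurable_funB; exact: measurable_chart_phase.
move=> v v01.
have yD := cube_path_dom a0 j w01 v01.
have uD := cube_path_dom a0 j u01 v01.
have dE : a *: (w + rV_upd v j 0) - a *: (u + rV_upd v j 0) = a *: (w - u).
  by rewrite -scalerBr opprD addrACA subrr addr0.
have nE : `|a *: (w + rV_upd v j 0) - a *: (u + rV_upd v j 0)| = a * `|w - u|.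
  by rewrite dE normrZ gtr0_norm.
have yu : diff_dom a j (a *: (w + rV_upd v j 0), a *: (u + rV_upd v j 0)).
  split => //=; rewrite -subr_eq0 dE scaler_eq0 negb_or gt_eqF//=.
  by rewrite subr_eq0.
have dl x : dotR lam x = `|lam| * dotR (unitvec lam) x by rewrite -dotRZl unitvecE.
have Hp : `|unitvec lam| <= 1 /\ forall s : R, 0 <= s <= 1 -> kap <=
   `| `|a *: (w + rV_upd v j 0) - a *: (u + rV_upd v j 0)|^-1 *
    dotR (unitvec lam) (field X j (gam (a *: (w + rV_upd v j 0) + (a * s) *: ebase R j)) -
               field X j (gam (a *: (u + rV_upd v j 0) + (a * s) *: ebase R j)))|.
  split=> [|s s01]; first exact: unitvec_norm.
  have := Hl _ (cube_upd j v01 s01); rewrite (rV_updE a w v j s) (rV_updE a u v j s) dl normrM normr_id.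
  rewrite nE normrM normfV (gtr0_norm wu0) ler_pdivlMl//.
  by rewrite [kap * _]mulrC -mulrA ler_pM2l ?normr_gt0// [kap * _]mulrC.
exists (exist _ (unitvec lam, exist _ _ yu) Hp) => s s01.
rewrite /Q /p1 /p2 /D /= nE (rV_updE a w v j s) (rV_updE a u v j s) !GE; [|exact: uD|exact: yD].
by rewrite /phase 2!dl; field; rewrite normr_eq0 subr_eq0 wu gt_eqF.
Qed.

End chart_decay.

(** * The square of an averaged exponential *)

Section TTstar.
Variable R : realType.

Lemma Rintegral_sqr_le d (T : measurableType d) (P : probability T R) (c : T -> R) :
  bmeas c -> (Rintegral P setT c) ^+ 2 <= Rintegral P setT (fun x => c x ^+ 2).
Proof.
move=> bc; set m := Rintegral P setT c.
have bc2 : bmeas (fun x => c x ^+ 2) by exact: bmeasM.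
have b1 : bmeas (fun x => (- (2 * m)) * c x) by exact: bmeasZ.
have b2 : bmeas (fun x => c x ^+ 2 + (- (2 * m)) * c x) by exact: bmeasD.
have : 0 <= Rintegral P setT (fun x => (c x ^+ 2 + (- (2 * m)) * c x) + m ^+ 2).
  by apply: Rintegral_ge0 => x _; rewrite (_ : _ + _ = (c x - m) ^+ 2) ?sqr_ge0//; ring.
rewrite RintegralD//; [|exact: bmeas_integrable|by apply: bmeas_integrable; exact: bmeas_cst].
rewrite RintegralD//; [|exact: bmeas_integrable|exact: bmeas_integrable].
rewrite RintegralZl//; last exact: bmeas_integrable.
by rewrite Rintegral_cst1 -/m; lra.
Qed.

Lemma Rintegral_mul d1 d2 (T1 : measurableType d1) (T2 : measurableType d2)
    (P1 : probability T1 R) (P2 : probability T2 R) (f : T1 -> R) (g : T2 -> R) :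
  bmeas f -> bmeas g ->
  Rintegral (P1 \x P2)%E setT (fun z => f z.1 * g z.2) =
  Rintegral P1 setT f * Rintegral P2 setT g.
Proof.
move=> bf bg.
have bz : bmeas (fun z : T1 * T2 => f z.1 * g z.2).
  apply: bmeasM.
    exact: (bmeas_comp measurable_fst bf).
  exact: (bmeas_comp measurable_snd bg).
rewrite Rintegral_prod1//=.
rewrite -RintegralZr//; last exact: bmeas_integrable.
by apply: eq_Rintegral => x _; rewrite RintegralZl//; exact: bmeas_integrable.
Qed.

(* Cauchy-Schwarz in [v]; the square is expanded in two copies of [w], and
   the average over [v] is then taken first. *)
Lemma TTstar d1 d2 (T1 : measurableType d1) (T2 : measurableType d2)
    (P : probability T1 R) (Q : probability T2 R) (f : T1 * T2 -> R) :
  measurable_fun setT f ->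
  (Rintegral (P \x Q)%E setT (fun z => cos (f z))) ^+ 2 +
  (Rintegral (P \x Q)%E setT (fun z => sin (f z))) ^+ 2 <=
  Rintegral (P \x P)%E setT
    (fun ww => Rintegral Q setT (fun v => cos (f (ww.1, v) - f (ww.2, v)))).
Proof.
move=> mf.
have mf1 v : measurable_fun setT (fun w => f (w, v)).
  by apply: (measurableT_comp mf); exact: pair2_measurable.
have bcos : bmeas (fun z => cos (f z)) by exact: bmeas_cos.
have bsin : bmeas (fun z => sin (f z)) by exact: bmeas_sin.
have msw : measurable_fun setT (fun z : T2 * T1 => (z.2, z.1)).
  by apply: measurable_fun_pair; [exact: measurable_snd|exact: measurable_fst].
pose c v := Rintegral P setT (fun w => cos (f (w, v))).
pose s v := Rintegral P setT (fun w => sin (f (w, v))).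
have bc : bmeas c.
  exact: (@bmeas_Rintegral1 _ _ _ _ _ P (fun z => cos (f (z.2, z.1))) (bmeas_comp msw bcos)).
have bs : bmeas s.
  exact: (@bmeas_Rintegral1 _ _ _ _ _ P (fun z => sin (f (z.2, z.1))) (bmeas_comp msw bsin)).
rewrite (Rintegral_prod2 _ _ bcos) (Rintegral_prod2 _ _ bsin).
have mF : measurable_fun setT (fun z : (T1 * T1) * T2 => f (z.1.1, z.2) - f (z.1.2, z.2)).
  apply: measurable_funB; apply: (measurableT_comp mf); apply: measurable_fun_pair.
  - by apply: measurableT_comp; [exact: measurable_fst|exact: measurable_fst].
  - exact: measurable_snd.
  - by apply: measurableT_comp; [exact: measurable_snd|exact: measurable_fst].
  - exact: measurable_snd.
have E v : c v ^+ 2 + s v ^+ 2 =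
    Rintegral (P \x P)%E setT (fun ww => cos (f (ww.1, v) - f (ww.2, v))).
  rewrite !expr2 -(Rintegral_mul P P (bmeas_cos (mf1 v)) (bmeas_cos (mf1 v))).
  rewrite -(Rintegral_mul P P (bmeas_sin (mf1 v)) (bmeas_sin (mf1 v))).
  rewrite -RintegralD//.
  - by apply: eq_Rintegral => ww _; rewrite cosB.
  - apply: (@bmeas_integrable _ _ _ (P \x P : probability _ R)%E).
    apply: bmeasM.
      by apply: (bmeas_comp measurable_fst (bmeas_cos (mf1 v))).
    by apply: (bmeas_comp measurable_snd (bmeas_cos (mf1 v))).
  - apply: (@bmeas_integrable _ _ _ (P \x P : probability _ R)%E).
    apply: bmeasM.
      by apply: (bmeas_comp measurable_fst (bmeas_sin (mf1 v))).
    by apply: (bmeas_comp measurable_snd (bmeas_sin (mf1 v))).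
apply: (@le_trans _ _ (Rintegral Q setT (fun v => c v ^+ 2 + s v ^+ 2))).
  rewrite RintegralD//; [|by apply: bmeas_integrable; exact: bmeasM|by apply: bmeas_integrable; exact: bmeasM].
  by apply: lerD; exact: Rintegral_sqr_le.
under eq_Rintegral do rewrite E.
have b3 := bmeas_cos mF.
have H1 := Rintegral_prod1 (P \x P : probability _ R)%E Q b3.
have H2 := Rintegral_prod2 (P \x P : probability _ R)%E Q b3.
rewrite H1 in H2; rewrite le_eqVlt; apply/orP; left; apply/eqP; exact: esym H2.
Qed.

End TTstar.

(** * Quantitative non-degeneracy *)

Section dichotomy.
Variable R : realType.

Lemma continuous_sum (T : topologicalType) (I : Type) (s : seq I) (f : I -> T -> R) x :
  (forall i, {for x, continuous (f i)}) -> {for x, continuous (fun y => \sum_(i <- s) f i y)}.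
Proof.
move=> cf; elim: s => [|i s IH].
  have -> : (fun y => \sum_(i <- [::]) f i y) = (fun=> 0).
    by apply/funext => y; rewrite big_nil.
  exact: cst_continuous.
have -> : (fun y => \sum_(j <- i :: s) f j y) = (fun y => f i y + \sum_(j <- s) f j y).
  by apply/funext => y; rewrite big_cons.
by apply: continuousD; [exact: cf|exact: IH].
Qed.

Lemma compact_sphere n : compact [set x : 'rV[R]_n | `|x| = 1].
Proof.
apply: (subclosed_compact _ (@compact_norm_ball R n 1)); last by move=> x /= ->.
rewrite (_ : [set _ | _] = (fun y : 'rV[R]_n => `|y|) @^-1` [set 1]) //.
by apply: closed_comp => [x _|]; [exact: norm_continuous|exact: closed_eq].
Qed.

Lemma dotRZr n c (x y : 'rV[R]_n) : dotR x (c *: y) = c * dotR x y.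
Proof. by rewrite /dotR mulr_sumr; apply: eq_bigr => i _; rewrite !mxE mulrCA. Qed.

(* Compactness of the product of the unit spheres. *)
Lemma dichotomy d k (b : 'I_k -> 'rV[R]_d) (z : 'I_k -> 'I_k -> 'rV[R]_d) :
  (forall (lam : 'rV[R]_d) (u : 'rV[R]_k), lam != 0 -> u != 0 ->
    (forall j, dotR lam (b j) = 0) ->
    (forall j, \sum_i u 0 i * dotR lam (z i j) = 0) -> False) ->
  exists2 kap, 0 < kap & forall (lam : 'rV[R]_d), lam != 0 ->
    (exists j, kap * `|lam| <= `|dotR lam (b j)|) \/
    (forall u : 'rV[R]_k, u != 0 ->
      exists j, kap * `|lam| * `|u| <= `|\sum_i u 0 i * dotR lam (z i j)|).
Proof.
move=> H.
pose f (lu : 'rV[R]_d * 'rV[R]_k) := \sum_j (dotR lu.1 (b j)) ^+ 2 +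
  \sum_j (\sum_i lu.2 0 i * dotR lu.1 (z i j)) ^+ 2.
pose K := [set x : 'rV[R]_d | `|x| = 1] `*` [set x : 'rV[R]_k | `|x| = 1].
have cf : continuous f.
  have cdot (y : 'rV[R]_d) : continuous (fun lu : 'rV[R]_d * 'rV[R]_k => dotR lu.1 y).
    move=> lu; apply: continuous_sum => i; apply: continuousM; last exact: cst_continuous.
    apply: (@continuous_comp _ _ _ (fst : 'rV[R]_d * 'rV[R]_k -> _) (fun x : 'rV[R]_d => x 0 i)).
      exact: cvg_fst.
    exact: coord_continuous.
  have csq (g : 'rV[R]_d * 'rV[R]_k -> R) : continuous g -> continuous (fun lu => g lu ^+ 2).
    by move=> cg lu; apply: continuousM; exact: cg.
  move=> lu; apply: continuousD; apply: continuous_sum => j; apply: csq; first exact: cdot.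
  move=> {}lu; apply: continuous_sum => i; apply: continuousM; last exact: cdot.
  apply: (@continuous_comp _ _ _ (snd : 'rV[R]_d * 'rV[R]_k -> _) (fun x : 'rV[R]_k => x 0 i)).
    exact: cvg_snd.
  exact: coord_continuous.
have [e e0 He] : exists2 e, 0 < e & forall lu, K lu -> e <= f lu.
  have [K0|K0] := pselect (K !=set0); last first.
    by exists 1 => // lu Klu; exfalso; apply: K0; exists lu.
  have cK := compact_setX (@compact_sphere d) (@compact_sphere k).
  have [[l u] Kc Hc] := compact_EVT_min K0 cK (continuous_subspaceT cf).
  exists (f (l, u)); last by move=> lu Klu; apply: Hc; rewrite inE.
  move: Kc; rewrite inE /K /= => -[/= l1 u1].
  have l0 : l != 0 by rewrite -normr_eq0 l1 oner_eq0.
  have u0 : u != 0 by rewrite -normr_eq0 u1 oner_eq0.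
  have f1 : 0 <= \sum_j (dotR l (b j)) ^+ 2 by apply: sumr_ge0 => j _; exact: sqr_ge0.
  have f2 : 0 <= \sum_j (\sum_i u 0 i * dotR l (z i j)) ^+ 2 by apply: sumr_ge0 => j _; exact: sqr_ge0.
  rewrite lt_neqAle addr_ge0// andbT; apply/eqP => /esym/eqP.
  rewrite /f /= paddr_eq0// => /andP[/eqP h1 /eqP h2].
  apply: (H l u l0 u0) => j; apply/eqP; rewrite -sqrf_eq0; apply/eqP.
    by apply: (psumr_eq0P _ h1) => // i _; exact: sqr_ge0.
  by apply: (psumr_eq0P _ h2) => // i _; exact: sqr_ge0.
(* If both alternatives failed, each of the two sums in [f] at the normalised vectors would be below
   [e / 2], since [k kap ^ 2 < e / 2]. *)
pose kap := Num.min 1 (e / (2 * k.+1%:R)).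
have kap0 : 0 < kap by rewrite lt_min ltr01 divr_gt0// mulr_gt0// ltr0n.
have kap2 : k%:R * kap ^+ 2 < e / 2.
  have k1 : kap <= 1 by rewrite ge_min lexx.
  have k2 : kap <= e / (2 * k.+1%:R) by rewrite ge_min lexx orbT.
  have k3 : kap ^+ 2 <= e / (2 * k.+1%:R).
    by rewrite (le_trans _ k2)// expr2 ler_piMr// ltW.
  apply: (@le_lt_trans _ _ (k%:R * (e / (2 * k.+1%:R)))); first by rewrite ler_wpM2l.
  rewrite (_ : _ * _ = e / 2 * (k%:R / k.+1%:R)); last by field; rewrite nat1r pnatr_eq0.
  by rewrite gtr_pMr ?divr_gt0// ltr_pdivrMr ?ltr0n// mul1r ltr_nat.
have small (g : 'I_k -> R) : (forall j, `|g j| < kap) -> \sum_j (g j) ^+ 2 < e / 2.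
  move=> gk; apply: le_lt_trans kap2.
  rewrite (le_trans (_ : _ <= \sum_(j < k) kap ^+ 2))//.
    by apply: ler_sum => j _; rewrite -real_normK ?num_real// lerXn2r ?nnegrE// ltW.
  by rewrite sumr_const card_ord mulr_natl.
exists kap => // lam l0.
have l1 : 0 < `|lam| by rewrite normr_gt0.
have [?|nA] := pselect (exists j, kap * `|lam| <= `|dotR lam (b j)|); [by left|right].
move=> u u0; have u1 : 0 < `|u| by rewrite normr_gt0.
apply: contrapT => nB.
have unit1 n (x : 'rV[R]_n) : 0 < `|x| -> `| `|x|^-1 *: x| = 1.
  by move=> x0; rewrite normrZ normfV normr_id mulVf// gt_eqF.
have := He (`|lam|^-1 *: lam, `|u|^-1 *: u) (conj (unit1 _ _ l1) (unit1 _ _ u1)).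
rewrite leNgt => /negP; apply; rewrite /f /= [e]splitr; apply: ltrD; apply: small => j.
  rewrite dotRZl normrM normfV normr_id ltr_pdivrMl// mulrC ltNge.
  by apply/negP => Hj; apply: nA; exists j.
rewrite (eq_bigr (fun i => (`|u|^-1 * `|lam|^-1) * (u 0 i * dotR lam (z i j)))); last first.
  by move=> i _; rewrite mxE dotRZl; ring.
rewrite -mulr_sumr normrM gtr0_norm ?mulr_gt0 ?invr_gt0//.
rewrite -invfM ltr_pdivrMl ?mulr_gt0// (_ : _ * _ * kap = kap * `|lam| * `|u|) 1?ltNge; last by ring.
by apply/negP => Hj; apply: nB; exists j.
Qed.

End dichotomy.

Section final_decay.
Variable R : realType.

Lemma measurable_addR k : measurable_fun setT
  (fun z : Rd R k * Rd R k => ((z.1 : 'rV[R]_k) + z.2 : Rd R k)).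
Proof.
apply: measurable_rV => i; under eq_fun do rewrite mxE.
apply: measurable_funD.
  by apply: (measurableT_comp (measurable_rV_coord i)); exact: measurable_fst.
by apply: (measurableT_comp (measurable_rV_coord i)); exact: measurable_snd.
Qed.

Lemma measurable_add_comp k d (G : 'rV[R]_k -> 'rV[R]_d) (a : R) : continuous G ->
  measurable_fun setT (fun z : Rd R k * Rd R k => (G (a *: ((z.1 : 'rV[R]_k) + z.2)) : Rd R d)).
Proof.
move=> cG; apply: (@measurableT_comp _ _ _ _ (Rd R k) (Rd R d) (G \o (fun v => a *: v)) _ _).
  apply: measurable_rV_continuous => v.
  apply: (continuous_comp (f := fun v => a *: v)); last exact: cG.
  by apply: continuousZ; [exact: cst_continuous|exact: cvg_id].
exact: measurable_addR.
Qed.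

Lemma dotR_close d (lam x y : 'rV[R]_d) e : (forall b, `|x 0 b - y 0 b| <= e) ->
  `|dotR lam x - dotR lam y| <= d%:R * `|lam| * e.
Proof.
move=> xy; rewrite -dotRBr /dotR (le_trans (ler_norm_sum _ _ _))//.
rewrite (le_trans (_ : _ <= \sum_(i < d) `|lam| * e))//.
  apply: ler_sum => i _; rewrite normrM !mxE ler_pM// rV_norm_ge//.
by rewrite sumr_const card_ord -mulrA mulr_natl.
Qed.

Lemma normr_half_ge (kap l x y : R) :
  kap * l <= `|y| -> `|x - y| <= kap / 2 * l -> kap / 2 * l <= `|x|.
Proof.
move=> h1 h2; have h3 := ler_normB x (x - y); rewrite subKr in h3; lra.
Qed.

Lemma sum4_bounds (x y z : R) : 0 <= x -> 0 <= y -> 0 <= z ->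
  let C := 1 + x + y + z in [/\ 0 < C, x <= C, y <= C & z <= C].
Proof. by move=> x0 y0 z0 /=; split; lra. Qed.

(* If [lam] is far from normal, average over [v] in a direction [j] where the
   phase is monotone.  If it is nearly normal, the phase difference between [w]
   and [w'] is non-stationary in [v] once [w - w'] is larger than [dl]. *)
Lemma chart_decay d k p S B X gam r rho L N : @chart R d k p S B X gam r rho L ->
  (forall (lam : 'rV[R]_d) (u : 'rV[R]_k), lam != 0 -> u != 0 ->
    (forall j, dotR lam (field X j p) = 0) ->
    (forall j, \sum_i u 0 i * dotR lam
       (\row_c \sum_b 'D_(ebase R b) (X j c : _ -> R^o) p * X i b p) = 0) -> False) ->
  exists a, [/\ 0 < a, 2 * a < rho &
   forall G : 'rV[R]_k -> 'rV[R]_d, continuous G ->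
    (forall y, `|y| <= 2 * a -> G y = gam y) ->
    exists2 C, 0 < C & forall lam dl, 1 <= `|lam| -> 0 < dl <= 1 ->
    (Rintegral (powprob unif01 k \x powprob (betaN R N) k)%E setT
      (fun z : Rd R k * Rd R k => cos (phase lam (G (a *: ((z.1 : 'rV[R]_k) + (z.2 : 'rV[R]_k))))))) ^+ 2 +
    (Rintegral (powprob unif01 k \x powprob (betaN R N) k)%E setT
      (fun z : Rd R k * Rd R k => sin (phase lam (G (a *: ((z.1 : 'rV[R]_k) + (z.2 : 'rV[R]_k))))))) ^+ 2
    <= C * (dl ^+ k + (`|lam| * dl) ^- N)].
Proof.
move=> ch Hnd.
have [kap kap0 Hkap] := dichotomy (b := fun j => field X j p)
  (z := fun i j => \row_c \sum_b 'D_(ebase R b) (X j c : _ -> R^o) p * X i b p) Hnd.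
have rho0 := chart_rho ch; have L0 := chart_L ch; have r0 := chart_r ch.
have pr : `|p - p| < r by rewrite subrr normr0.
have /choice[g0 Hg0] : forall jc : 'I_k * 'I_d, exists g : 'I_d -> 'rV[R]_d -> R,
    (forall x b, `|x - p| < r -> is_derive x (ebase R b) (X jc.1 jc.2) (g b x)) /\
    (forall x b, `|x - p| < r -> {for x, continuous (g b)}).
  move=> [j c]; have [_ [g [dg Cg]]] := chart_field ch 1 j c.
  by exists g; split=> // x b; exact: (Cg b).1.
(* The derivative of the field [X j] along [X i]; on the manifold these are the second partial
   derivatives of [gam]. *)
pose Z (i j : 'I_k) c x := \sum_b g0 (j, c) b x * X i b x.
have Zp i j c : Z i j c p = \sum_b 'D_(ebase R b) (X j c : _ -> R^o) p * X i b p.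
  apply: eq_bigr => b _; congr (_ * _).
  by have [_ <-] := (Hg0 (j, c)).1 p b pr.
have cX j b x : `|x - p| < r -> {for x, continuous (X j b)}.
  exact: Cn_continuous (chart_field ch 0 j b) x.
have cZ i j c x : `|x - p| < r -> {for x, continuous (Z i j c)}.
  move=> xr; apply: continuous_sum => b.
  by apply: continuousM; [exact: (Hg0 (j, c)).2|exact: cX].
(* Pairing with [lam] costs [d] and summing increments costs [k]. Oscillations of [X] and [Z] below
   [eta] therefore preserve the lower bounds at [p] with constant [kap / 2]. *)
pose eta := kap / 2 / ((d * k.+1)%N.+1)%:R.
have eta0 : 0 < eta by rewrite !divr_gt0.
have deta : d%:R * k.+1%:R * eta <= kap / 2.
  rewrite /eta mulrCA ler_piMr ?divr_ge0 ?ltW// -natrM.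
  by rewrite ltr_pdivrMr ?ltr0n// mul1r ltr_nat.
have [r1 r10 Hr1] := @continuous_finite_ball R d ('I_k * 'I_d)%type (fun jb => X jb.1 jb.2)
  p eta eta0 (fun jb => cX jb.1 jb.2 p pr).
have [r2 r20 Hr2] := @continuous_finite_ball R d ('I_k * 'I_k * 'I_d)%type
  (fun ijc => Z ijc.1.1 ijc.1.2 ijc.2) p eta eta0 (fun ijc => cZ ijc.1.1 ijc.1.2 ijc.2 p pr).
pose r3 := Num.min r1 r2; have r30 : 0 < r3 by rewrite lt_min r10.
(* The mean value estimates take place on the open ball of radius [4 * a], which contains the closed
   one of radius [2 * a] and which [gam] maps within [r3] of [p]. *)
pose a := Num.min rho (r3 / L) / 4.
have m0 : 0 < Num.min rho (r3 / L) by rewrite lt_min rho0 divr_gt0.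
have a0 : 0 < a by rewrite divr_gt0.
have a4 : 4 * a <= rho by rewrite /a mulrC divfK// ge_min lexx.
have a4L : L * (4 * a) <= r3.
  by rewrite /a [4 * _]mulrC divfK// mulrC -ler_pdivlMr// ge_min lexx orbT.
have ar : 2 * a < rho by move: a0 a4; lra.
have gamr y : `|y| < 4 * a -> `|gam y - p| < r3.
  move=> ya; rewrite -(chart_base ch).
  have h := chart_lip ch (lt_le_trans ya a4) (_ : `|0| < rho).
  rewrite subr0 normr0 in h; apply: le_lt_trans (h rho0) _.
  by apply: lt_le_trans a4L; rewrite ltr_pM2l.
have ya24 (y : 'rV[R]_k) : `|y| <= 2 * a -> `|y| < 4 * a by move: a0; lra.
have Xclose y j b : `|y| < 4 * a -> `|X j b (gam y) - X j b p| <= eta.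
  by move=> /gamr; rewrite lt_min => /andP[h _]; exact: (Hr1 _ h (j, b)).
have Zclose y i j c : `|y| < 4 * a -> `|Z i j c (gam y) - Z i j c p| <= eta.
  by move=> /gamr; rewrite lt_min => /andP[_ h]; exact: (Hr2 _ h (i, j, c)).
have Xdiff y u j c : `|y| <= 2 * a -> `|u| <= 2 * a ->
   `|X j c (gam y) - X j c (gam u) - \sum_i Z i j c p * (y 0 i - u 0 i)| <= eta * (k%:R * `|y - u|).
  move=> ya ua.
  have d1 v i : `|v - 0| < 4 * a -> is_derive v (ebase R i) (X j c \o gam) (Z i j c (gam v)).
    rewrite subr0 => va; apply: (chart_derive ch).
    - exact: lt_le_trans a4.
    - exact: (Hg0 (j, c)).1.
    - exact: (Hg0 (j, c)).2.
  have d2 v i : `|v - 0| < 4 * a -> `|Z i j c (gam v) - Z i j c p| <= eta.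
    by rewrite subr0; exact: Zclose.
  have := C1_mean d1 d2 (x := y) (y := u).
  rewrite !subr0 => /(_ (ya24 _ ya) (ya24 _ ua)) h.
  apply: le_trans h _; rewrite ler_pM2l//.
  rewrite (_ : \sum_i _ = \sum_i `|(y - u) 0 i|); first exact: sum_coord_norm_le.
  by apply: eq_bigr => i _; rewrite !mxE.
have kap20 : 0 < kap / 2 by rewrite divr_gt0.
exists a; split => // G cG GE.
have /choice[CT HCT] : forall j : 'I_k, exists C : R, 0 < C /\
    forall (lam : 'rV[R]_d) (w : 'rV[R]_k), lam != 0 -> cube w ->
    (forall y, `|y| <= 2 * a -> kap / 2 * `|lam| <= `|dotR lam (field X j (gam y))|) ->
    `|Rintegral (powprob (betaN R N) k) setT (fun v => cos (phase lam (G (a *: (w + (v : 'rV[R]_k))))))|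
      <= C / `|lam| ^+ N /\
    `|Rintegral (powprob (betaN R N) k) setT (fun v => sin (phase lam (G (a *: (w + (v : 'rV[R]_k))))))|
      <= C / `|lam| ^+ N.
  by move=> j; have [C C0 H] := decay_tangential ch a0 ar cG GE N j kap20; exists C.
have /choice[CN HCN] : forall j : 'I_k, exists C : R, 0 < C /\
    forall (lam : 'rV[R]_d) (w u : 'rV[R]_k), lam != 0 -> w != u ->
    cube w -> cube u ->
    (forall v, cube v -> kap / 2 * `|lam| * (a * `|w - u|) <=
       `|dotR lam (field X j (gam (a *: (w + v))) - field X j (gam (a *: (u + v))))|) ->
    `|Rintegral (powprob (betaN R N) k) setT (fun v => cos (phase lam (G (a *: (w + (v : 'rV[R]_k))))
        - phase lam (G (a *: (u + (v : 'rV[R]_k))))))|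
      <= C / (`|lam| * (a * `|w - u|)) ^+ N.
  by move=> j; have [C C0 H] := decay_normal ch a0 ar cG GE N j kap20; exists C.
pose C1 := \sum_j CT j; pose C2 := \sum_j CN j.
have C1j j : CT j <= C1.
  by rewrite /C1 (bigD1 j)//= lerDl sumr_ge0// => i _; exact/ltW/(HCT i).1.
have C2j j : CN j <= C2.
  by rewrite /C2 (bigD1 j)//= lerDl sumr_ge0// => i _; exact/ltW/(HCN i).1.
have C10 : 0 <= C1 by apply: sumr_ge0 => i _; exact/ltW/(HCT i).1.
have C20 : 0 <= C2 by apply: sumr_ge0 => i _; exact/ltW/(HCN i).1.
have aN : 0 < a ^+ N by rewrite exprn_gt0.
pose C := 1 + 2 * C1 ^+ 2 + 2 ^+ k + C2 / a ^+ N.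
have C2a : 0 <= C2 / a ^+ N by rewrite divr_ge0// ltW.
have C12 : 0 <= 2 * C1 ^+ 2 by rewrite mulr_ge0// sqr_ge0.
have k20 : 0 <= 2 ^+ k :> R by rewrite exprn_ge0.
have [C0 C1C k2C C2C] := sum4_bounds C12 k20 C2a.
rewrite -/C in C0 C1C k2C C2C.
exists C => //.
move=> lam dl lam1 /andP[dl0 dl1].
have lam0 : 0 < `|lam| by exact: lt_le_trans lam1.
have lamN0 : lam != 0 by rewrite -normr_gt0.
set P := powprob unif01 k; set Q := powprob (betaN R N) k.
pose f (z : Rd R k * Rd R k) := phase lam (G (a *: ((z.1 : 'rV[R]_k) + (z.2 : 'rV[R]_k)))).
have mf : measurable_fun setT f.
  exact: (measurableT_comp (measurable_phase lam) (measurable_add_comp a cG)).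
have mcube : measurable (@cube R k : set (Rd R k)).
  exact: (@measurable_rV_box _ k (fun=> `[0, 1]%classic)).
have Pcube : P (@cube R k) = 1%E.
  by apply: powprob_cube; [exact: measurable_itv|exact: unif01_01].
have Qcube : Q (@cube R k) = 1%E.
  by apply: powprob_cube; [exact: measurable_itv|exact: beta_prob01].
have ldN : 0 < (`|lam| * dl) ^- N by rewrite invr_gt0 exprn_gt0// mulr_gt0.
have dlk : 0 < dl ^+ k by rewrite exprn_gt0.
set y := (`|lam| * dl) ^- N.
have [[j Hj]|Hu] := Hkap lam lamN0.
  have low z : `|z| <= 2 * a -> kap / 2 * `|lam| <= `|dotR lam (field X j (gam z))|.
    move=> za; have h1 : `|dotR lam (field X j (gam z)) - dotR lam (field X j p)| <= kap / 2 * `|lam|.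
      apply: (@le_trans _ _ (d%:R * `|lam| * eta)).
        by apply: dotR_close => b; rewrite !mxE; apply: Xclose; exact: ya24.
      rewrite mulrAC ler_pM2r//; apply: le_trans deta; rewrite ler_pM2r// ler_peMr//.
      by rewrite ler1n.
    exact: normr_half_ge Hj h1.
  have HT w (w01 : cube w) := (HCT j).2 lam w lamN0 w01 low.
  have CT1 : CT j / `|lam| ^+ N <= C1 / `|lam| ^+ N by rewrite ler_pM2r ?invr_gt0 ?exprn_gt0.
  have B1 : `|Rintegral (P \x Q)%E setT (fun z => cos (f z))| <= C1 / `|lam| ^+ N.
    rewrite Rintegral_prod1; last exact: bmeas_cos.
    apply: (Rintegral_norm_le_ae mcube Pcube); first exact: (bmeas_Rintegral1 _ (bmeas_cos mf)).
    by move=> w w01; apply: le_trans (HT w w01).1 CT1.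
  have B2 : `|Rintegral (P \x Q)%E setT (fun z => sin (f z))| <= C1 / `|lam| ^+ N.
    rewrite Rintegral_prod1; last exact: bmeas_sin.
    apply: (Rintegral_norm_le_ae mcube Pcube); first exact: (bmeas_Rintegral1 _ (bmeas_sin mf)).
    by move=> w w01; apply: le_trans (HT w w01).2 CT1.
  (* Squaring yields [|lam| ^- N] twice; [|lam| >= 1] and [dl <= 1] bring this under the second term
     of the claim. *)
  have xy : `|lam| ^- N * `|lam| ^- N <= y.
    have x1 : `|lam| ^- N <= 1 by rewrite invf_le1 ?exprn_gt0// exprn_ege1.
    apply: (@le_trans _ _ (`|lam| ^- N)); first by rewrite ler_piMr// invr_ge0 exprn_ge0.
    rewrite lef_pV2 ?posrE ?exprn_gt0 ?mulr_gt0//.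
    apply: lerXn2r; rewrite ?nnegrE; [|exact: ltW|by rewrite ger_pMr].
    by apply: mulr_ge0; exact: ltW.
  have sq t : `|t| <= C1 / `|lam| ^+ N -> t ^+ 2 <= C1 ^+ 2 * y.
    move=> tC; rewrite -real_normK ?num_real//.
    apply: (@le_trans _ _ ((C1 / `|lam| ^+ N) ^+ 2)).
      by rewrite lerXn2r ?nnegrE// divr_ge0// exprn_ge0.
    by rewrite exprMn ler_wpM2l ?sqr_ge0// expr2.
  have S1 := sq _ B1; have S2 := sq _ B2.
  apply: le_trans (lerD S1 S2) _.
  rewrite (_ : _ + _ = 2 * C1 ^+ 2 * y); last by ring.
  apply: (@le_trans _ _ (C * y)); first by rewrite ler_pM2r.
  by rewrite ler_pM2l// lerDr ltW.
apply: le_trans (TTstar P Q mf) _.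
pose E : set (Rd R k * Rd R k) := [set ww | `|(ww.1 : 'rV[R]_k) - ww.2| <= dl].
have mE : measurable E.
  have mg : measurable_fun setT (fun ww : Rd R k * Rd R k => `|(ww.1 : 'rV[R]_k) - ww.2|).
    apply: (@measurableT_comp _ _ _ _ (Rd R k) _ (fun v : 'rV[R]_k => `|v|) _ (fun ww : Rd R k * Rd R k => (ww.1 : 'rV[R]_k) - ww.2)).
      by apply: measurable_rV_continuousR => x; exact: norm_continuous.
    apply: measurable_rV => i; under eq_fun do rewrite !mxE.
    apply: measurable_funB.
      by apply: (measurableT_comp (measurable_rV_coord i)); exact: measurable_fst.
    by apply: (measurableT_comp (measurable_rV_coord i)); exact: measurable_snd.
  rewrite (_ : E = setT `&` (fun ww : Rd R k * Rd R k => `|(ww.1 : 'rV[R]_k) - ww.2|) @^-1` `]-oo, dl]%classic).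
    by apply: mg => //; exact: measurable_itv.
  by rewrite setTI; apply/seteqP; split => ww; rewrite /E /= in_itv.
pose H (ww : Rd R k * Rd R k) := Rintegral Q setT (fun v => cos (f (ww.1, v) - f (ww.2, v))).
have mF : measurable_fun setT (fun z : (Rd R k * Rd R k) * Rd R k => f (z.1.1, z.2) - f (z.1.2, z.2)).
  apply: measurable_funB; apply: (measurableT_comp mf); apply: measurable_fun_pair.
  - by apply: measurableT_comp; [exact: measurable_fst|exact: measurable_fst].
  - exact: measurable_snd.
  - by apply: measurableT_comp; [exact: measurable_snd|exact: measurable_fst].
  - exact: measurable_snd.
have bH : bmeas H by exact: (bmeas_Rintegral1 Q (bmeas_cos mF)).
have b1E : bmeas (\1_E : _ -> R) by exact: bmeas_indic.
pose D : set (Rd R k * Rd R k) := (@cube R k) `*` (@cube R k).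
have mD : measurable D by exact: measurableX.
have PD : (P \x P)%E D = 1%E.
  transitivity (P (@cube R k) * P (@cube R k))%E; first exact: product_measure1E.
  by rewrite Pcube mule1.
(* On [E] the average of the cosine is at most 1, off [E] the decay applies; subtracting the
   indicator merges both cases into one pointwise bound on the cube. *)
have HD ww : D ww -> H ww - \1_E ww <= C2 / a ^+ N * y.
  case: ww => w u [/= w01 u01].
  have [Ewu|nE] := boolP ((w, u) \in E).
    rewrite indicE Ewu lerBlDr (le_trans (_ : _ <= 1))//; last first.
      by rewrite lerDr mulr_ge0// ltW.
    apply: (Rintegral_le_ae measurableT (probability_setT Q)) => [|v _]; last exact: cos_le1.
    apply: bmeas_cos; apply: measurable_funB.
      by apply: (measurableT_comp mf); exact: pair1_measurable.
    by apply: (measurableT_comp mf); exact: pair1_measurable.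
  rewrite indicE (negbTE nE) subr0.
  have wu : dl < `|(w : 'rV[R]_k) - u|.
    by rewrite ltNge; apply/negP => h; move: nE; rewrite /E notin_setE; apply.
  have wu0 : 0 < `|(w : 'rV[R]_k) - u| by exact: lt_trans wu.
  have wuN : (w : 'rV[R]_k) != u by rewrite -subr_eq0 -normr_gt0.
  have [j Hj] : exists j, kap * `|lam| * `|(w : 'rV[R]_k) - u| <=
      `|\sum_i ((w : 'rV[R]_k) - u) 0 i * dotR lam (\row_c \sum_b 'D_(ebase R b) (X j c : _ -> R^o) p * X i b p)|.
    by apply: Hu; rewrite subr_eq0.
  have HN v : cube v -> kap / 2 * `|lam| * (a * `|(w : 'rV[R]_k) - u|) <=
       `|dotR lam (field X j (gam (a *: ((w : 'rV[R]_k) + v))) - field X j (gam (a *: ((u : 'rV[R]_k) + v))))|.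
    move=> v01.
    set Y := a *: ((w : 'rV[R]_k) + v); set Y' := a *: ((u : 'rV[R]_k) + v).
    have YY : Y - Y' = a *: ((w : 'rV[R]_k) - u).
      by rewrite /Y /Y' -scalerBr opprD addrACA subrr addr0.
    (* [M] is the difference of the two field values linearised at [p]. Its pairing with [lam] is
       [a] times the sum bounded below in [Hj], and [eta] limits the error to half of that bound. *)
    pose M : 'rV[R]_d := \row_c \sum_i Z i j c p * (Y 0 i - Y' 0 i).
    have VM : `|dotR lam (field X j (gam Y) - field X j (gam Y')) - dotR lam M| <=
        d%:R * `|lam| * (eta * (k%:R * `|Y - Y'|)).
      apply: dotR_close => c; rewrite !mxE; apply: Xdiff; exact: cube_norm_le.
    have YYn : `|Y - Y'| = a * `|(w : 'rV[R]_k) - u| by rewrite YY normrZ gtr0_norm.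
    have ME : dotR lam M = a * \sum_i ((w : 'rV[R]_k) - u) 0 i * dotR lam
        (\row_c \sum_b 'D_(ebase R b) (X j c : _ -> R^o) p * X i b p).
      rewrite /M /dotR; under eq_bigr do rewrite mxE mulr_sumr.
      rewrite exchange_big /= mulr_sumr; apply: eq_bigr => i _.
      rewrite mulrA mulr_sumr; apply: eq_bigr => c _.
      have -> : Y 0 i - Y' 0 i = a * ((w : 'rV[R]_k) - u) 0 i.
        by have /rowP/(_ i) := YY; rewrite !mxE.
      rewrite (_ : (\row_c _) 0 c = Z i j c p); last by rewrite mxE Zp.
      by move: (Z i j c p) (((w : 'rV[R]_k) - u) 0 i) => z1 z2; ring.
    rewrite -mulrA; apply: (@normr_half_ge _ _ _ (dotR lam M)).
      rewrite ME normrM (gtr0_norm a0).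
      rewrite (_ : kap * _ = a * (kap * `|lam| * `|(w : 'rV[R]_k) - u|)); last by ring.
      by rewrite ler_pM2l.
    apply: le_trans VM _; rewrite YYn.
    rewrite [leLHS](_ : _ = d%:R * k%:R * eta * (`|lam| * (a * `|(w : 'rV[R]_k) - u|))); last by ring.
    rewrite ler_pM2r; last by rewrite !mulr_gt0.
    apply: le_trans deta; rewrite ler_pM2r// ler_wpM2l// ler_nat.
    by [].
  have h := (HCN j).2 lam w u lamN0 wuN w01 u01 HN.
  apply: le_trans (ler_norm _) _; apply: le_trans h _.
  rewrite -mulrA; apply: ler_pM => //.
  - exact/ltW/(HCN j).1.
  - by rewrite invr_ge0 exprn_ge0// mulr_ge0// mulr_ge0// ltW.
  rewrite /y -invfM -exprMn lef_pV2 ?posrE ?exprn_gt0 ?mulr_gt0//.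
  apply: lerXn2r; rewrite ?nnegrE; [by rewrite !mulr_ge0// ltW|by rewrite !mulr_ge0// ltW|].
  by rewrite mulrCA ler_pM2l// ler_pM2l// ltW.
(* For fixed [w], the set of [u] with [|w - u| <= dl] is a cube of side [2 dl]. *)
have PE : Rintegral (P \x P)%E setT (\1_E : _ -> R) <= 2 ^+ k * dl ^+ k.
  rewrite Rintegral_prod1//.
  apply: (Rintegral_le_ae measurableT (probability_setT P)) => [|w _].
    exact: (bmeas_Rintegral1 _ b1E).
  pose bx : set (Rd R k) := [set u | forall i, `[(w : 'rV[R]_k) 0 i - dl, (w : 'rV[R]_k) 0 i + dl]%classic ((u : 'rV[R]_k) 0 i)].
  have mbx : measurable bx.
    by apply: (@measurable_rV_box _ k (fun i => `[(w : 'rV[R]_k) 0 i - dl, (w : 'rV[R]_k) 0 i + dl]%classic)) => i; exact: measurable_itv.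
  have b1x : bmeas (\1_bx : Rd R k -> R) by exact: bmeas_indic.
  apply: (@le_trans _ _ (Rintegral P setT (\1_bx : Rd R k -> R))).
    apply: le_Rintegral => //.
    - apply: bmeas_integrable.
      by apply: (@bmeas_comp _ _ _ _ _ (pair w)) => //; exact: pair1_measurable.
    - exact: bmeas_integrable.
    move=> u _; rewrite !indicE; case: (boolP ((w, u) \in E)) => [|_]; last by rewrite ler0n.
    rewrite inE /E /= => wu; rewrite mem_set// /bx /= => i.
    rewrite in_itv /=; have := le_trans (rV_norm_ge _ i) wu; rewrite !mxE.
    by rewrite distrC ler_distl.
  rewrite /Rintegral integral_indic// setIT -exprMn -lee_fin fineK; last exact: fin_num_measure.
  apply: (@powprob_box_le _ _ k (2 * dl) (fun i => `[(w : 'rV[R]_k) 0 i - dl, (w : 'rV[R]_k) 0 i + dl]%classic)) => i.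
    exact: measurable_itv.
  apply: le_trans (unif01_itv_le _) _; first by rewrite lerD2l ge0_cp// ltW.
  by rewrite lee_fin [leLHS](_ : _ = 2 * dl)//; ring.
have bHE : bmeas (fun ww => H ww - \1_E ww) by apply: bmeasD => //; exact: bmeasN.
have HE : Rintegral (P \x P)%E setT (fun ww => H ww - \1_E ww) <= C2 / a ^+ N * y.
  exact: (Rintegral_le_ae mD PD bHE HD).
rewrite RintegralB// in HE; last 2 first.
- exact: (@bmeas_integrable _ _ _ (P \x P : probability _ R)%E).
- exact: (@bmeas_integrable _ _ _ (P \x P : probability _ R)%E).
rewrite lerBlDr in HE; apply: le_trans HE _.
rewrite addrC mulrDr; apply: lerD; last by rewrite ler_pM2r.
by apply: le_trans PE _; rewrite ler_pM2r.
Qed.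

End final_decay.

(** * Fourier frames *)

Section density.
Variables (R : realType) (d : measure_display) (T : measurableType d).
Variable mu : {measure set T -> \bar R}.
Hypothesis hfin : (mu setT < +oo)%E.

Lemma bmeas_integrable_fin (f : T -> R) : bmeas f -> mu.-integrable setT (EFin \o f).
Proof.
move=> [mf [C fC]]; apply/integrableP; split; first exact/measurable_EFinP.
apply: (@le_lt_trans _ _ (\int[mu]_x (cst (`|C|%:E) x))%E).
  apply: ge0_le_integral => //.
  - by apply: measurableT_comp => //; exact/measurable_EFinP.
  - by move=> x _; rewrite /= lee_fin (le_trans (fC x))// ler_norm.
by rewrite integral_cst// lte_mul_pinfty// ?lee_fin.
Qed.

Lemma measure_fin_num A : measurable A -> mu A \is a fin_num.
Proof.
move=> mA; rewrite ge0_fin_numE//; apply: le_lt_trans hfin.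
by apply: le_measure; rewrite ?inE.
Qed.

(** An alias of [mu] on which finiteness, known only as the hypothesis [hfin], can be registered as
    a structure for Radon-Nikodym. *)
Definition finite_copy : set T -> \bar R := mu.

HB.instance Definition _ := Measure.on finite_copy.
HB.instance Definition _ := Measure_isFinite.Build _ _ _ finite_copy
  (fun A mA => measure_fin_num mA).

(* Truncating the Radon-Nikodym derivative at [C] only changes it on a null set. *)
Lemma exists_density (m : probability T R) (C : R) : 0 < C ->
  (forall A, measurable A -> (m A <= C%:E * mu A)%E) ->
  exists g : T -> R, [/\ bmeas g, forall x, 0 <= g x &
    forall h, bmeas h -> Rintegral m setT h = Rintegral mu setT (fun x => g x * h x)].
Proof.
move=> C0 mC.
pose mu' : {finite_measure set T -> \bar R} := finite_copy.
have dom : m `<< mu'.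
  apply/null_content_dominatesP => A mA muA.
  apply/eqP; rewrite eq_le measure_ge0 andbT; apply: le_trans (mC A mA) _.
  by rewrite (_ : mu A = 0%E) ?mule0.
pose F := Radon_Nikodym_SigmaFinite.f m mu'.
have F0 x : (0 <= F x)%E by exact: Radon_Nikodym_SigmaFinite.f_ge0.
have Ffin x : F x \is a fin_num by exact: Radon_Nikodym_SigmaFinite.f_fin_num.
have iF : mu'.-integrable setT F by exact: Radon_Nikodym_SigmaFinite.f_integrable.
have mF : measurable_fun setT F by exact: measurable_int iF.
have mf0 : measurable_fun setT (fun x => fine (F x)) by exact: measurableT_comp.
pose A := [set x | (C%:E < F x)%E].
have mA : measurable A.
  by rewrite -[A]setTI; exact: emeasurable_fun_o_infty.
have aeA : {ae mu', forall x, A x -> False}.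
  have mFC : measurable_fun A (fun x => F x - C%:E)%E.
    by apply: measurable_funTS; apply: emeasurable_funB.
  (* On [A] the function [F - C] is positive, yet its integral [m A - C mu A] is at most 0. *)
  have : (\int[mu']_(x in A) `|(F x - C%:E)|)%E = 0%E.
    apply/eqP; rewrite eq_le integral_ge0 ?andbT//.
    rewrite (eq_integral (fun x => F x - C%:E)%E); last first.
      by move=> x; rewrite inE => Ax; rewrite gee0_abs// sube_ge0 ?ltW.
    rewrite integralB//; last 2 first.
    - exact: (integrableS measurableT).
    - exact: finite_measure_integrable_cst.
    rewrite integral_cst// -Radon_Nikodym_SigmaFinite.f_integral// sube_le0.
    exact: mC.
  move/(ae_eq_integral_abs mu' mA mFC).
  apply: filterS => x H Ax; have E : (F x - C%:E = 0)%E := H Ax.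
  have : (0 < F x - C%:E)%E by rewrite sube_gt0.
  by rewrite E ltxx.
pose g x := Num.min (fine (F x)) C.
have g0 x : 0 <= g x by rewrite le_min fine_ge0//= ltW.
have mg : measurable_fun setT g by apply: measurable_minr.
exists g; split => //.
  split=> //; exists C => x; rewrite ger0_norm// ge_min lexx orbT //.
move=> h bh; have [mh _] := bh.
have ih : m.-integrable setT (EFin \o h) by exact: bmeas_integrable.
rewrite /Rintegral -(Radon_Nikodym_change_of_variables dom measurableT ih).
congr fine; apply: (@ae_eq_integral _ _ _ mu') => //.
- apply: emeasurable_funM; first exact/measurable_EFinP.
  by apply: (@measurable_int _ _ _ mu'); exact: Radon_Nikodym_integrable.
- apply/measurable_EFinP; exact: measurable_funM.
have := ae_eq_Radon_Nikodym_SigmaFinite dom measurableT.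
apply: filterS2 aeA => x nA H _; rewrite /= -(H I).
rewrite muleC EFinM; congr (_ * _)%E.
rewrite /g min_l ?fineK//.
by rewrite -lee_fin fineK// leNgt; apply/negP.
Qed.

End density.

(** * Coefficients of modulated functions and sums over frequencies *)

Section fourier_coefficients.
Variables (R : realType) (d : nat).
Notation V := 'rV[R]_d.
Variable mu : {measure set (Rd R d) -> \bar R}.
Hypothesis hfin : (mu setT < +oo)%E.

Lemma phaseB (lam eta x : V) : phase (lam - eta) x = phase lam x - phase eta x.
Proof. by rewrite /phase dotRBl mulrBr. Qed.

(* The pair [(g cos, g sin)] of real functions encodes [g e_xi]. *)
Lemma fcoef2_modulation (g : Rd R d -> R) (xi lam : V) : bmeas g ->
  fcoef2 mu (fun x => g x * cos (phase xi x)) (fun x => g x * sin (phase xi x)) lam =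
  (Rintegral mu setT (fun x => g x * cos (phase (xi - lam) x))) ^+ 2 +
  (Rintegral mu setT (fun x => g x * sin (phase (xi - lam) x))) ^+ 2.
Proof.
move=> bg; rewrite /fcoef2; congr (_ ^+ 2 + _ ^+ 2).
  by apply: eq_Rintegral => x _; rewrite phaseB cosB; ring.
by apply: eq_Rintegral => x _; rewrite phaseB sinB; ring.
Qed.

Lemma bmeas_gcos (g : Rd R d -> R) (lam : V) : bmeas g -> bmeas (fun x => g x * cos (phase lam x)).
Proof. by move=> bg; apply: bmeasM => //; apply: bmeas_cos; exact: measurable_phase. Qed.

Lemma bmeas_gsin (g : Rd R d -> R) (lam : V) : bmeas g -> bmeas (fun x => g x * sin (phase lam x)).
Proof. by move=> bg; apply: bmeasM => //; apply: bmeas_sin; exact: measurable_phase. Qed.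

Lemma L2norm2_modulation (g : Rd R d -> R) (xi : V) : bmeas g ->
  L2norm2 mu (fun x => g x * cos (phase xi x)) (fun x => g x * sin (phase xi x)) =
  (Rintegral mu setT (fun x => g x ^+ 2))%:E.
Proof.
move=> bg; have bg2 : bmeas (fun x => g x ^+ 2) by exact: bmeasM.
rewrite /L2norm2 /Rintegral fineK; last first.
  by apply: integrable_fin_num => //; exact: (bmeas_integrable_fin hfin bg2).
apply: eq_integral => x _; congr EFin.
by rewrite !exprMn -mulrDr cos2Dsin2 mulr1.
Qed.

Lemma L2fun_modulation (g : Rd R d -> R) (xi : V) : bmeas g ->
  L2fun mu (fun x => g x * cos (phase xi x)) (fun x => g x * sin (phase xi x)).
Proof.
move=> bg; split; [exact: (bmeas_gcos xi bg).1|exact: (bmeas_gsin xi bg).1|].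
by have := L2norm2_modulation xi bg; rewrite /L2norm2 => ->; rewrite ltry.
Qed.

Lemma esum_ge_seq (Lam : set V) (f : V -> R) (s : seq V) :
  (forall x, 0 <= f x) -> uniq s -> (forall x, x \in s -> Lam x) ->
  ((\sum_(x <- s) f x)%:E <= \esum_(x in Lam) (f x)%:E)%E.
Proof.
move=> f0 us sL; apply: esum_ge; exists [set` s].
  by split; [exact: finite_seq|move=> x /= /sL].
by rewrite -fsbig_seq// sumEFin.
Qed.

Lemma esum_le_seq (Lam : set V) (f : V -> R) c :
  (forall s : seq V, uniq s -> (forall x, x \in s -> Lam x) -> \sum_(x <- s) f x <= c) ->
  (\esum_(x in Lam) (f x)%:E <= c%:E)%E.
Proof.
move=> H; apply: ge_ereal_sup => _ [X [fX XL] <-].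
rewrite fsbig_finite//= sumEFin lee_fin; apply: H; first exact: finmap.fset_uniq.
by move=> x; rewrite in_fset_set// inE => /XL.
Qed.

End fourier_coefficients.

(** * Counting frequencies *)

Section bessel.
Variables (R : realType) (d : nat).
Notation V := 'rV[R]_d.

Lemma cos_ge_cos1 (t : R) : `|t| <= 1 -> cos 1 <= cos t.
Proof.
move=> t1; have -> : cos t = cos `|t|.
  by have [t0|t0] := leP 0 t; [rewrite ger0_norm|rewrite ltr0_norm// cosN].
rewrite leNgt; apply/negP.
have p1 := pihalf_ge1 R; have p2 : 1 <= pi :> R by lra.
rewrite ltr_cos ?in_itv /= ?ler01 ?normr_ge0 ?p2 ?(le_trans t1)//.
by rewrite ltNge t1.
Qed.

Variable mu : {measure set (Rd R d) -> \bar R}.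
Hypothesis hfin : (mu setT < +oo)%E.

(** Rotating by the phase [th] at [p] aligns the integrand: [C cos th + S sin th] is the integral
    over [E] of [cos (phase - th) >= cos 1], and Cauchy-Schwarz in the plane bounds its square by
    [C^2 + S^2]. *)
Lemma indic_coef_ge (E : set (Rd R d)) (eta p : V) : measurable E ->
  (forall y, E y -> `|phase eta y - phase eta p| <= 1) ->
  (cos 1 * fine (mu E)) ^+ 2 <=
  (Rintegral mu setT (fun x => \1_E x * cos (phase eta x))) ^+ 2 +
  (Rintegral mu setT (fun x => \1_E x * sin (phase eta x))) ^+ 2.
Proof.
move=> mE Ep.
have b1 : bmeas (\1_E : Rd R d -> R) by exact: bmeas_indic.
have bc := bmeas_gcos eta b1; have bs := bmeas_gsin eta b1.
set C := Rintegral _ _ _; set S := Rintegral _ _ _.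
pose th := phase eta p.
have CS : C * cos th + S * sin th = Rintegral mu setT (fun x => \1_E x * cos (phase eta x - th)).
  rewrite -RintegralZr//; last exact: bmeas_integrable_fin.
  rewrite -RintegralZr//; last exact: bmeas_integrable_fin.
  rewrite -RintegralD//; last 2 first.
  - by apply: bmeas_integrable_fin => //; apply: bmeasM => //; exact: bmeas_cst.
  - by apply: bmeas_integrable_fin => //; apply: bmeasM => //; exact: bmeas_cst.
  by apply: eq_Rintegral => x _; rewrite cosB; ring.
have cmu : cos 1 * fine (mu E) = Rintegral mu setT (fun x => cos 1 * \1_E x).
  rewrite RintegralZl//; last exact: bmeas_integrable_fin.
  by rewrite /Rintegral integral_indic// setIT.
have H : cos 1 * fine (mu E) <= C * cos th + S * sin th.
  rewrite CS cmu; apply: le_Rintegral => //.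
  - by apply: bmeas_integrable_fin => //; exact: bmeasZ.
  - apply: bmeas_integrable_fin => //; apply: bmeasM => //; apply: bmeas_cos.
    by apply: measurable_funB => //; exact: measurable_phase.
  move=> x _; rewrite indicE; case: (boolP (x \in E)) => [|_]; last by rewrite mulr0 mul0r.
  by rewrite inE mulr1 mul1r => Ex; apply: cos_ge_cos1; exact: Ep.
have H0 : 0 <= cos 1 * fine (mu E).
  by rewrite mulr_ge0 ?fine_ge0// ltW// cos1_gt0.
apply: (@le_trans _ _ ((C * cos th + S * sin th) ^+ 2)).
  by apply: lerXn2r; rewrite ?nnegrE//; exact: le_trans H.
have e1 := cos2Dsin2 th.
rewrite (_ : _ ^+ 2 = (C ^+ 2 + S ^+ 2) * (cos th ^+ 2 + sin th ^+ 2) - (C * sin th - S * cos th) ^+ 2); last by ring.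
by rewrite e1 mulr1 gerBl sqr_ge0.
Qed.

Variables (Lam : set V) (B : R).
Hypothesis B0 : 0 < B.
Hypothesis hB : forall u v : Rd R d -> R, L2fun mu u v ->
  (\esum_(lam in Lam) (fcoef2 mu u v lam)%:E <= B%:E * L2norm2 mu u v)%E.

Lemma fcoef2_ge0 u v lam : 0 <= fcoef2 mu u v lam.
Proof. by rewrite addr_ge0// sqr_ge0. Qed.

(* Test the Bessel inequality on a modulated indicator of a ball of radius
   comparable to [1 / r]. *)
Lemma bessel_count k (p : V) (c s0 : R) : 0 < c -> 0 < s0 ->
  (forall s, 0 < s <= s0 -> ((c * s ^+ k)%:E <= mu [set x : V | (`|x - p| < s)%R])%E) ->
  exists2 K, 0 < K & forall (x : V) (r : R) (s : seq V), 1 <= r -> uniq s ->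
    (forall lam, lam \in s -> Lam lam /\ `|lam - x| <= r) -> (size s)%:R <= K * r ^+ k.
Proof.
move=> c0 s00 mass.
have pi0 := pi_gt0 R.
(* With radius [rad = kap / r] and [kap <= w^-1], the phase of a frequency at distance at most [r]
   from [x] varies by at most [2 pi d r rad <= 1] from its value at [p]; the factor [d] comes from
   the maximum norm. *)
pose w := 2 * pi * d%:R + 1 : R.
have w0 : 0 < w by rewrite ltr_wpDl// mulr_ge0// mulr_ge0// ltW.
pose kap := Num.min s0 w^-1.
have kap0 : 0 < kap by rewrite lt_min s00 invr_gt0.
have cos10 := cos1_gt0 R.
exists (B / (cos 1 ^+ 2 * c * kap ^+ k)).
  by rewrite divr_gt0// !mulr_gt0// exprn_gt0.
move=> x r s r1 us sL.
have r0 : 0 < r by exact: lt_le_trans r1.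
pose rad := kap / r.
have rad0 : 0 < rad by rewrite divr_gt0.
have rads : rad <= s0.
  rewrite ler_pdivrMr//; apply: (@le_trans _ _ s0); first by rewrite ge_min lexx.
  by rewrite ler_peMr// ltW.
pose E : set (Rd R d) := [set y : V | `|y - p| < rad].
have mE : measurable E by exact: measurable_norm_ball.
have b1 : bmeas (\1_E : Rd R d -> R) by exact: bmeas_indic.
have ME : c * rad ^+ k <= fine (mu E).
  rewrite -lee_fin fineK; last exact: measure_fin_num.
  by apply: mass; rewrite rad0.
have crad : 0 < c * rad ^+ k by rewrite mulr_gt0// exprn_gt0.
have M0 : 0 < fine (mu E) by exact: lt_le_trans ME.
have := hB (L2fun_modulation hfin x b1); rewrite L2norm2_modulation//.
have -> : Rintegral mu setT (fun y => \1_E y ^+ 2) = fine (mu E).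
  rewrite (@eq_Rintegral _ _ _ mu setT (\1_E : Rd R d -> R)).
    by rewrite /Rintegral integral_indic// setIT.
  by move=> y _; rewrite indicE; case: (_ \in _); rewrite ?expr1n ?expr0n.
move=> Hb.
have Hs : \sum_(lam <- s) fcoef2 mu (fun y => \1_E y * cos (phase x y)) (fun y => \1_E y * sin (phase x y)) lam
    <= B * fine (mu E).
  rewrite -lee_fin EFinM; apply: le_trans Hb.
  apply: esum_ge_seq => // [lam|lam /sL[]//]; exact: fcoef2_ge0.
have Hl lam : lam \in s -> (cos 1 * fine (mu E)) ^+ 2 <=
    fcoef2 mu (fun y => \1_E y * cos (phase x y)) (fun y => \1_E y * sin (phase x y)) lam.
  move=> /sL[_ lx]; rewrite fcoef2_modulation//; apply: (indic_coef_ge (p := p) mE) => y yE.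
  rewrite /phase -mulrBr -dotRBr normrM gtr0_norm ?mulr_gt0//.
  apply: (@le_trans _ _ (2 * pi * (d%:R * r * rad))).
    rewrite ler_pM2l ?mulr_gt0// (le_trans (dotR_norm_le _ _))//.
    rewrite ler_pM ?mulr_ge0//; last exact: ltW.
    by rewrite ler_wpM2l// distrC.
  rewrite (_ : _ * _ = 2 * pi * d%:R * kap); last by rewrite /rad; field; rewrite gt_eqF.
  apply: (@le_trans _ _ (w * kap)); first by rewrite ler_pM2r// lerDl.
  by rewrite -(mulfV (lt0r_neq0 w0)) ler_pM2l// ge_min lexx orbT.
(* The left side is quadratic in [mu E], the right side linear. Dividing by [mu E] and using
   [mu E >= c (kap / r)^k] produces the factor [r^k]. *)
have : (size s)%:R * (cos 1 * fine (mu E)) ^+ 2 <= B * fine (mu E).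
  apply: le_trans Hs; rewrite mulr_natl -(count_predT s) -iter_addr_0 -big_const_seq.
  by rewrite big_seq [leRHS]big_seq; apply: ler_sum => lam /Hl.
rewrite exprMn [fine _ ^+ 2]expr2 !mulrA ler_pM2r// => H.
have {H} : (size s)%:R * cos 1 ^+ 2 * (c * rad ^+ k) <= B.
  apply: le_trans H; rewrite -[X in _ <= X * _]mulrA.
  by rewrite ler_wpM2l// mulr_ge0// sqr_ge0.
rewrite /rad expr_div_n !mulrA ler_pdivrMr ?exprn_gt0// => H.
rewrite mulrAC ler_pdivlMr ?mulr_gt0 ?exprn_gt0//.
by rewrite !mulrA.
Qed.

End bessel.

(** * Empty balls and dyadic sums *)

Section empty_ball.
Variables (R : realType) (d : nat).
Notation V := 'rV[R]_d.
Variables (Lam : set V) (k : nat) (K : R).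
Hypothesis K0 : 0 < K.
Hypothesis count : forall (x : V) (r : R) (s : seq V), 1 <= r -> uniq s ->
  (forall lam, lam \in s -> Lam lam /\ `|lam - x| <= r) -> (size s)%:R <= K * r ^+ k.

(* [L ^ d] disjoint balls of radius [r] fit in a ball of radius [2 r L], which
   contains at most [O(L ^ k)] points. *)
Lemma exists_empty_ball (r : R) : (k < d)%N -> 1 <= r ->
  exists xi, forall lam, Lam lam -> r <= `|lam - xi|.
Proof.
move=> kd r1; apply: contrapT => nE.
have r0 : 0 < r by exact: lt_le_trans r1.
have near xi : exists lam, Lam lam /\ `|lam - xi| < r.
  apply: contrapT => nL; apply: nE; exists xi => lam lL.
  by rewrite leNgt; apply/negP => lr; apply: nL; exists lam.
have {nE near} [pt ptP] := choice near.
pose D := K * (2 * r) ^+ k.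
have D0 : 0 <= D by rewrite mulr_ge0 ?exprn_ge0 ?mulr_ge0// ltW.
(* If every ball of radius [r] met [Lam], the count would give [L^d <= K (2 r L)^k = D L^k], while
   [D < L] and [k < d] give [D L^k < L^d]. *)
pose L := (Num.bound D).+1.
have DL : D < L%:R by rewrite (lt_trans (archi_boundP D0))// ltr_nat.
pose ctr (z : {ffun 'I_d -> 'I_L}) : V := \row_i (2 * r * (z i)%:R).
pose s := [seq pt (ctr z) | z <- enum {ffun 'I_d -> 'I_L}].
have inj : injective (pt \o ctr).
  move=> z z' /= E; apply/ffunP => i; apply/eqP; apply: contraT => zi.
  have : `|ctr z - ctr z'| < 2 * r.
    rewrite (_ : _ - _ = - (pt (ctr z) - ctr z) + (pt (ctr z) - ctr z')); last first.
      by rewrite opprB addrA subrK.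
    rewrite (le_lt_trans (ler_normD _ _))// normrN (_ : 2 * r = r + r); last by ring.
    by rewrite ltrD ?(ptP _).2// E (ptP _).2.
  rewrite ltNge => /negP[]; apply: le_trans (rV_norm_ge _ i).
  rewrite !mxE -mulrBr normrM ger0_norm ?mulr_ge0 ?(ltW r0)//.
  rewrite ler_peMr ?mulr_ge0 ?(ltW r0)//.
  have [h|h|h] := ltngtP (z i) (z' i).
  - by rewrite distrC -natrB ?(ltnW h)// normr_nat ler1n subn_gt0.
  - by rewrite -natrB ?(ltnW h)// normr_nat ler1n subn_gt0.
  - by rewrite (val_inj h) eqxx in zi.
have us : uniq s by rewrite map_inj_uniq ?enum_uniq.
have sz : size s = (L ^ d)%N by rewrite size_map -cardE card_ffun !card_ord.
have L1 : 1 <= L%:R :> R by rewrite ler1n.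
have rL : 1 <= 2 * r * L%:R by rewrite -[1]mul1r ler_pM//; lra.
have := count (x := 0) rL us.
have bnd lam : lam \in s -> Lam lam /\ `|lam - 0| <= 2 * r * L%:R.
  move=> /mapP[z _ ->]; split; first exact: (ptP _).1.
  rewrite subr0 -[pt _](subrK (ctr z)) (le_trans (ler_normD _ _))//.
  have h1 := ltW (ptP (ctr z)).2.
  have h2 : `|ctr z| <= 2 * r * (L.-1)%:R.
    apply: rV_norm_le => [|i]; first by rewrite !mulr_ge0 ?(ltW r0).
    rewrite mxE ger0_norm ?mulr_ge0 ?(ltW r0)//.
    by rewrite ler_pM2l ?mulr_gt0// ler_nat -ltnS.
  apply: le_trans (lerD h1 h2) _.
  rewrite (_ : L%:R = L.-1%:R + 1); last by rewrite natr1.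
  by rewrite mulrDr mulr1 addrC lerD2l; lra.
move=> /(_ bnd); rewrite sz natrX exprMn mulrA -/D => H.
have : L%:R ^+ k.+1 <= D * L%:R ^+ k.
  by apply: le_trans H; rewrite ler_weXn2l.
by rewrite exprS ler_pM2r ?exprn_gt0 ?(lt_le_trans _ L1)// leNgt DL.
Qed.

Variables (xi : V) (f : V -> R) (C : R) (J : nat).
Hypothesis C0 : 0 <= C.
Hypothesis k0 : (0 < k)%N.
Hypothesis far : forall lam, Lam lam -> 8 ^+ J <= `|lam - xi|.
Hypothesis fle : forall j lam, Lam lam -> 8 ^+ j <= `|lam - xi| -> f lam <= C / 16 ^+ (j * k).

Let D := C * K * 8 ^+ k.

(** At most [K 8^((j+1) k)] points, each contributing at most [C 16^(-j k)]: the product is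
    [D 2^(-j k)], and [k >= 1]. *)
Lemma dyadic_annulus_sum (j : nat) (s : seq V) : uniq s -> (forall lam, lam \in s -> Lam lam) ->
  \sum_(lam <- s | (`|lam - xi| < 8 ^+ j.+1) && (8 ^+ j <= `|lam - xi|)) f lam <= D / 2 ^+ j.
Proof.
move=> us sL.
pose P lam := (`|lam - xi| < 8 ^+ j.+1) && (8 ^+ j <= `|lam - xi|).
rewrite -big_filter -/P; set t := seq.filter P s.
have tP lam : lam \in t -> Lam lam /\ P lam by rewrite mem_filter => /andP[? /sL].
have a0 : 0 <= C / 16 ^+ (j * k) by rewrite divr_ge0// exprn_ge0.
have h : (size t)%:R <= K * (8 ^+ j.+1) ^+ k.
  apply: (count (x := xi)); first by rewrite exprn_ege1// ler1n.
    by rewrite filter_uniq.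
  by move=> lam /tP[? /andP[/ltW]].
apply: (@le_trans _ _ ((size t)%:R * (C / 16 ^+ (j * k)))).
  rewrite mulr_natl -(count_predT t) -iter_addr_0 -big_const_seq.
  rewrite big_seq [leRHS]big_seq; apply: ler_sum => lam /tP[? /andP[_ ?]].
  exact: fle.
apply: le_trans (ler_wpM2r a0 h) _.
have -> : K * (8 ^+ j.+1) ^+ k * (C / 16 ^+ (j * k)) = D * ((2 ^+ j) ^+ k)^-1.
  rewrite (_ : 16 = 8 * 2); last by ring.
  rewrite exprS exprMn exprM exprMn exprMn /D; field.
  by rewrite !expf_neq0.
rewrite ler_wpM2l ?mulr_ge0 ?exprn_ge0 ?(ltW K0)// lef_pV2 ?posrE ?exprn_gt0//.
by rewrite -{1}[2 ^+ j]expr1 ler_weXn2l// exprn_ege1// ler1n.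
Qed.

Lemma dyadic_sum_le (s : seq V) : uniq s -> (forall lam, lam \in s -> Lam lam) ->
  \sum_(lam <- s) f lam <= 2 * D / 2 ^+ J.
Proof.
move=> us sL.
have D0 : 0 <= D by rewrite !mulr_ge0 ?exprn_ge0// ltW.
(* The bound telescopes: the next annulus adds [D / 2^(J+i)], which is
   [2 D / 2^(J+i) - 2 D / 2^(J+i+1)]. By [far] the sum is empty at [i = 0]. *)
have ind i : \sum_(lam <- s | `|lam - xi| < 8 ^+ (J + i)) f lam <=
    2 * D / 2 ^+ J - 2 * D / 2 ^+ (J + i).
  elim: i => [|i IH].
    rewrite addn0 subrr big_seq_cond big_pred0// => lam.
    by apply/negbTE/negP => /andP[/sL/far]; rewrite leNgt => /negP.
  rewrite (bigID (fun lam => `|lam - xi| < 8 ^+ (J + i)))/=.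
  have e1 : \sum_(lam <- s | (`|lam - xi| < 8 ^+ (J + i.+1)) && (`|lam - xi| < 8 ^+ (J + i))) f lam
     = \sum_(lam <- s | `|lam - xi| < 8 ^+ (J + i)) f lam.
    apply: eq_bigl => lam; rewrite andb_idl// => /lt_le_trans; apply.
    by rewrite ler_weXn2l ?ler1n// leq_add2l.
  rewrite e1.
  have e2 : \sum_(lam <- s | (`|lam - xi| < 8 ^+ (J + i.+1)) && ~~ (`|lam - xi| < 8 ^+ (J + i))) f lam
     <= D / 2 ^+ (J + i).
    under eq_bigl do rewrite -leNgt; rewrite addnS; exact: dyadic_annulus_sum.
  apply: le_trans (lerD IH e2) _.
  rewrite addnS exprS; set x := _ / 2 ^+ J; set y := 2 ^+ (J + i).
  have y0 : y != 0 by rewrite expf_neq0.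
  by rewrite le_eqVlt; apply/orP; left; apply/eqP; field.
pose b := \sum_(lam <- s) `|lam - xi|.
have b0 : 0 <= b by exact: sumr_ge0.
(* Every distance in the list is at most [b], so the ball of radius [8 ^ (J + i)] contains the whole
   list. *)
pose i := Num.bound b.
have bi lam : lam \in s -> `|lam - xi| < 8 ^+ (J + i).
  move=> ls; apply: (@le_lt_trans _ _ b).
    by rewrite /b (big_rem lam)//= lerDl sumr_ge0.
  rewrite (lt_trans (archi_boundP b0))// -natrX ltr_nat.
  by rewrite (leq_ltn_trans (leq_addl J _))// ltn_expl.
have := ind i; rewrite big_seq_cond (eq_bigl (mem s)); last first.
  by move=> lam /=; rewrite andb_idr// => /bi.
rewrite -big_seq => H; apply: le_trans H _; rewrite gerBl.
by rewrite divr_ge0 ?exprn_ge0// mulr_ge0.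
Qed.

End empty_ball.

Section no_frame.
Variables (R : realType) (d k n : nat).
Notation V := 'rV[R]_d.
Variable mu : {measure set (Rd R d) -> \bar R}.
Hypothesis hfin : (mu setT < +oo)%E.

(* [g <= t g^2 + 1 / (4 t)] with [t = 1 + mu setT]. *)
Lemma density_L2_gt0 (g : Rd R d -> R) : bmeas g -> Rintegral mu setT g = 1 ->
  0 < Rintegral mu setT (fun x => g x ^+ 2).
Proof.
move=> bg g1; rewrite ltNge; apply/negP => le0.
have bg2 : bmeas (fun x => g x ^+ 2) by exact: bmeasM.
pose t := 1 + fine (mu setT).
have m0 : 0 <= fine (mu setT) by exact: fine_ge0.
have t0 : 0 < t by rewrite ltr_pwDl.
have : 1 <= t * Rintegral mu setT (fun x => g x ^+ 2) + (4 * t)^-1 * fine (mu setT).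
  rewrite -{1}g1 -RintegralZl//; last exact: bmeas_integrable_fin.
  have -> : (4 * t)^-1 * fine (mu setT) = Rintegral mu setT (fun=> (4 * t)^-1).
    by rewrite Rintegral_cst.
  have bc : bmeas ((fun=> (4 * t)^-1) : Rd R d -> R) by exact: bmeas_cst.
  have bt : bmeas (fun x => t * g x ^+ 2) by exact: bmeasZ.
  rewrite -RintegralD//; try exact: bmeas_integrable_fin.
  apply: le_Rintegral => //; try exact: bmeas_integrable_fin.
    by apply: bmeas_integrable_fin => //; exact: bmeasD.
  move=> x _; rewrite -subr_ge0.
  have -> : t * g x ^+ 2 + (4 * t)^-1 - g x = t * (g x - (2 * t)^-1) ^+ 2.
    by field; rewrite gt_eqF.
  by rewrite mulr_ge0 ?sqr_ge0// ltW.
have h1 : t * Rintegral mu setT (fun x => g x ^+ 2) <= 0 by rewrite pmulr_rle0.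
have h2 : (4 * t)^-1 * fine (mu setT) <= 4^-1.
  rewrite invfM -mulrA ger_pMr// mulrC ler_pdivrMr// mul1r /t.
  by rewrite lerDr.
move=> h; suff : (1 : R) <= 4^-1 by rewrite invf_ge1 //; lra.
by apply: le_trans h _; lra.
Qed.

(* Test the lower frame bound on the modulated density [g e_xi]; on the annulus
   [8 ^ j <= |lam - xi| < 8 ^ j.+1] use the decay with [dl = 4 ^- j]. *)
Theorem no_frame_of_decay (m : probability (Rd R d) R) (C0 C c s0 : R) (p : V) :
  (0 < k)%N -> (k < d)%N -> (2 * k <= n)%N ->
  0 < C0 -> (forall A, measurable A -> (m A <= C0%:E * mu A)%E) -> 0 < C ->
  (forall lam dl, 1 <= `|lam| -> 0 < dl <= 1 ->
    (Rintegral m setT (fun x => cos (phase lam x))) ^+ 2 +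
    (Rintegral m setT (fun x => sin (phase lam x))) ^+ 2 <=
    C * (dl ^+ n + (`|lam| * dl) ^- (4 * k))) ->
  0 < c -> 0 < s0 ->
  (forall s, 0 < s <= s0 -> ((c * s ^+ k)%:E <= mu [set x : V | (`|x - p| < s)%R])%E) ->
  ~ admits_fourier_frame mu.
Proof.
move=> k0 kd kn C00 mC C1 decay c0 s00 mass [Lam [_ [A [B [A0 B0 fr]]]]].
have [K K0 count] := bessel_count hfin B0 (fun u v h => (fr u v h).2) c0 s00 mass.
have [g [bg g0 gE]] := exists_density hfin C00 mC.
have g1 : Rintegral mu setT g = 1.
  have := gE (fun=> 1) (bmeas_cst _ 1); rewrite Rintegral_cst1 => /esym <-.
  by apply: eq_Rintegral => x _; rewrite mulr1.
pose I2 := Rintegral mu setT (fun x => g x ^+ 2).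
have I20 : 0 < I2 by exact: density_L2_gt0.
pose D := 2 * C * K * 8 ^+ k.
have D0 : 0 < D by rewrite !mulr_gt0 ?exprn_gt0.
(* The two frame estimates will give [A I2 <= 2 D / 2^J], that is [2^J <= e], against the choice of
   [J]. *)
pose e := 2 * D / (A * I2).
have e0 : 0 <= e by apply: divr_ge0; apply: mulr_ge0 => //; exact: ltW.
pose J := Num.bound e.
have [xi far] : exists xi, forall lam, Lam lam -> 8 ^+ J <= `|lam - xi|.
  by apply: (exists_empty_ball K0 count kd); rewrite exprn_ege1// ler1n.
have [lo _] := fr _ _ (L2fun_modulation hfin xi bg).
move: lo; rewrite L2norm2_modulation// -/I2 -EFinM.
set f := fcoef2 _ _ _ => lo.
have fle j lam : Lam lam -> 8 ^+ j <= `|lam - xi| -> f lam <= 2 * C / 16 ^+ (j * k).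
  move=> lL jl; rewrite /f fcoef2_modulation//.
  rewrite -!gE; try exact: bmeas_cos (measurable_phase _); try exact: bmeas_sin (measurable_phase _).
  have jl' : 8 ^+ j <= `|xi - lam| by rewrite distrC.
  have l1 : 1 <= `|xi - lam| by rewrite (le_trans _ jl')// exprn_ege1// ler1n.
  (* With [dl = 4^-j], the first term is [4^(-j n) <= 16^(-j k)] because [n >= 2 k], and the second
     is at most [(8^j / 4^j)^(-4 k) = 16^(-j k)]. *)
  have four : 0 < (4^-1 : R) ^+ j <= 1.
    by rewrite exprn_gt0// exprn_ile1// invf_le1//; lra.
  apply: le_trans (decay _ _ l1 four) _.
  rewrite (mulrC 2) -mulrA ler_pM2l// (_ : 2 / _ = (16 ^+ (j * k))^-1 + (16 ^+ (j * k))^-1); last first.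
    by rewrite -mulr2n mulr_natl.
  have e16 : 16 = 4 ^+ 2 :> R by ring.
  have e2 : 16 = 2 ^+ 4 :> R by ring.
  apply: lerD.
    rewrite -exprM exprVn lef_pV2 ?posrE ?exprn_gt0// e16 -exprM.
    by rewrite ler_weXn2l ?ler1n// mulnCA leq_mul2l kn orbT.
  rewrite lef_pV2 ?posrE ?exprn_gt0// ?mulr_gt0 ?exprn_gt0//; last exact: lt_le_trans l1.
  rewrite e2 -exprM (_ : 4 * (j * k) = j * (4 * k))%N; last by ring.
  rewrite exprM lerXn2r ?nnegrE ?exprn_ge0 ?mulr_ge0 ?exprn_ge0//.
  apply: (@le_trans _ _ (8 ^+ j * 4^-1 ^+ j)); last by rewrite ler_pM2r ?exprn_gt0.
  by rewrite -exprMn (_ : 8 * 4^-1 = 2 :> R)//; field.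
have hi : ((\esum_(lam in Lam) (f lam)%:E) <= (2 * D / 2 ^+ J)%:E)%E.
  apply: esum_le_seq => s us sL.
  have C2 : 0 <= 2 * C by rewrite mulr_ge0// ltW.
  exact: (dyadic_sum_le K0 count C2 k0 far fle us sL).
have := le_trans lo hi; rewrite lee_fin ler_pdivlMr ?exprn_gt0// mulrC -ler_pdivlMr ?mulr_gt0//.
rewrite -/e leNgt => /negP; apply.
by rewrite (lt_trans (archi_boundP e0))// -natrX ltr_nat ltn_expl.
Qed.

End no_frame.

(** * Curvature and the conclusion *)

Section curvature.
Variable R : realType.

Lemma orthogonal_line k d (B : 'M[R]_(k, d)) (g lam : 'rV[R]_d) :
  d = (1 + k)%N -> row_free B -> B *m g^T = 0 -> g != 0 -> B *m lam^T = 0 ->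
  exists c, lam = c *: g.
Proof.
move=> dk fB Bg g0 Bl; apply/sub_rVP.
have sub v : B *m v^T = 0 -> (v <= kermx B^T)%MS.
  by move=> Bv; apply/sub_kermxP; apply: trmx_inj; rewrite trmx_mul trmxK trmx0.
have rk : \rank (kermx B^T) = 1%N.
  rewrite mxrank_ker mxrank_tr; move/eqP: fB => ->.
  by rewrite dk addnK.
apply: (submx_trans (sub _ _ Bl)).
have /= := mxrank_leqif_sup (sub _ _ Bg).
by move=> H; rewrite -H.2 rk rank_rV g0.
Qed.

Lemma mulmx_trE d (x y : 'rV[R]_d) : x *m y^T = (dotR x y)%:M.
Proof.
apply/matrixP => i j; rewrite !ord1 !mxE eqxx mulr1n.
by apply: eq_bigr => a _; rewrite mxE.
Qed.

Lemma dotR_gt0 d (x : 'rV[R]_d) : x != 0 -> 0 < dotR x x.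
Proof.
move=> x0; have sq (i : 'I_d) (_ : true) : 0 <= x 0 i * x 0 i by rewrite -expr2 sqr_ge0.
rewrite lt_neqAle eq_sym sumr_ge0 ?andbT; last exact: sq.
apply: contra x0; rewrite /dotR psumr_eq0; last exact: sq.
move=> /allP x0; apply/eqP/rowP => i; rewrite [RHS]mxE.
by have := x0 i (mem_index_enum i); rewrite mulf_eq0 orbb => /eqP.
Qed.

(* [T - s n] is in the kernel: both [T] and [n] are mapped to multiples of [n]. *)
Lemma degenerate_det d (g n T t : 'rV[R]_d) (M DN : 'M[R]_d) (h c : R) :
  n = h *: g -> dotR n n = 1 -> dotR T n = 0 -> T != 0 ->
  DN = h *: M^T + g^T *m t -> T *m M = c *: g ->
  \det (DN *m (1%:M - n^T *m n) + n^T *m n) = 0.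
Proof.
move=> nE nn Tn T0 DNE TM.
have h0 : h != 0.
  apply/eqP => h0; move: nn; rewrite nE h0 scale0r /dotR big1 => [|i _]; last by rewrite mxE mul0r.
  by move/eqP; rewrite eq_sym oner_eq0.
(* [DN] sends [T] to [(h c + t . T) g], and [g = n / h]. *)
pose s := (h * c + dotR t T) / h.
have gE : g = h^-1 *: n by rewrite nE scalerA mulVf// scale1r.
have DNT : DN *m T^T = s *: n^T.
  rewrite DNE mulmxDl -scalemxAl -trmx_mul TM -mulmxA mulmx_trE mul_mx_scalar.
  rewrite linearZ /= scalerA -scalerDl gE linearZ /= scalerA; congr (_ *: _).
set Q := _ + _.
have Qn : Q *m n^T = n^T.
  rewrite /Q mulmxDl -!mulmxA mulmxBl mul1mx -mulmxA mulmx_trE nn.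
  by rewrite mulmx1 subrr mulmx0 add0r.
have nT : n *m T^T = 0.
  by rewrite -[LHS]trmxK trmx_mul trmxK mulmx_trE Tn raddf0 trmx0.
have QT : Q *m T^T = s *: n^T.
  by rewrite /Q mulmxDl -!mulmxA mulmxBl mul1mx -mulmxA nT !mulmx0 subr0 addr0.
pose w := T - s *: n.
have w0 : w != 0.
  apply/eqP => w0; have TE : T = s *: n by apply/eqP; rewrite -subr_eq0 -/w w0.
  move/eqP: T0; apply; move: Tn; rewrite TE /dotR => H.
  have : s * dotR n n = 0.
    by rewrite -H /dotR mulr_sumr; apply: eq_bigr => i _; rewrite mxE mulrA.
  by rewrite nn mulr1 => ->; rewrite scale0r.
have Qw : w *m Q^T = 0.
  apply: trmx_inj; rewrite trmx_mul trmxK trmx0 /w linearB linearZ /= mulmxBr.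
  by rewrite QT -scalemxAr Qn subrr.
rewrite -det_tr; apply/eqP/det0P.
by exists w.
Qed.

Variable d : nat.

Lemma is_derive_grad (U : set 'rV[R]_d) (f : 'rV[R]_d -> R) x b c :
  smooth_on U f -> U x ->
  is_derive x (ebase R b) ('D_(ebase R c) (f : _ -> R^o) : 'rV[R]_d -> R)
    ('D_(ebase R b) ('D_(ebase R c) (f : _ -> R^o) : _ -> R^o) x).
Proof. by move=> sf Ux; have [dl _] := sf [:: c] x Ux; split => //; exact: dl. Qed.

Lemma is_derive_sqrt_comp (q : 'rV[R]_d -> R) (x v : 'rV[R]_d) dq : 0 < q x ->
  is_derive x v q dq -> is_derive x v (fun x => Num.sqrt (q x)) (dq * (2 * Num.sqrt (q x))^-1).
Proof.
move=> q0; rewrite -{1}[x]addr0 -{1}(scale0r v) => /is_derive_line h; apply: is_derive_line0.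
have s0 : 0 < q (x + 0 *: v) by rewrite scale0r addr0.
have := @is_derive1_comp R Num.sqrt (fun s => q (x + s *: v)) 0 _ _ (is_derive1_sqrt s0) h.
by move=> k; apply: (is_derive_eq k); rewrite scale0r addr0 mulrC.
Qed.

(** The product rule for [h grad f], where [t] collects the derivatives of the normalising factor.
    The term with [t] takes values in the normal line, which is the shape that [degenerate_det]
    expects. *)
Lemma derive_gauss_map (U : set 'rV[R]_d) (f : 'rV[R]_d -> R) p :
  smooth_on U f -> U p -> gradF f p != 0 ->
  let h := (Num.sqrt (dotR (gradF f p) (gradF f p)))^-1 in
  exists t : 'rV[R]_d, forall a b,
  'D_(ebase R b) ((fun x => gauss_map f x 0 a) : _ -> R^o) p =
  h * 'D_(ebase R b) ('D_(ebase R a) (f : _ -> R^o) : _ -> R^o) p + gradF f p 0 a * t 0 b.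
Proof.
move=> sf Up g0 h.
pose q x := dotR (gradF f x) (gradF f x).
have q0 : 0 < q p by exact: dotR_gt0.
have [dq dqE] : exists dq : 'I_d -> R, forall b, is_derive p (ebase R b) q (dq b).
  pose G c := 'D_(ebase R c) (f : _ -> R^o) : 'rV[R]_d -> R.
  exists (fun b => \sum_c ((G c p) *: 'D_(ebase R b) (G c : _ -> R^o) p + (G c p) *: 'D_(ebase R b) (G c : _ -> R^o) p)) => b.
  rewrite (_ : q = \sum_c (G c \* G c)); last first.
    apply/funext => x; rewrite /q /dotR fct_sumE; apply: eq_bigr => c _.
    by rewrite !mxE.
  apply: is_derive_sum => c.
  exact: is_deriveM (is_derive_grad b c sf Up) (is_derive_grad b c sf Up).
pose hh x := (Num.sqrt (q x))^-1.
have [dh dhE] : exists dh : 'I_d -> R, forall b, is_derive p (ebase R b) hh (dh b).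
  eexists=> b; apply: is_derive_inv; last exact: (is_derive_sqrt_comp q0 (dqE b)).
  by rewrite gt_eqF// sqrtr_gt0.
exists (\row_b dh b) => a b.
rewrite (_ : (fun x => gauss_map f x 0 a) = (fun x => hh x * 'D_(ebase R a) (f : _ -> R^o) x)); last first.
  by apply/funext => x; rewrite !mxE.
have D := is_deriveM (dhE b) (is_derive_grad b a sf Up).
rewrite [LHS](@derive_val _ _ _ _ _ _ _ D) !mxE.
by [].
Qed.

(** Applied twice: to the defining function, where it says that the fields [X j] are tangent, and
    then to [grad F . X j], where it produces the second-order identity. *)
Lemma chart_derive_vanish k S p B X gam r rho L (ch : @chart R d k p S B X gam r rho L)
    (A : 'rV[R]_d -> R) (g : 'I_d -> 'rV[R]_d -> R) y j :
  (forall x a, `|x - p| < r -> is_derive x (ebase R a) A (g a x)) ->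
  (forall x a, `|x - p| < r -> {for x, continuous (g a)}) ->
  (forall y, `|y| < rho -> A (gam y) = 0) -> `|y| < rho ->
  \sum_a g a (gam y) * X j a (gam y) = 0.
Proof.
move=> dA cg A0 yr; have D := chart_derive ch j yr dA cg.
have D0 : is_derive y (ebase R j) (A \o gam) 0.
  apply: is_derive_epsdelta => e e0; exists (rho - `|y|); first by rewrite subr_gt0.
  move=> h hr; rewrite /= !A0 ?mulr0 ?subrr ?normr0 ?mulr_ge0// ?ltW//.
  rewrite (le_lt_trans (ler_normD _ _))// -ltrBrDr (le_lt_trans _ hr)//.
  rewrite normrZ ler_piMr// rV_norm_le// => i.
  by rewrite mxE eqxx /=; case: (_ == _); rewrite ?normr1 ?normr0.
by rewrite -(@derive_val _ _ _ _ _ _ _ D) (@derive_val _ _ _ _ _ _ _ D0).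
Qed.

(* A covector [lam] normal at [p] is a multiple of [g = grad F p].  Differentiating
   [g . X j = 0] along [gam] identifies the hypothesis on [u] with the vanishing
   of the second fundamental form on [(u B, X j)] for all [j]. *)
Lemma gauss_curv_nondegenerate k (M U W : set 'rV[R]_d) p (F : 'I_1 -> 'rV[R]_d -> R)
    B X gam r rho L : local_defining M p U F -> d = (1 + k)%N ->
  @chart R d k p (M `&` W) B X gam r rho L -> B *m (Defs.jacobian F p)^T = 0 ->
  row_free B -> [set x | `|x - p| < r] `<=` U ->
  gaussian_curvature (F ord0) p != 0 ->
  forall lam (u : 'rV[R]_k), lam != 0 -> u != 0 ->
    (forall j, dotR lam (field X j p) = 0) ->
    (forall j, \sum_i u 0 i * dotR lam
      (\row_c \sum_b 'D_(ebase R b) (X j c : _ -> R^o) p * X i b p) = 0) -> False.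
Proof.
move=> [oU Up MF sF rF] dk ch BJ fB rU K0 lam u lam0 u0 Hl Hz.
set f := F ord0 in K0.
have sf : smooth_on U f by exact: sF.
pose g := gradF f p.
pose G (a : 'I_d) : 'rV[R]_d -> R := 'D_(ebase R a) (f : _ -> R^o).
pose Mx : 'M[R]_d := \matrix_(b, a) ('D_(ebase R b) (G a : _ -> R^o) p : R).
have JE : Defs.jacobian F p = g.
  by apply/matrixP => i j; rewrite !ord1 !mxE.
have g0 : g != 0 by rewrite -mxrank_eq0 -JE rF.
rewrite JE in BJ.
have BX j a : B j a = X j a p by rewrite (chart_fieldp ch).
have Bl : B *m lam^T = 0.
  apply/matrixP => j i; rewrite ord1 [RHS]mxE -(Hl j) mxE /dotR.
  by apply: eq_bigr => a _; rewrite !mxE mulrC BX.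
have [c lamE] := orthogonal_line dk fB BJ g0 Bl.
have c0 : c != 0 by apply: contra lam0 => /eqP c0; rewrite lamE c0 scale0r.
have rho0 := chart_rho ch.
have r0 := chart_r ch.
have pr : `|p - p| < r by rewrite subrr normr0.
have z0 : `|0 : 'rV[R]_k| < rho by rewrite normr0.
have GC N a : Cn N [set x | `|x - p| < r] (G a).
  by apply: (CnS rU); apply: smooth_Cn; exact: smooth_derive.
pose H j x := \sum_a G a x * X j a x.
have H0 j y : `|y| < rho -> H j (gam y) = 0.
  move=> yr; apply: (chart_derive_vanish ch) yr => [x a xr|x a xr|y' yr'].
  - by have [dl _] := sf [::] x (rU x xr); split => //; exact: dl.
  - exact: Cn_continuous (GC 0%N a) x xr.
  - have [yp [My _]] := chart_in ch yr'.
    by apply: (MF _ (rU _ yp)).1.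
have HC N j : Cn N [set x | `|x - p| < r] (H j).
  by apply: Cn_sum => a; apply: CnM => //; exact: chart_field ch _ _ _.
have second i j : \sum_a g 0 a * (\sum_b 'D_(ebase R b) (X j a : _ -> R^o) p * X i b p)
    + \sum_a \sum_b Mx b a * X j a p * X i b p = 0.
  have [_ [dH [dHE CdH]]] := HC 1%N j.
  have E := chart_derive_vanish ch i dHE (fun x b => (CdH b).1 x) (H0 j) z0.
  rewrite (chart_base ch) in E; rewrite -[RHS]E.
  have dHp b : dH b p = \sum_a (g 0 a * 'D_(ebase R b) (X j a : _ -> R^o) p + Mx b a * X j a p).
    rewrite -[LHS](@derive_val _ _ _ _ _ _ _ (dHE p b pr)).
    have D a : is_derive p (ebase R b) (G a \* X j a)
        (g 0 a * 'D_(ebase R b) (X j a : _ -> R^o) p + Mx b a * X j a p).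
      have [_ [dX [dXE _]]] := chart_field ch 1%N j a.
      have DX := dXE p b pr.
      have DG := is_derive_grad b a sf (rU p pr).
      apply: (is_derive_eq (is_deriveM DG DX)).
      by rewrite (@derive_val _ _ _ _ _ _ _ DX) !mxE [X in _ + X]mulrC.
    rewrite (_ : H j = \sum_a (G a \* X j a)); last first.
      by apply/funext => x; rewrite /H fct_sumE.
    exact: (@derive_val _ _ _ _ _ _ _ (is_derive_sum D)).
  under [RHS]eq_bigr do rewrite dHp mulr_suml.
  rewrite [RHS]exchange_big -big_split /=; apply: eq_bigr => a _.
  rewrite mulr_sumr -big_split /=; apply: eq_bigr => b _.
  by rewrite mulrDl mulrA.
pose T := u *m B.
have T0 : T != 0.
  apply: contra u0 => /eqP T0; have /row_freeP[B' BB'] := fB.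
  by rewrite -[u]mulmx1 -BB' mulmxA -/T T0 mul0mx.
(* It suffices that [T *m Mx] annihilates every row of [B]; as [lam] is a non-zero multiple of [g],
   [second] converts [Hz] into this. *)
have [c' TM] : exists c', T *m Mx = c' *: g.
  apply: (orthogonal_line dk fB BJ g0).
  apply/matrixP => j i0; rewrite ord1 [RHS]mxE.
  have := Hz j.
  have e i : dotR lam (\row_c \sum_b 'D_(ebase R b) (X j c : _ -> R^o) p * X i b p) =
      - (c * \sum_a \sum_b Mx b a * X j a p * X i b p).
    rewrite lamE dotRZl -mulrN; congr (_ * _); apply/eqP; rewrite -addr_eq0; apply/eqP; rewrite -[RHS](second i j).
    by rewrite /dotR; congr (_ + _); apply: eq_bigr => a _; rewrite !mxE.
  under eq_bigr do rewrite e mulrN mulrCA -mulrN.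
  rewrite -mulr_sumr => /eqP; rewrite mulf_eq0 (negPf c0) /= sumrN oppr_eq0 => /eqP <-.
  rewrite mxE; under [RHS]eq_bigr do rewrite mulr_sumr; rewrite [RHS]exchange_big /=.
  apply: eq_bigr => a _; rewrite !mxE BX mulr_sumr.
  have TE b : T 0 b = \sum_i u 0 i * B i b by rewrite mxE.
  under [LHS]eq_bigr do rewrite TE mulr_suml mulr_sumr.
  rewrite exchange_big /=; apply: eq_bigr => i _; rewrite mulr_sumr; apply: eq_bigr => b _.
  by rewrite !BX mxE; ring.
have [t tE] := derive_gauss_map sf Up g0.
set h := (Num.sqrt _)^-1 in tE.
move/eqP: K0; apply; rewrite /gaussian_curvature.
apply: (degenerate_det (g := g) (T := T) (t := t) (M := Mx) (h := h) (c := c')) => //.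
- have q0 := dotR_gt0 g0.
  rewrite /gauss_map -/g dotRZr dotRZl mulrA -invfM -expr2 sqr_sqrtr ?ltW//.
  by rewrite mulVf// gt_eqF.
- have : T *m g^T = 0 by rewrite /T -mulmxA BJ mulmx0.
  rewrite mulmx_trE dotRZr => /matrixP/(_ 0 0); rewrite !mxE eqxx mulr1n => ->.
  by rewrite mulr0.
- by apply/matrixP => a b; rewrite [LHS]mxE tE !mxE big_ord1 !mxE.
Qed.

End curvature.

(** * The decaying law dominated by the measure *)

Section chart_law.
Variable R : realType.

(** A bound valid for each [v] in a set of full measure survives averaging over [v]; this passes
    from the law with [v] frozen to the law of [gam (a (w + v))]. *)
Lemma product_law_le d1 d2 d3 (T1 : measurableType d1) (T2 : measurableType d2)
    (T3 : measurableType d3) (P : probability T1 R) (Q : probability T2 R)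
    (X : T1 * T2 -> T3) (D : set T2) (A : set T3) (b : R) :
  measurable_fun setT X -> measurable D -> Q D = 1%E -> measurable A ->
  (forall v, D v -> (P [set w | A (X (w, v))] <= b%:E)%E) ->
  ((P \x Q)%E (X @^-1` A) <= b%:E)%E.
Proof.
move=> mX mD QD mA H; set E := X @^-1` A.
have mE : measurable E by rewrite -[E]setTI; exact: mX.
have b1 : bmeas (\1_E : _ -> R) by exact: bmeas_indic.
rewrite -[leLHS]fineK; last by apply: (@fin_num_measure _ _ _ (P \x Q : probability _ R)%E).
rewrite lee_fin (_ : fine _ = Rintegral (P \x Q)%E setT (\1_E : _ -> R)); last first.
  by rewrite /Rintegral integral_indic// setIT.
rewrite Rintegral_prod2//; apply: (Rintegral_le_ae mD QD) => [|v Dv].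
  apply: (@bmeas_Rintegral1 _ _ _ _ _ P (fun z => \1_E (z.2, z.1))).
  apply: (@bmeas_comp _ _ _ _ _ (fun z => (z.2, z.1)) _ _ b1).
  by apply: measurable_fun_pair; [exact: measurable_snd|exact: measurable_fst].
have mEv : measurable [set w | A (X (w, v))].
  have mXv : measurable_fun setT (fun w => X (w, v)).
    by apply: (measurableT_comp mX); exact: pair2_measurable.
  by rewrite -[X in measurable X]setTI; exact: mXv.
rewrite (@eq_Rintegral _ _ _ P setT (\1_[set w | A (X (w, v))])); last first.
  by move=> w _; rewrite !indicE.
by rewrite /Rintegral integral_indic// setIT -lee_fin fineK ?fin_num_measure// H.
Qed.

Lemma chart_law d k p S B X gam r rho L N (O : set 'rV[R]_d)
    (mu : {measure set (Rd R d) -> \bar R}) :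
  @chart R d k p S B X gam r rho L -> S `<=` O ->
  (forall (lam : 'rV[R]_d) (u : 'rV[R]_k), lam != 0 -> u != 0 ->
    (forall j, dotR lam (field X j p) = 0) ->
    (forall j, \sum_i u 0 i * dotR lam
       (\row_c \sum_b 'D_(ebase R b) (X j c : _ -> R^o) p * X i b p) = 0) -> False) ->
  (mu setT < +oo)%E ->
  (forall A : set (Rd R d), measurable A -> (hausdorff k (A `&` O) <= mu A)%E) ->
  exists (m : probability (Rd R d) R) C0 C, [/\ 0 < C0,
    forall A, measurable A -> (m A <= C0%:E * mu A)%E, 0 < C &
    forall lam dl, 1 <= `|lam| -> 0 < dl <= 1 ->
    (Rintegral m setT (fun x => cos (phase lam x))) ^+ 2 +
    (Rintegral m setT (fun x => sin (phase lam x))) ^+ 2 <=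
    C * (dl ^+ k + (`|lam| * dl) ^- N)].
Proof.
move=> ch SO Hnd hfin hmu.
have [a [a0 ar dec]] := chart_decay N ch Hnd.
have [G [cG GE [C0 C00 law]]] := chart_law_le_hausdorff ch SO a0 ar.
have [C C1 {}dec] := dec G cG GE.
pose X0 (z : Rd R k * Rd R k) : Rd R d := G (a *: ((z.1 : 'rV[R]_k) + z.2)).
have mX : measurable_fun setT X0 by exact: measurable_add_comp.
pose Xm : {mfun _ >-> _} := mfun_Sub (mem_set mX).
pose P := powprob (@unif01 R) k; pose Q := powprob (betaN R N) k.
pose m : probability (Rd R d) R := distribution (P \x Q : probability _ R)%E Xm.
exists m, C0, C; split => // [A mA|lam dl lam1 dl1].
  have mcube : measurable (@cube R k : set (Rd R k)).
    exact: (@measurable_rV_box _ k (fun=> `[0, 1]%classic)).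
  have Qcube : Q (@cube R k) = 1%E.
    by apply: powprob_cube; [exact: measurable_itv|exact: beta_prob01].
  have fA : mu A \is a fin_num by exact: measure_fin_num.
  rewrite -(fineK fA) -EFinM.
  apply: (@product_law_le _ _ _ _ _ _ P Q X0 _ A (C0 * fine (mu A)) mX mcube Qcube mA) => v Dv.
  apply: le_trans (law v A Dv mA) _; rewrite EFinM fineK//.
  by apply: lee_wpmul2l (hmu A mA); rewrite lee_fin ltW.
rewrite /m !Rintegral_distribution; first exact: dec.
- by apply: bmeas_sin; exact: measurable_phase.
- by apply: bmeas_cos; exact: measurable_phase.
Qed.

End chart_law.

Lemma hausdorff_ge0 (R : realType) (d s : nat) (A : set 'rV[R]_d) : (0 <= hausdorff s A)%E.
Proof.
apply: (@le_trans _ _ (hausdorff_delta s 1 A)); last first.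
  by apply: ereal_sup_ubound; exists 1 => //=; exact: ltr01.
apply: le_ereal_inf_tmp => _ [C _ <-].
apply: nneseries_ge0 => n _ _; rewrite lee_fin mulr_ge0 ?exprn_ge0 ?fine_ge0//.
  by rewrite divr_ge0 ?exprn_ge0// ltW// ball_vol_gt0.
by apply: ereal_sup_ubound; left.
Qed.

Theorem theorem3p4 (R : realType) (d k : nat)
  (hd : (3 <= d)%N) (hk1 : (1 <= k)%N) (hk2 : (k <= (d - 1)./2)%N)
  (M1 U1 M2 Omega : set 'rV[R]_d)
  (hM1 : smooth_submanifold k M1) (hU1 : rel_open_nonempty M1 U1)
  (hM2 : smooth_submanifold (d - 1) M2) (hOm : rel_open_nonempty M2 Omega)
  (hK : nonzero_gauss_curv_in M2 Omega)
  (mu : {measure set (Rd R d) -> \bar R})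
  (hmu : forall A : set (Rd R d), measurable A ->
     mu A = (hausdorff k (A `&` U1) + hausdorff (d - 1) (A `&` Omega))%E)
  (hfin : (mu setT < +oo)%E) :
  ~ admits_fourier_frame mu.
Proof.
have k2 : (2 * k <= d - 1)%N by rewrite mul2n -geq_half_double.
have kd : (k < d)%N by lia.
(* The two charts sit at unrelated points: any [q] in [U1] serves for the count of frequencies,
   while [p] below is the point of non-zero curvature. *)
have [[q U1q] [W1 [oW1 U1E]]] := hU1.
have [M1q W1q] : M1 q /\ W1 q by move: U1q; rewrite U1E.
have [V1 [F1 def1]] := hM1.2 q M1q.
have dk : d = (d - k + k)%N by rewrite subnK// ltnW.
have [B1 [X1 [gam1 [r1 [rho1 [L1 [ch1 _ _ _]]]]]]] := exists_chart def1 M1q dk oW1 W1q.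
have S1 : M1 `&` W1 `<=` U1 by rewrite U1E.
have [c [s0 [c0 s00 mass]]] := chart_mass_ge ch1 S1.
have [p [Op [V2 [F2 [def2 K0]]]]] := hK.
have [_ [W2 [oW2 OE]]] := hOm.
have [M2p W2p] : M2 p /\ W2 p by move: Op; rewrite OE.
have d1 : d = (1 + (d - 1))%N by lia.
have [B2 [X2 [gam2 [r2 [rho2 [L2 [ch2 BJ fB rV]]]]]]] := exists_chart def2 M2p d1 oW2 W2p.
have S2 : M2 `&` W2 `<=` Omega by rewrite OE.
(* Both summands of [mu] are nonnegative, so each is dominated by [mu]: this one for the law on
   [Omega], the other for the mass of balls at [q]. *)
have hO A : measurable (A : set (Rd R d)) -> (hausdorff (d - 1) (A `&` Omega) <= mu A)%E.
  by move=> mA; rewrite hmu// leeDr// hausdorff_ge0.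
have Hnd := gauss_curv_nondegenerate def2 d1 ch2 BJ fB rV K0.
have [m [C0 [C [C00 mC C1 dec]]]] := chart_law (4 * k) ch2 S2 Hnd hfin hO.
apply: (no_frame_of_decay hfin (n := d - 1) hk1 kd k2 C00 mC C1 dec c0 s00 (p := q)) => s sI.
apply: le_trans (mass s sI) _; rewrite hmu; last exact: measurable_norm_ball.
by rewrite leeDl// hausdorff_ge0.
Qed.
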